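(* Consider the federated problem, the functions $\mathsf T$, $\mathsf h_i$, $\mathsf h$, the algorithm FedMM, and its output $\{\hat S_t, t\ge 0\}$ described in the context. Assume the following. (1) $\mathrm{int}\,\Theta\neq\emptyset$, $\psi$ and $\phi$ are $\mathcal C^1$ on $\mathrm{int}\,\Theta$, and for any $s\in\mathcal S$ the function $\theta\mapsto\psi(\theta)-\langle s,\phi(\theta)\rangle$ is convex. (2) $f$ is $\mathcal C^1$ on $\mathrm{int}\,\Theta$. (3) (Oracles) For all $t\ge0$, conditionally on $\mathcal F_t$ the oracles $\mathsf S_{t+1,1},\dots,\mathsf S_{t+1,n}$ are independent; for each $i\in[n]$, $\mathbb E[\mathsf S_{t+1,i}\mid\mathcal F_t]=\mathbb E_{\pi_i}[\bar S(Z,\mathsf T(\hat S_t))]$, and there is $\sigma_i^2>0$ such that for all $t\ge0$, $\mathbb E\big[\|\mathsf S_{t+1,i}-\mathbb E_{\pi_i}[\bar S(Z,\mathsf T(\hat S_t))]\|^2\mid\mathcal F_t\big]\le\sigma_i^2$. (4) (Compression) For all $s\in\mathbb R^q$, the random variables $\{\mathrm{Quant}_{t+1,i}(s), t\ge0,i\in[n]\}$ are i.i.d. with the distribution of $\mathrm{Quant}(s)$; there is $\omega\ge0$ such that $\mathbb E[\mathrm{Quant}(s)]=s$ and $\mathbb E[\|\mathrm{Quant}(s)-s\|^2]\le\omega\|s\|^2$ for all $s\in\mathbb R^q$; each compression is applied independently of any other randomness in the past of the algorithm. (5) (Participation) For some $\mathsf p\in(0,1]$, at each step each worker is selected with probability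 $\mathsf p$, independently of the past and of the other workers. (6) For all $i\in[n]$, $\mathsf h_i$ is globally $L_i$-Lipschitz on $\mathcal S$; and $\sup_{\mathcal S}\|\mathsf h(\cdot)\|<\infty$. (7) There exist positive constants $C_\star, C_{\star\star}$ and, for any $s\in\mathcal S$, a $q\times q$ positive-definite matrix $\mathsf B(s)$ such that for all $s,s'\in\mathcal S$, $$\|\phi(\mathsf T(s'))-\phi(\mathsf T(s))-\mathsf B(s)(s'-s)\|\le C_\star\|s'-s\|^2,\qquad |\langle s'-s,\phi(\mathsf T(s'))-\phi(\mathsf T(s))\rangle|\le C_{\star\star}\|s'-s\|^2;$$ and there exist $0<v_{\min}\le v_{\max}$ such that $v_{\min}\|u\|^2\le u^\top\mathsf B(s)u\le v_{\max}\|u\|^2$ for all $s\in\mathcal S$, $u\in\mathbb R^q$. (8) $\mathcal S$ is a closed convex subset of $\mathbb R^q$, and in FedMM $\mathsf B_t:=\mathsf B(\hat S_t)$. Set $$\omega_{\mathsf p}:=\omega+(1+\omega)\frac{1-\mathsf p}{\mathsf p},\quad \bar C:=C_{\star\star}+C_\star\sup_{\mathcal S}\|\mathsf h(\cdot)\|,\quad \sigma^2:=n\sum_{i=1}^n\mu_i^2\sigma_i^2,\quad L^2:=n\sum_{i=1}^n\mu_i^2L_i^2,$$ and for $t\ge0$ $$\bar{\mathcal E}_{t+1}:=\frac{\|\Pi(\hat S_t+\gamma_{t+1}\mathsf h(\hat S_t),\mathsf B_t)-\hat S_t\|_{\mathsf B_t}^2}{\gamma_{t+1}^2}.$$ (A)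 Case $\omega_{\mathsf p}=0$. If FedMM is run with $\alpha\in[0,1]$ and step sizes $\gamma_{t+1}\in(0,v_{\min}/(2\bar C))$, then for any positive integer $T$ $$\sum_{t=1}^T\frac{\gamma_t}{4}\Big(1-\frac{2\bar C}{v_{\min}}\gamma_t\Big)\mathbb E[\bar{\mathcal E}_t]\le\mathbb E\big[(f+g)(\mathsf T(\hat S_0))-\min(f+g)\big]+v_{\max}\frac{\sigma^2}{n}\sum_{t=1}^T\gamma_t.$$ (B) Case $\omega_{\mathsf p}>0$. If FedMM is run with $\alpha\in(0,1/(1+\omega_{\mathsf p})]$ and positive step sizes satisfying, for all $t\ge 1$, $$\gamma_{t+1}\le\gamma_t\le\gamma_1,\qquad 1-\frac{2\bar C}{v_{\min}}\gamma_t-64\frac{\omega_{\mathsf p}}{\alpha^2}\frac{v_{\max}}{v_{\min}}\frac{L^2}{n}\gamma_t^2>0,\qquad \gamma_1\le\frac{\alpha}{4\sqrt{\omega_{\mathsf p}}}\frac{\sqrt{v_{\min}}}{\sqrt{v_{\max}}}\frac{\sqrt n}{L},$$ then for any positive integer $T$ $$\sum_{t=1}^T\frac{\gamma_t}{4}\Big(1-\frac{2\bar C}{v_{\min}}\gamma_t-64\frac{\omega_{\mathsf p}}{\alpha^2}\frac{v_{\max}}{v_{\min}}\frac{L^2}{n}\gamma_t^2\Big)\mathbb E[\bar{\mathcal E}_t]\le\mathbb E\big[(f+g)(\mathsf T(\hat S_0))-\min(f+g)\big]+\frac{4\omega_{\mathsf p}v_{\max}}{\alpha}\gamma_1\sum_{i=1}^n\mu_i^2\mathbb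 E\big[\|V_{0,i}-\mathsf h_i(\hat S_0)\|^2\big]+2v_{\max}(1+5\omega_{\mathsf p})\frac{\sigma^2}{n}\sum_{t=1}^T\gamma_t.$$
   Context: Notation. $\langle\cdot,\cdot\rangle$ and $\|\cdot\|$ are the Euclidean scalar product and norm; $[n]=\{1,\dots,n\}$. For a (symmetric) positive-definite $q\times q$ matrix $\mathsf B$, $\|u\|_{\mathsf B}:=\sqrt{u^\top\mathsf B u}$ and $\Pi(\hat s,\mathsf B):=\mathrm{argmin}_{s\in\mathcal S}(s-\hat s)^\top\mathsf B(s-\hat s)$ for $\hat s\in\mathbb R^q$. Problem. $g:\mathbb R^d\to(-\infty,+\infty]$ is proper, lower semicontinuous, convex with domain $\Theta\subseteq\mathbb R^d$; $\ell:\mathbb R^p\times\Theta\to\mathbb R$ is measurable; $\pi_1,\dots,\pi_n$ are probability measures on $\mathbb R^p$; $\mu_i>0$, $\sum_{i=1}^n\mu_i=1$; $\pi:=\sum_i\mu_i\pi_i$; $f_i(\theta):=\mathbb E_{\pi_i}[\ell(Z,\theta)]$ (assumed finite, with $\mathbb E_{\pi_i}|\ell(Z,\theta)|<\infty$) and $f:=\sum_i\mu_if_i$. The problem is to minimize $f+g$; $\min(f+g)$ denotes the minimal value, assumed to exist. Majorize-Minimization framework (standing). There exist a convex set $\mathcal S\subseteq\mathbb R^q$ and measurable functions $\bar S:\mathbb R^p\times\Theta\to\mathcal S$, $\psi:\Theta\to\mathbb R$, $\phi:\Theta\to\mathbb R^q$ such that for every $\tau\in\Theta$, $\mathbb E_\pi[\|\bar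 S(Z,\tau)\|]<\infty$ and $$f(\theta)\le f(\tau)+\psi(\theta)-\psi(\tau)-\langle\mathbb E_\pi[\bar S(Z,\tau)],\phi(\theta)-\phi(\tau)\rangle\quad\text{for all }\theta\in\Theta.$$ The map $\mathsf T:\mathcal S\to\Theta$, $\mathsf T(s):=\mathrm{argmin}_{\theta\in\mathbb R^d}(g(\theta)+\psi(\theta)-\langle s,\phi(\theta)\rangle)$, is well defined (unique minimizer for every $s\in\mathcal S$) and measurable. Define on $\mathcal S$: $\mathsf h_i(s):=\mathbb E_{\pi_i}[\bar S(Z,\mathsf T(s))]-s$ and $\mathsf h(s):=\mathbb E_\pi[\bar S(Z,\mathsf T(s))]-s=\sum_i\mu_i\mathsf h_i(s)$. Algorithm FedMM. Inputs: $\alpha\geq 0$, $\mathsf p\in(0,1]$, step sizes $\gamma_t\in(0,1]$, initial values $\hat S_0\in\mathcal S$, $V_{0,i}\in\mathbb R^q$ ($i\in[n]$); set $V_0:=\sum_i\mu_iV_{0,i}$. For $t=0,1,\dots$: a random set $\mathcal A_{t+1}\subseteq[n]$ of active workers is sampled; each active worker $i\in\mathcal A_{t+1}$ samples a random vector $\mathsf S_{t+1,i}$ (an oracle for $\mathbb E_{\pi_i}[\bar S(Z,\mathsf T(\hat S_t))]$), sets $\Delta_{t+1,i}:=\mathsf S_{t+1,i}-\hat S_t-V_{t,i}$ and $V_{t+1,i}:=V_{t,i}+\frac{\alpha}{\mathsf p}\mathrm{Quant}_{t+1,i}(\Delta_{t+1,i})$, where $\mathrm{Quant}_{t+1,i}$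 is a random compression operator $\mathbb R^q\to\mathbb R^q$; for $i\notin\mathcal A_{t+1}$, $V_{t+1,i}:=V_{t,i}$. The server sets $H_{t+1}:=V_t+\frac1{\mathsf p}\sum_{i\in\mathcal A_{t+1}}\mu_i\mathrm{Quant}_{t+1,i}(\Delta_{t+1,i})$, $\hat S_{t+1}:=\Pi(\hat S_t+\gamma_{t+1}H_{t+1},\mathsf B_t)$ for a positive-definite matrix $\mathsf B_t$, and $V_{t+1}:=V_t+\frac{\alpha}{\mathsf p}\sum_{i\in\mathcal A_{t+1}}\mu_i\mathrm{Quant}_{t+1,i}(\Delta_{t+1,i})$. Oracles $\mathsf S_{t+1,i}$ and $\Delta_{t+1,i}$ may be regarded as defined for all $i\in[n]$ (unused for inactive workers); with $U_{t+1,i}:=\mathbf 1_{i\in\mathcal A_{t+1}}$ and $\widetilde{\mathrm{Quant}}_{t+1,i}(s):=\frac{U_{t+1,i}}{\mathsf p}\mathrm{Quant}_{t+1,i}(s)$. Filtration. $\mathcal F_0:=\sigma(\hat S_0,V_{0,i},i\in[n])$ and $\mathcal F_{t+1}:=\mathcal F_t\vee\sigma(\mathsf S_{t+1,i},\widetilde{\mathrm{Quant}}_{t+1,i}(\Delta_{t+1,i}),i\in[n])$. The compression and selection randomness at iteration $t+1$ is independent of $\mathcal F_t$ and of the oracles $\mathsf S_{t+1,\cdot}$, and the selection is independent of the compression. Measurability of $s\mapsto\mathsf B(s)$ is understood. *)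

(* Defs.v *)
From HB Require Import structures.
From mathcomp Require Import all_boot all_order all_algebra.
From mathcomp Require Import all_classical all_reals all_analysis.
Import Order.TTheory GRing.Theory Num.Theory.
Import numFieldNormedType.Exports.

Set Implicit Arguments.
Unset Strict Implicit.
Unset Printing Implicit Defensive.

Local Open Scope classical_set_scope.
Local Open Scope ring_scope.

(* Every space of matrices carries its Borel sigma-algebra; R^k is 'cV[R]_k. *)
HB.instance Definition _ (R : realType) (m k : nat) :=
  Measurable.copy 'M[R]_(m, k) (g_sigma_algebraType (@open 'M[R]_(m, k))).

Section euclidean.
Context {R : realType}.

Definition edot {k} (u v : 'cV[R]_k) : R := \sum_j u j 0 * v j 0.

(* The library norm `|u| of a matrix is the sup norm. *)
Definition enorm {k} (u : 'cV[R]_k) : R := Num.sqrt (edot u u).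

Definition qform {k} (B : 'M[R]_k) (u : 'cV[R]_k) : R := (u^T *m B *m u) 0 0.

Definition bnorm {k} (B : 'M[R]_k) (u : 'cV[R]_k) : R := Num.sqrt (qform B u).

Definition posdef {k} (B : 'M[R]_k) : Prop :=
  B^T = B /\ forall u, u != 0 -> 0 < qform B u.

Definition argmin_on {T : Type} {disp} {U : porderType disp} (D : set T)
    (F : T -> U) : set T :=
  [set x | D x /\ forall y, D y -> (F x <= F y)%O].

Definition bproj {k} (D : set 'cV[R]_k) (s : 'cV[R]_k) (B : 'M[R]_k) :
    'cV[R]_k :=
  xget 0 (argmin_on D (fun u => qform B (u - s))).

Definition vmean {d} {E : measurableType d} {k}
    (mu : {measure set E -> \bar R}) (X : E -> 'cV[R]_k) : 'cV[R]_k :=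
  \col_j \int[mu]_z X z j 0.

(* The value at t = 0 and t = 1 is left out because it is automatic. *)
Definition econvex {k} (g : 'cV[R]_k -> \bar R) : Prop :=
  forall (x y : 'cV[R]_k) (t : R), 0 < t < 1 ->
    (g (t *: x + (1 - t) *: y)%R <= t%:E * g x + (1 - t)%:E * g y)%E.

(* Meant for open A, where continuity of y |-> 'D_v f y at the points of A
   only involves points of A. *)
Definition C1_on {V W : normedModType R} (A : set V) (f : V -> W) : Prop :=
  (forall x, A x -> differentiable f x) /\
  forall v x, A x -> {for x, continuous (fun y => 'D_v f y)}.

End euclidean.

Section probability_notions.
Context {R : realType} {dO : measure_display} {Omega : measurableType dO}.
Variable P : probability Omega R.

Definition sigma_rv {d} {E : measurableType d} (X : Omega -> E) :
    set (set Omega) :=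
  preimage_set_system setT X measurable.

Definition mutual_indep {I : eqType} (G : I -> set (set Omega)) : Prop :=
  forall (J : seq I) (A : I -> set Omega), uniq J ->
    (forall i, i \in J -> G i (A i)) ->
    P (\bigcap_(i in [set` J]) A i) = (\prod_(i <- J) P (A i))%E.

(* Y is a version of E[X | G], for an integrable X. *)
Definition is_cond_exp (G : set (set Omega)) (X Y : Omega -> R) : Prop :=
  [/\ P.-integrable setT (EFin \o X),
      sigma_rv Y `<=` G &
      forall A, G A -> (\int[P]_(w in A) (X w)%:E = \int[P]_(w in A) (Y w)%:E)%E].

Definition is_cond_vexp {k} (G : set (set Omega)) (X Y : Omega -> 'cV[R]_k) :
    Prop :=
  forall j, is_cond_exp G (fun w => X w j 0) (fun w => Y w j 0).

(* P(X_i in A_i for all i | G) is the product of the P(X_i in A_i | G), almost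
   surely; taking some A_i equal to setT gives the subfamilies. *)
Definition cond_indep {d} {E : measurableType d} {n} (G : set (set Omega))
    (X : 'I_n -> Omega -> E) : Prop :=
  forall A : 'I_n -> set E, (forall i, measurable (A i)) ->
    exists Y : 'I_n -> Omega -> R,
      (forall i, is_cond_exp G \1_(X i @^-1` A i) (Y i)) /\
      is_cond_exp G \1_(\bigcap_i (X i @^-1` A i)) (fun w => \prod_i Y i w).

End probability_notions.

Record mm_data (R : realType) (n p d q : nat) := MMData {
  mm_g : 'cV[R]_d -> \bar R;
  mm_ell : 'cV[R]_p -> 'cV[R]_d -> R;
  mm_pi : 'I_n -> probability 'cV[R]_p R;
  mm_mu : 'I_n -> R;
  mm_mix : probability 'cV[R]_p R;
  mm_S : set 'cV[R]_q;
  mm_Sbar : 'cV[R]_p -> 'cV[R]_d -> 'cV[R]_q;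
  mm_psi : 'cV[R]_d -> R;
  mm_phi : 'cV[R]_d -> 'cV[R]_q;
  mm_T : 'cV[R]_q -> 'cV[R]_d
}.

(* Functions given on Theta (ell, Sbar, psi, phi) or on S (T) are total; their
   values outside are never used, g being +oo outside Theta. *)
Section mm.
Context {R : realType} {n p d q : nat}.
Variable M : mm_data R n p d q.

Definition mm_Theta : set 'cV[R]_d := [set th | mm_g M th < +oo]%E.

Definition mm_fi (i : 'I_n) (th : 'cV[R]_d) : R :=
  \int[mm_pi M i]_z mm_ell M z th.

Definition mm_f (th : 'cV[R]_d) : R := \sum_i mm_mu M i * mm_fi i th.

Definition mm_obj (th : 'cV[R]_d) : \bar R := ((mm_f th)%:E + mm_g M th)%E.

Definition mm_surrogate (s : 'cV[R]_q) (th : 'cV[R]_d) : \bar R :=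
  (mm_g M th + (mm_psi M th - edot s (mm_phi M th))%:E)%E.

Definition mm_hi (i : 'I_n) (s : 'cV[R]_q) : 'cV[R]_q :=
  vmean (mm_pi M i) (fun z => mm_Sbar M z (mm_T M s)) - s.

Definition mm_h (s : 'cV[R]_q) : 'cV[R]_q :=
  vmean (mm_mix M) (fun z => mm_Sbar M z (mm_T M s)) - s.

Record federated_problem : Prop := FederatedProblem {
  fp_g_ninfty : forall th, mm_g M th != -oo%E;
  fp_g_proper : mm_Theta !=set0;
  fp_g_lsc : lower_semicontinuous (mm_g M);
  fp_g_convex : econvex (mm_g M);
  fp_ell_meas :
    measurable_fun (setT `*` mm_Theta) (fun x => mm_ell M x.1 x.2);
  fp_ell_int : forall i th, mm_Theta th ->
    (mm_pi M i).-integrable setT (EFin \o mm_ell M ^~ th);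
  fp_mu_gt0 : forall i, 0 < mm_mu M i;
  fp_mu_sum : \sum_i mm_mu M i = 1;
  fp_mix : forall A, measurable A ->
    mm_mix M A = (\sum_i (mm_mu M i)%:E * mm_pi M i A)%E
}.

Record mm_framework : Prop := MMFramework {
  mf_S_convex : convex_set (mm_S M);
  mf_Sbar_S : forall z th, mm_Theta th -> mm_S M (mm_Sbar M z th);
  mf_Sbar_meas :
    measurable_fun (setT `*` mm_Theta) (fun x => mm_Sbar M x.1 x.2);
  mf_psi_meas : measurable_fun mm_Theta (mm_psi M);
  mf_phi_meas : measurable_fun mm_Theta (mm_phi M);
  mf_Sbar_int : forall tau, mm_Theta tau ->
    (mm_mix M).-integrable setT (fun z => (enorm (mm_Sbar M z tau))%:E);
  mf_majorize : forall tau th, mm_Theta tau -> mm_Theta th ->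
    mm_f th <= mm_f tau + mm_psi M th - mm_psi M tau
      - edot (vmean (mm_mix M) (mm_Sbar M ^~ tau)) (mm_phi M th - mm_phi M tau);
  mf_T_argmin : forall s, mm_S M s ->
    argmin_on setT (mm_surrogate s) = [set mm_T M s];
  mf_T_meas : measurable_fun (mm_S M) (mm_T M)
}.

End mm.

(* Iteration t.+1 uses the entries of index t.+1; those of index 0 are unused.
   The random compression operator Quant_{t,i} is fi_quant t i applied to a
   random seed, so that it can be evaluated at a random vector. *)
Record fedmm_input (R : realType) (n q : nat) (dO : measure_display)
    (Omega : measurableType dO) (dE : measure_display) (E : measurableType dE)
    := FedMMInput {
  fi_S0 : {mfun Omega >-> 'cV[R]_q};
  fi_V0 : 'I_n -> {mfun Omega >-> 'cV[R]_q};
  fi_oracle : nat -> 'I_n -> {mfun Omega >-> 'cV[R]_q};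
  fi_seed : nat -> 'I_n -> {mfun Omega >-> E};
  fi_quant : nat -> 'I_n -> E -> 'cV[R]_q -> 'cV[R]_q;
  fi_active : nat -> Omega -> {set 'I_n};
  fi_gamma : nat -> R;
  fi_alpha : R;
  fi_p : R;
  fi_B : 'cV[R]_q -> 'M[R]_q
}.

Record fedmm_state (R : realType) (n q : nat) := FedMMState {
  st_S : 'cV[R]_q;
  st_Vi : 'I_n -> 'cV[R]_q;
  st_V : 'cV[R]_q
}.

Section fedmm.
Context {R : realType} {n p d q : nat}.
Context {dO : measure_display} {Omega : measurableType dO}.
Context {dE : measure_display} {E : measurableType dE}.
Variables (M : mm_data R n p d q) (I : fedmm_input R n q Omega E).

Definition Quant (t : nat) (i : 'I_n) (w : Omega) (s : 'cV[R]_q) : 'cV[R]_q :=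
  fi_quant I t i (fi_seed I t i w) s.

Definition fedmm_delta (t : nat) (w : Omega) (st : fedmm_state R n q)
    (i : 'I_n) : 'cV[R]_q :=
  fi_oracle I t i w - st_S st - st_Vi st i.

Definition fedmm_init (w : Omega) : fedmm_state R n q :=
  FedMMState (fi_S0 I w) (fun i => fi_V0 I i w)
    (\sum_i mm_mu M i *: fi_V0 I i w).

Definition fedmm_step (t : nat) (w : Omega) (st : fedmm_state R n q) :
    fedmm_state R n q :=
  let Qd i := Quant t i w (fedmm_delta t w st i) in
  let agg := \sum_(i in fi_active I t w) mm_mu M i *: Qd i in
  let H := st_V st + (fi_p I)^-1 *: agg in
  FedMMState
    (bproj (mm_S M) (st_S st + fi_gamma I t *: H) (fi_B I (st_S st)))
    (fun i => if i \in fi_active I t w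
              then st_Vi st i + (fi_alpha I / fi_p I) *: Qd i else st_Vi st i)
    (st_V st + (fi_alpha I / fi_p I) *: agg).

Fixpoint fedmm (t : nat) (w : Omega) : fedmm_state R n q :=
  if t is t'.+1 then fedmm_step t w (fedmm t' w) else fedmm_init w.

Definition Shat (t : nat) (w : Omega) : 'cV[R]_q := st_S (fedmm t w).

(* Delta t i and Qtilde t i are meant for t > 0. *)
Definition Delta (t : nat) (i : 'I_n) (w : Omega) : 'cV[R]_q :=
  fedmm_delta t w (fedmm t.-1 w) i.

Definition Qtilde (t : nat) (i : 'I_n) (w : Omega) : 'cV[R]_q :=
  ((i \in fi_active I t w)%:R / fi_p I) *: Quant t i w (Delta t i w).

Fixpoint filt (t : nat) : set (set Omega) :=
  if t is t'.+1
  then <<s filt t' `|`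
      \bigcup_i (sigma_rv (fi_oracle I t i) `|` sigma_rv (Qtilde t i)) >>
  else <<s sigma_rv (fi_S0 I) `|` \bigcup_i sigma_rv (fi_V0 I i) >>.

Definition oracle_mean (i : 'I_n) (t : nat) (w : Omega) : 'cV[R]_q :=
  vmean (mm_pi M i) (fun z => mm_Sbar M z (mm_T M (Shat t w))).

(* \bar{E}_t, for t > 0. *)
Definition Ebar (t : nat) (w : Omega) : R :=
  let s := Shat t.-1 w in
  bnorm (fi_B I s)
    (bproj (mm_S M) (s + fi_gamma I t *: mm_h M s) (fi_B I s) - s) ^+ 2
  / fi_gamma I t ^+ 2.

(* The sources of randomness of iteration t.+1: the past together with the
   oracles, the n compressions and the n selections. *)
Definition round_sources (t : nat) (k : option ('I_n + 'I_n)) :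
    set (set Omega) :=
  match k with
  | None => <<s filt t `|` \bigcup_i sigma_rv (fi_oracle I t.+1 i) >>
  | Some (inl i) => sigma_rv (fi_seed I t.+1 i)
  | Some (inr i) => sigma_rv (fun w => i \in fi_active I t.+1 w)
  end.

Record fedmm_admissible : Prop := FedMMAdmissible {
  fa_alpha : 0 <= fi_alpha I;
  fa_p : 0 < fi_p I <= 1;
  fa_gamma : forall t, 0 < fi_gamma I t.+1 <= 1;
  fa_S0 : forall w, mm_S M (fi_S0 I w);
  fa_quant_meas : forall t i,
    measurable_fun setT (fun x : E * 'cV[R]_q => fi_quant I t.+1 i x.1 x.2);
  fa_active_meas : forall t i,
    measurable [set w | i \in fi_active I t.+1 w]
}.

Variable P : probability Omega R.

Record oracle_assumption (sig : 'I_n -> R) : Prop := OracleAssumption {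
  oa_indep : forall t, cond_indep P (filt t) (fi_oracle I t.+1);
  oa_mean : forall t i,
    is_cond_vexp P (filt t) (fi_oracle I t.+1 i) (oracle_mean i t);
  oa_sig : forall i, 0 < sig i;
  oa_var : forall t i, exists Y : Omega -> R,
    is_cond_exp P (filt t)
      (fun w => enorm (fi_oracle I t.+1 i w - oracle_mean i t w) ^+ 2) Y /\
    {ae P, forall w, Y w <= sig i ^+ 2}
}.

(* nu s is the distribution of Quant(s). *)
Record compression_assumption (nu : 'cV[R]_q -> probability 'cV[R]_q R)
    (omega : R) : Prop := CompressionAssumption {
  ca_indep : forall s, mutual_indep P
    (fun k : nat * 'I_n => sigma_rv (fun w => Quant k.1.+1 k.2 w s));
  ca_law : forall s t i A, measurable A ->
    P ((fun w => Quant t.+1 i w s) @^-1` A) = nu s A;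
  ca_omega : 0 <= omega;
  ca_mean : forall s, vmean (nu s) id = s;
  ca_var : forall s,
    (\int[nu s]_x (enorm (x - s) ^+ 2)%:E <= (omega * enorm s ^+ 2)%:E)%E
}.

Definition participation_assumption : Prop :=
  forall t i, P [set w | i \in fi_active I t.+1 w] = (fi_p I)%:E.

Definition sources_independent : Prop :=
  forall t, mutual_indep P (round_sources t).

End fedmm.

Section regularity.
Context {R : realType} {n p d q : nat}.
Variable M : mm_data R n p d q.

Record smoothness_assumption : Prop := SmoothnessAssumption {
  sa_int : (mm_Theta M)° !=set0;
  sa_psi : C1_on (mm_Theta M)° (mm_psi M);
  sa_phi : C1_on (mm_Theta M)° (mm_phi M);
  sa_convex : forall s, mm_S M s ->
    convex_function (mm_Theta M)
      (fun th => mm_psi M th - edot s (mm_phi M th));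
  sa_f : C1_on (mm_Theta M)° (mm_f M)
}.

Record field_assumption (L : 'I_n -> R) : Prop := FieldAssumption {
  fl_L : forall i, 0 <= L i;
  fl_lip : forall i s s', mm_S M s -> mm_S M s' ->
    enorm (mm_hi M i s' - mm_hi M i s) <= L i * enorm (s' - s);
  fl_bounded : has_ubound [set enorm (mm_h M s) | s in mm_S M]
}.

Record metric_assumption (B : 'cV[R]_q -> 'M[R]_q)
    (Cstar Cstar2 vmin vmax : R) : Prop := MetricAssumption {
  ma_Cstar : 0 < Cstar;
  ma_Cstar2 : 0 < Cstar2;
  ma_posdef : forall s, mm_S M s -> posdef (B s);
  ma_meas : measurable_fun (mm_S M) B;
  ma_expand : forall s s', mm_S M s -> mm_S M s' ->
    enorm (mm_phi M (mm_T M s') - mm_phi M (mm_T M s) - B s *m (s' - s))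
      <= Cstar * enorm (s' - s) ^+ 2;
  ma_dot : forall s s', mm_S M s -> mm_S M s' ->
    `|edot (s' - s) (mm_phi M (mm_T M s') - mm_phi M (mm_T M s))|
      <= Cstar2 * enorm (s' - s) ^+ 2;
  ma_v : 0 < vmin <= vmax;
  ma_bounds : forall s u, mm_S M s ->
    vmin * enorm u ^+ 2 <= qform (B s) u <= vmax * enorm u ^+ 2
}.

Definition omega_part (omega prob : R) : R :=
  omega + (1 + omega) * ((1 - prob) / prob).

Definition Cbar (Cstar Cstar2 : R) : R :=
  Cstar2 + Cstar * sup [set enorm (mm_h M s) | s in mm_S M].

(* sigma^2 and L^2 are both of this form. *)
Definition agg_sq (c : 'I_n -> R) : R :=
  n%:R * \sum_i mm_mu M i ^+ 2 * c i ^+ 2.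

Definition is_min_value {T : Type} (F : T -> \bar R) (m : R) : Prop :=
  (exists x, F x = m%:E) /\ forall x, (m%:E <= F x)%E.

End regularity.

(* Main.v *)
Require Import Defs.
From mathcomp Require Import all_boot all_order all_algebra.
From mathcomp Require Import all_classical all_reals all_analysis.
From mathcomp Require Import measurable_realfun ring lra.
Import Order.TTheory GRing.Theory Num.Theory.
Import numFieldNormedType.Exports.

Set Implicit Arguments.
Unset Strict Implicit.
Unset Printing Implicit Defensive.

Local Open Scope classical_set_scope.
Local Open Scope ring_scope.

(** Let W(s) = (f + g)(T(s)). The majorization at T(s), combined with the
    optimality of T(s') for the surrogate of s', gives
    W(s') <= W(s) - <phi(T s') - phi(T s), h(s)> + Cstar2 |s' - s|^2, hence
    W(s') <= W(s) - <h(s), B(s)(s' - s)> + Cbar |s' - s|^2.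
    The variational inequality of the B(s)-projection turns this into a
    pointwise descent of W along the iterates, whose error is the noise
    H_(t+1) - h(S_t). That noise splits into oracle, compression and
    participation parts which are pairwise orthogonal in L^2 (independence of
    each source from all the others makes the cross terms vanish by Fubini),
    so its second moment is at most
    sum_i mu_i^2 (sig_i^2 + omegap |Delta_i|^2). The last term is absorbed by the
    Lyapunov function
    E[W(S_t)] + (vmax omegap / alpha) gamma_(t+1) sum_i mu_i^2 E|V_(t,i) - h_i(S_t)|^2,
    because the control variates contract at rate 1 - alpha / 2. *)

(** No moment of the initial state is assumed, so expectations of nonnegative quantities are kept in
    the extended reals. When [omegap] is positive, an infinite right-hand side settles the claim;
    otherwise finiteness of the gap and of the deviations of the control variates is carried from
    round to round together with the Lyapunov inequality, because orthogonality of the noise is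
    available for square-integrable vectors only. When [omegap] is zero these deviations may be
    infinite: they enter only through products with [omegap], and 0 times +oo is 0. Fubini does not
    reach the oracle noise, which is centered and independent across workers only conditionally on
    the past. Conditional expectations being given by integrals over the sets of a sigma-algebra,
    the pull-out rule and the uncorrelatedness of conditionally independent oracles are derived in
    that form, from pi-systems and a layer-cake formula. Since [bproj] selects a minimizer by
    choice, measurability of the iterates is itself a point to prove. *)

(** * Euclidean scalar product and norm on columns *)

Section euclidean_algebra.
Context {R : realType} {k : nat}.
Implicit Types (u v w : 'cV[R]_k) (B : 'M[R]_k) (a : R).

Lemma edotC u v : edot u v = edot v u.
Proof. by apply: eq_bigr => j _; rewrite mulrC. Qed.

Lemma edotDl u v w : edot (u + v) w = edot u w + edot v w.
Proof.
by rewrite -big_split; apply: eq_bigr => j _; rewrite mxE mulrDl.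
Qed.

Lemma edotDr u v w : edot u (v + w) = edot u v + edot u w.
Proof. by rewrite edotC edotDl 2!(edotC _ u). Qed.

Lemma edotZl a u v : edot (a *: u) v = a * edot u v.
Proof. by rewrite mulr_sumr; apply: eq_bigr => j _; rewrite mxE mulrA. Qed.

Lemma edotZr a u v : edot u (a *: v) = a * edot u v.
Proof. by rewrite edotC edotZl edotC. Qed.

Lemma edotNl u v : edot (- u) v = - edot u v.
Proof. by rewrite -scaleN1r edotZl mulN1r. Qed.

Lemma edotNr u v : edot u (- v) = - edot u v.
Proof. by rewrite edotC edotNl edotC. Qed.

Lemma edotBl u v w : edot (u - v) w = edot u w - edot v w.
Proof. by rewrite edotDl edotNl. Qed.

Lemma edotBr u v w : edot u (v - w) = edot u v - edot u w.
Proof. by rewrite edotDr edotNr. Qed.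

Lemma edot0l u : edot 0 u = 0.
Proof. by rewrite -(scale0r (0 : 'cV[R]_k)) edotZl mul0r. Qed.

Lemma edot_ge0 u : 0 <= edot u u.
Proof. by apply: sumr_ge0 => j _; rewrite -expr2 sqr_ge0. Qed.

Lemma enorm_ge0 u : 0 <= enorm u.
Proof. exact: sqrtr_ge0. Qed.

Lemma enorm2 u : enorm u ^+ 2 = edot u u.
Proof. by rewrite sqr_sqrtr// edot_ge0. Qed.

Lemma edot_sq_le u v : edot u v ^+ 2 <= edot u u * edot v v.
Proof.
have [v0|v0] := eqVneq (edot v v) 0.
  suff -> : v = 0 by rewrite edotC !edot0l mulr0 expr0n.
  apply/matrixP => j j'; rewrite ord1 !mxE; apply/eqP.
  move/eqP : v0; rewrite psumr_eq0; last by move=> i _; rewrite -expr2 sqr_ge0.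
  by move/allP/(_ j); rewrite mem_index_enum mulf_eq0 orbb => /(_ isT).
have vp : 0 < edot v v by rewrite lt_neqAle eq_sym v0 edot_ge0.
have := edot_ge0 (edot v v *: u - edot u v *: v).
rewrite edotBl !edotBr !edotZl !edotZr (edotC v u).
set x := edot u u; set y := edot u v; set z := edot v v => h.
have {h} : 0 <= z * (x * z - y ^+ 2) by move: h; congr (_ <= _); ring.
by rewrite pmulr_rge0// subr_ge0.
Qed.

Lemma edot_le u v : `|edot u v| <= enorm u * enorm v.
Proof.
rewrite -(ler_pXn2r (_ : 0 < 2)%N)// ?nnegrE ?mulr_ge0 ?enorm_ge0//.
by rewrite exprMn !enorm2 real_normK ?num_real// edot_sq_le.
Qed.

Lemma enormZ a u : enorm (a *: u) ^+ 2 = a ^+ 2 * enorm u ^+ 2.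
Proof. by rewrite !enorm2 edotZl edotZr mulrA expr2. Qed.

Lemma enormN u : enorm (- u) = enorm u.
Proof. by rewrite /enorm edotNl edotNr opprK. Qed.

Lemma enormD2 u v :
  enorm (u + v) ^+ 2 = enorm u ^+ 2 + 2 * edot u v + enorm v ^+ 2.
Proof. by rewrite !enorm2 edotDl !edotDr (edotC v u); ring. Qed.

Lemma enormD2_le u v : enorm (u + v) ^+ 2 <= 2 * enorm u ^+ 2 + 2 * enorm v ^+ 2.
Proof.
rewrite enormD2; have := sqr_ge0 (enorm (u - v)).
by rewrite enormD2 enormN edotNr; lra.
Qed.

Lemma coord_sq_le u j : u j 0 ^+ 2 <= enorm u ^+ 2.
Proof.
rewrite enorm2 /edot (bigD1 j)//= -expr2 lerDl sumr_ge0// => i _.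
by rewrite -expr2 sqr_ge0.
Qed.

Lemma enorm2_sum u : enorm u ^+ 2 = \sum_j u j 0 ^+ 2.
Proof. by rewrite enorm2; apply: eq_bigr => j _; rewrite expr2. Qed.

Lemma enorm0 : enorm (0 : 'cV[R]_k) = 0.
Proof. by rewrite /enorm edot0l sqrtr0. Qed.

Lemma enorm_eq0 u : enorm u = 0 -> u = 0.
Proof.
move=> u0; apply/matrixP => j j'; rewrite ord1 !mxE.
by apply/eqP; rewrite -sqrf_eq0 eq_le sqr_ge0 andbT (le_trans (coord_sq_le _ _))// u0 expr0n.
Qed.

End euclidean_algebra.

(** * The bilinear form of a matrix *)

Section bilinear.
Context {R : realType} {k : nat} (B : 'M[R]_k).
Implicit Types (u v w : 'cV[R]_k) (a : R).

Definition bdot u v := edot u (B *m v).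

Lemma bdotDl u v w : bdot (u + v) w = bdot u w + bdot v w.
Proof. exact: edotDl. Qed.

Lemma bdotDr u v w : bdot u (v + w) = bdot u v + bdot u w.
Proof. by rewrite /bdot mulmxDr edotDr. Qed.

Lemma bdotZl a u v : bdot (a *: u) v = a * bdot u v.
Proof. exact: edotZl. Qed.

Lemma bdotZr a u v : bdot u (a *: v) = a * bdot u v.
Proof. by rewrite /bdot -scalemxAr edotZr. Qed.

Lemma bdotNl u v : bdot (- u) v = - bdot u v.
Proof. exact: edotNl. Qed.

Lemma bdotNr u v : bdot u (- v) = - bdot u v.
Proof. by rewrite /bdot mulmxN edotNr. Qed.

Lemma edot_mx u v : edot u v = (u^T *m v) 0 0.
Proof. by rewrite mxE; apply: eq_bigr => j _; rewrite mxE. Qed.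

Lemma qformE u : qform B u = bdot u u.
Proof. by rewrite /bdot edot_mx mulmxA. Qed.

Lemma bdotC u v : B^T = B -> bdot u v = bdot v u.
Proof.
move=> BT; rewrite /bdot edotC !edot_mx trmx_mul BT -mulmxA.
by rewrite -edot_mx.
Qed.

Lemma bnorm2 u : 0 <= qform B u -> bnorm B u ^+ 2 = qform B u.
Proof. by move=> h; rewrite sqr_sqrtr. Qed.

End bilinear.

Lemma qformB_split {R : realType} {k : nat} (B : 'M[R]_k) (u v : 'cV[R]_k) :
  B^T = B ->
  qform B (u + v) = qform B u + 2 * bdot B u v + qform B v.
Proof.
by move=> BT; rewrite !qformE bdotDl !bdotDr (bdotC v u BT); ring.
Qed.

(** * Existence and variational inequality of the projection in a matrix metric *)

Section projection.
Context {R : realType} {k : nat}.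
Implicit Types (S : set 'cV[R]_k) (B : 'M[R]_k) (u v x : 'cV[R]_k).

Lemma trmx_continuous m1 n1 : continuous (@trmx R m1 n1).
Proof.
move=> M A [E nE EA]; exists (fun i j => E j i) => [i j|N EN].
  by have := nE j i; rewrite mxE.
by apply: EA => i j; have := EN j i; rewrite mxE.
Qed.

(** Transposition is continuous and preserves the sup norm, which carries the compactness theorem
    from row vectors to columns. *)
Lemma cV_bounded_closed_compact S : bounded_set S -> closed S -> compact S.
Proof.
move=> Sb Sc.
have -> : S = trmx @` ((@trmx R 1 k) @^-1` S).
  apply/seteqP; split => [x Sx|_ [y Sy <-]//].
  by exists x^T; rewrite /= ?trmxK.
apply: continuous_compact.
  by apply: continuous_subspaceT; exact: trmx_continuous.
apply: bounded_closed_compact; last first.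
  by apply: closed_comp => // x _; exact: trmx_continuous.
case: Sb => M [Mr SM]; exists M; split => // x Mx y /= Sy.
apply: le_trans (SM _ Mx _ Sy).
rewrite [leLHS]/Num.norm [leRHS]/Num.norm /= !mx_normrE.
apply/bigmax_leP; split; first by apply/bigmax_geP; left.
move=> [i j] _; apply/bigmax_geP; right; exists (j, i) => //=.
by rewrite mxE.
Qed.

Lemma qform_continuous B x : continuous (fun u => qform B (u - x)).
Proof.
have -> : (fun u => qform B (u - x)) = (fun u => \sum_i \sum_j (u - x) i 0 * B i j * (u - x) j 0).
  apply/funext => u; rewrite qformE /bdot /edot; apply: eq_bigr => i _.
  by rewrite [X in _ * X]mxE mulr_sumr; apply: eq_bigr => j _; rewrite mulrA.
apply: continuous_big => [|i _]; first exact: add_continuous.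
apply: continuous_big => [|j _]; first exact: add_continuous.
have h l : continuous (fun u : 'cV[R]_k => (u - x) l 0).
  have -> : (fun u : 'cV[R]_k => (u - x) l 0) = (fun u => u l 0 + (- x) l 0).
    by apply/funext => v; rewrite !mxE.
  by move=> v; apply: continuousD; [exact: coord_continuous|exact: cst_continuous].
move=> u; exact: (@continuousM R _ _ _ u (@continuousM R _ _ _ u (h i u) (@cst_continuous _ _ (B i j) u)) (h j u)).
Qed.

Lemma mxnorm_le_enorm u : `|u| <= enorm u.
Proof.
rewrite [leLHS]/Num.norm /= mx_normrE; apply/bigmax_leP; split.
  exact: enorm_ge0.
move=> [i j] _ /=; rewrite ord1.
rewrite -(ler_pXn2r (_ : 0 < 2)%N)// ?nnegrE ?enorm_ge0//.
by rewrite real_normK ?num_real// coord_sq_le.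
Qed.

(** Coercivity makes the sublevel set at a point of [S] bounded, hence compact, and a minimum over
    it is a minimum over [S]; the choice in [bproj] is then made in a nonempty set. *)
Lemma bproj_argmin S B (v : R) x : closed S -> S !=set0 -> 0 < v ->
  (forall u, v * enorm u ^+ 2 <= qform B u) ->
  argmin_on S (fun u => qform B (u - x)) (bproj S x B).
Proof.
move=> Sc [s0 Ss0] v0 vB; rewrite /bproj.
suff [y Sy] : argmin_on S (fun u => qform B (u - x)) !=set0 by apply: xgetPex; exists y.
pose S' := S `&` [set u | qform B (u - x) <= qform B (s0 - x)].
have S'c : compact S'.
  apply: cV_bounded_closed_compact; last first.
    apply: closedI => //.
    have -> : [set u | qform B (u - x) <= qform B (s0 - x)] =
        (fun u => qform B (u - x)) @^-1` [set r | r <= qform B (s0 - x)] by [].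
    by apply: closed_comp; [move=> u _; exact: qform_continuous|exact: closed_le].
  (* A radius free of square roots: [e ^+ 2 <= c] implies [e <= c + 1]. *)
  pose M := qform B (s0 - x) / v + 1 + `|x|.
  exists M; split; first exact: num_real.
  move=> t Mt u [Su /= qu]; apply/ltW/le_lt_trans/Mt.
  rewrite -[u](subrK x) (le_trans (ler_normD _ _))// lerD2r.
  apply: le_trans (mxnorm_le_enorm _) _.
  have : enorm (u - x) ^+ 2 <= qform B (s0 - x) / v.
    by rewrite ler_pdivlMr// mulrC (le_trans (vB _)).
  have := sqr_ge0 (enorm (u - x) - 1).
  have := enorm_ge0 (u - x).
  set e := enorm _; set c := _ / v; move=> e0 h1 h2.
  have [e1|/ltW e1] := lerP e 1; last by nra.
  by have := sqr_ge0 e; lra.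
have S'0 : S' !=set0 by exists s0; split => /=.
have := @compact_EVT_min _ R (fun u => qform B (u - x)) S' S'0 S'c.
case.
  by apply: continuous_subspaceT; exact: qform_continuous.
move=> c; rewrite inE => -[Sc1 /= Sc2] cmin; exists c; split=> //= y Sy.
have [h|/ltW h] := lerP (qform B (y - x)) (qform B (s0 - x)).
  by apply: cmin; rewrite inE.
exact: le_trans h.
Qed.

(* The segment from p to u stays in S, so the derivative at p is nonnegative. *)
Lemma bproj_var S B x p u : convex_set S -> B^T = B ->
  argmin_on S (fun u => qform B (u - x)) p -> S u ->
  bdot B (x - p) (u - p) <= 0.
Proof.
move=> Sconv BT [Sp pmin] Su; rewrite leNgt; apply/negP => d0.
set d := bdot B _ _ in d0.
set c := qform B (u - p).
have key (t : R) : 0 < t < 1 -> 2 * d <= t * c.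
  move=> /andP[t0 t1].
  have := Sconv u p (Itv01 (ltW t0) (ltW t1)) (mem_set Su) (mem_set Sp).
  rewrite inE => Sq; have {Sq} : S (p + t *: (u - p)).
    move: Sq; congr (S _); transitivity (t *: u + (1 - t) *: p) => //.
    by rewrite scalerBr scalerBl scale1r addrCA.
  move=> /pmin.
  have -> : p + t *: (u - p) - x = (p - x) + t *: (u - p) by rewrite addrAC.
  rewrite (qformB_split (p - x))// bdotZr !qformE bdotZl bdotZr -(qformE B (u - p)) -/c.
  have -> : bdot B (p - x) (u - p) = - d by rewrite -bdotNl opprB.
  have t2 : 0 < t by [].
  move=> h; have : 0 <= t * (t * c - 2 * d) by move: h; lra.
  by rewrite pmulr_rge0// subr_ge0.
have c0 : 0 < c.
  have := key 2^-1; rewrite invr_gt0 ltr0n invf_lt1 ?ltr1n// => /(_ isT).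
  lra.
(* At this [t] the bound [key] reads 2 d (d + c) <= d c, impossible for positive [d] and [c]. *)
have t1 : 0 < d / (d + c) < 1.
  by rewrite divr_gt0 ?addr_gt0//= ltr_pdivrMr ?addr_gt0// mul1r ltrDl.
have := key _ t1; rewrite -mulrAC ler_pdivlMr ?addr_gt0//.
nra.
Qed.

End projection.

(** * Majorization and one-step descent of the objective along [T] *)

Section descent.
Context {R : realType} {n p d q : nat} (M : mm_data R n p d q).
Context (Bf : 'cV[R]_q -> 'M[R]_q) (L : 'I_n -> R) (Cstar Cstar2 vmin vmax : R).
Hypotheses (hprob : federated_problem M) (hmm : mm_framework M)
  (hfield : field_assumption M L)
  (hmetric : metric_assumption M Bf Cstar Cstar2 vmin vmax)
  (hclosed : closed (mm_S M)).
Local Notation S := (mm_S M).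
Local Notation T := (mm_T M).
Local Notation C := (Cbar M Cstar Cstar2).

(** On [S] nothing is lost by [fine]: [T s] lies in the domain of g there, see [mm_obj_T]. *)
Definition mm_W (s : 'cV[R]_q) : R := mm_f M (T s) + fine (mm_g M (T s)).

Lemma T_argmin s : S s -> argmin_on setT (mm_surrogate M s) (T s).
Proof. by move=> Ss; rewrite (mf_T_argmin hmm Ss). Qed.

Lemma g_fin_num th : mm_Theta M th -> mm_g M th \is a fin_num.
Proof. by move=> gth; rewrite fin_numE fp_g_ninfty// -ltey. Qed.

(** The surrogate is finite at any point of the nonempty domain of g, hence also at its
    minimizer. *)
Lemma T_Theta s : S s -> mm_Theta M (T s).
Proof.
move=> Ss; have [_ /(_ _ I) Tmin] := T_argmin Ss.
have [th0 th0T] := fp_g_proper hprob.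
have := le_lt_trans (Tmin th0) _.
rewrite /mm_surrogate -(fineK (g_fin_num th0T)) -EFinD => /(_ +oo%E (ltry _)).
rewrite /mm_Theta/=; case: (mm_g M (T s)) => [r _||]//=; first exact: ltry.
Qed.

Lemma T_min s th : S s -> mm_Theta M th ->
  fine (mm_g M (T s)) + mm_psi M (T s) - edot s (mm_phi M (T s)) <=
  fine (mm_g M th) + mm_psi M th - edot s (mm_phi M th).
Proof.
move=> Ss thT; have [_ /(_ th Logic.I)] := T_argmin Ss.
rewrite /mm_surrogate -(fineK (g_fin_num thT)) -(fineK (g_fin_num (T_Theta Ss))).
by rewrite -!EFinD lee_fin !addrA.
Qed.

Lemma mm_obj_T s : S s -> mm_obj M (T s) = (mm_W s)%:E.
Proof.
by move=> Ss; rewrite /mm_obj -(fineK (g_fin_num (T_Theta Ss))) -EFinD.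
Qed.

Lemma Cbar_gt0 : 0 < C.
Proof.
rewrite /Cbar ltr_pwDl// ?(ma_Cstar2 hmetric)// mulr_ge0 ?(ltW (ma_Cstar hmetric))//.
have [->|/set0P[r [s Ss e]]] := eqVneq [set enorm (mm_h M s) | s in mm_S M] set0.
  by rewrite sup0.
apply: le_trans (enorm_ge0 (mm_h M s)) _; apply: ub_le_sup; last by exists s.
exact: fl_bounded hfield.
Qed.

(** Writing the mean of Sbar as h(s) + s leaves <s' - s, D> over, which accounts for the [Cstar2]
    part of [Cbar]; exchanging D for B(s)(s' - s) against h(s) costs the other part, [Cstar] times
    the supremum of |h|. *)
Lemma mm_W_majorize s s' : S s -> S s' ->
  mm_W s' <= mm_W s - bdot (Bf s) (mm_h M s) (s' - s) + C * enorm (s' - s) ^+ 2.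
Proof.
move=> Ss Ss'.
have maj := mf_majorize hmm (T_Theta Ss) (T_Theta Ss').
have min := T_min Ss' (T_Theta Ss).
have := ma_dot hmetric Ss Ss'; rewrite ler_norml => /andP[_ dotle].
have ex := ma_expand hmetric Ss Ss'.
set D := mm_phi M (T s') - mm_phi M (T s) in maj dotle ex *.
have -> : bdot (Bf s) (mm_h M s) (s' - s) =
    edot (mm_h M s) D - edot (mm_h M s) (D - Bf s *m (s' - s)).
  by rewrite /bdot (edotBr _ D) subKr.
have hbd : enorm (mm_h M s) <= sup [set enorm (mm_h M s) | s in mm_S M].
  apply: ub_le_sup; first exact: fl_bounded hfield.
  by exists s.
have := edot_le (mm_h M s) (D - Bf s *m (s' - s)); rewrite ler_norml => /andP[+ _].
have := ler_pM (enorm_ge0 _) (enorm_ge0 _) hbd ex.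
move: maj; rewrite (_ : vmean _ _ = mm_h M s + s); last by rewrite /mm_h subrK.
rewrite edotDl /Cbar /mm_W.
have -> : edot s D = edot s (mm_phi M (T s')) - edot s (mm_phi M (T s)).
  by rewrite edotBr.
move: dotle; rewrite edotBl [edot s D]edotBr.
have -> : edot s' D = edot s' (mm_phi M (T s')) - edot s' (mm_phi M (T s)).
  by rewrite edotBr.
move: min; lra.
Qed.

Lemma B_ge s u : S s -> vmin * enorm u ^+ 2 <= qform (Bf s) u.
Proof. by move=> Ss; have /andP[] := ma_bounds hmetric u Ss. Qed.

Lemma B_le s u : S s -> qform (Bf s) u <= vmax * enorm u ^+ 2.
Proof. by move=> Ss; have /andP[] := ma_bounds hmetric u Ss. Qed.

Lemma vmin_gt0 : 0 < vmin. Proof. by have /andP[] := ma_v hmetric. Qed.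

Lemma B_ge0 s u : S s -> 0 <= qform (Bf s) u.
Proof.
move=> Ss; apply: le_trans (B_ge u Ss).
by rewrite mulr_ge0 ?sqr_ge0// ltW// vmin_gt0.
Qed.

Lemma B_sym s : S s -> (Bf s)^T = Bf s.
Proof. by move=> Ss; have [] := ma_posdef hmetric Ss. Qed.

Lemma bproj_argminB s x : S s -> argmin_on S (fun u => qform (Bf s) (u - x)) (bproj S x (Bf s)).
Proof.
move=> Ss; apply: (bproj_argmin x hclosed _ vmin_gt0); first by exists s.
by move=> u; exact: B_ge.
Qed.

Lemma bproj_S s x : S s -> S (bproj S x (Bf s)).
Proof. by move=> /bproj_argminB => /(_ x)[]. Qed.

(** Here [sb] is the noiseless step, with x = s' - s, y = sb - s and e the noise. The variational
    inequality of [s'] is tested at [sb], that of [sb] at [s], and the cross term <g e, x - y> is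
    split by Young's inequality, in the form of nonnegativity of the B-form at g e - (x - y). Their
    combination bounds - g <h, x> by half of g^2 |e|^2 - |x|^2 - |y|^2 in the B-norm; the term [C]
    |x|^2 of the majorization is then charged to the B-norm of x through [vmin]. *)
Lemma fedmm_descent s (g : R) (H : 'cV[R]_q) : S s -> 0 < g ->
  let B := Bf s in
  let s' := bproj S (s + g *: H) B in
  let sb := bproj S (s + g *: mm_h M s) B in
  mm_W s' + g / 2 * (qform B (sb - s) / g ^+ 2)
    + g^-1 * (2^-1 - g * C / vmin) * qform B (s' - s)
  <= mm_W s + g / 2 * qform B (H - mm_h M s).
Proof.
move=> Ss g0; cbv zeta; set B := Bf s; set s' := bproj S (s + g *: H) B; set sb := bproj S _ B.
have Ss' : S s' by exact: bproj_S.
have Ssb : S sb by exact: bproj_S.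
have Bs := B_sym Ss.
have i1 := bproj_var (mf_S_convex hmm) Bs (bproj_argminB _ Ss) Ssb : bdot B (s + g *: H - s') _ <= 0.
have i2 := bproj_var (mf_S_convex hmm) Bs (bproj_argminB _ Ss) Ss : bdot B (s + g *: mm_h M s - sb) _ <= 0.
have i3 := mm_W_majorize Ss Ss'.
have i4 := B_ge (s' - s) Ss.
have i5 := B_ge0 (g *: (H - mm_h M s) - ((s' - s) - (sb - s))) Ss.
set h := mm_h M s in i2 i3 i5 *.
set x := s' - s in i3 i4 i5 *; set y := sb - s in i5 *.
set e := H - h in i5 *.
have E1 : s + g *: H - s' = g *: h + g *: e - x.
  by rewrite /e (scalerBr _ H) [g *: h + _]addrC subrK /x opprB addrA [g *: H + s]addrC.
have E2 : sb - s' = y - x by rewrite /x /y opprB addrA subrK.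
have E3 : s + g *: h - sb = g *: h - y by rewrite /y opprB [s + _]addrC addrA.
have E4 : s - sb = - y by rewrite opprB.
move: i1 i2 i5; rewrite E1 E2 E3 E4 !qformE.
clearbody e h x y; rewrite -/B !(bdotDl, bdotDr, bdotNl, bdotNr, bdotZl, bdotZr).
rewrite (bdotC y x Bs) (bdotC y e Bs) (bdotC x e Bs).
move: i3 i4; rewrite -/B qformE.
set a := bdot B h y; set b := bdot B h x; set c := bdot B e y; set d' := bdot B e x.
set X := bdot B x x; set Y := bdot B y y; set Z := bdot B x y; set E := bdot B e e.
set N := enorm x ^+ 2; move=> i3 i4 i1 i2 i5.
have C0 := Cbar_gt0; have v0 := vmin_gt0.
have CN : C * N <= C * X / vmin by rewrite ler_pdivlMr// -mulrA (mulrC N) ler_pM2l.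
have key : - (g * b) <= 2^-1 * (g ^+ 2 * E) - 2^-1 * X - 2^-1 * Y by lra.
have {key} : - b <= g / 2 * E - g^-1 * (2^-1 * X) - g^-1 * (2^-1 * Y).
  rewrite -(ler_pM2l g0) mulrN (le_trans key)//.
  by rewrite !mulrBr !(mulrA g g^-1) divff ?gt_eqF// !mul1r; lra.
have -> : g / 2 * (Y / g ^+ 2) = g^-1 * (2^-1 * Y).
  by field; rewrite gt_eqF.
have -> : g^-1 * (2^-1 - g * C / vmin) * X = g^-1 * (2^-1 * X) - C * X / vmin.
  by field; rewrite !gt_eqF.
lra.
Qed.

End descent.

(** * Borel measurability of matrix-valued maps *)

Section matrix_measurability.
Context {R : realType} {d : measure_display} {T : measurableType d}.

Lemma mx_measurableE m k : @measurable _ 'M[R]_(m, k) = <<s @open 'M[R]_(m, k) >>.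
Proof. by []. Qed.

Lemma open_mx_measurable m k (A : set 'M[R]_(m, k)) : open A -> measurable A.
Proof. exact: sub_sigma_algebra. Qed.

Lemma coord_measurable m k i j :
  measurable_fun setT (fun N : 'M[R]_(m, k) => N i j).
Proof.
apply: (measurability _ (RGenOpens.measurableE R)) => _ [A [a [b ->]] <-].
rewrite setTI; apply: open_mx_measurable.
apply: open_comp; last exact: interval_open.
by move=> N _; exact: coord_continuous.
Qed.

Lemma measurable_fun_coord m k (X : T -> 'M[R]_(m, k)) D i j :
  measurable_fun D X -> measurable_fun D (fun x => X x i j).
Proof. by move=> mX; exact: (measurableT_comp (coord_measurable i j) mX). Qed.

(** An open set is a countable union of boxes with rational centres and radii, and the preimage of a
    box is a finite intersection of preimages under coordinates. *)
Lemma measurable_fun_mx m k (X : T -> 'M[R]_(m, k)) D :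
  (forall i j, measurable_fun D (fun x => X x i j)) -> measurable_fun D X.
Proof.
move=> mX mD; apply: (measurability _ (mx_measurableE m k)) => //.
move=> _ [A oA <-].
pose box (c : 'M[rat]_(m, k) * rat) : set 'M[R]_(m, k) :=
  [set N | forall i j, `|N i j - ratr (c.1 i j)| < ratr c.2].
have AE : A = \bigcup_c (if `[< box c `<=` A >] then box c else set0).
  apply/seteqP; split => [N AN|N [c _]]; last by case: asboolP => // h; exact: h.
  have [e /= e0 Ae] : exists2 e : R, 0 < e & ball N e `<=` A.
    by apply/nbhs_ballP; exact: open_nbhs_nbhs.
  have e2 : 0 < e / 2 by rewrite divr_gt0.
  have [r] := rat_in_itvoo e2; rewrite in_itv/= => /andP[r0 r1].
  have ch i j : exists c : rat, ratr c \in `]N i j - ratr r, N i j + ratr r[.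
    by apply: rat_in_itvoo; lra.
  pose c := \matrix_(i, j) xchoose (ch i j).
  have cN i j : `|N i j - ratr (c i j)| < ratr r.
    have := xchooseP (ch i j); rewrite in_itv/= mxE => /andP[? ?].
    by rewrite ltr_norml; apply/andP; split; lra.
  exists (c, r) => //; case: asboolP => // -[] N' bN'; apply: Ae; split => // i j.
  rewrite /ball/= -(subrK (ratr (c i j)) (N i j)) -addrA.
  apply: le_lt_trans (ler_normD _ _) _.
  by have := cN i j; have := bN' i j; rewrite /= (distrC (N' i j)); lra.
rewrite AE preimage_bigcup setI_bigcupr.
apply: countable_bigcupT_measurable => // c.
case: asboolP => _; last by rewrite preimage_set0 setI0.
have -> : D `&` X @^-1` box c = \bigcap_i \bigcap_j (D `&` (fun x => X x i j) @^-1` [set y | `|y - ratr (c.1 i j)| < ratr c.2]) `&` D.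
  apply/seteqP; split => [x [Dx Xx]|x [Xx Dx]].
    by split => // i _ j _; split => //; exact: Xx.
  by split => // i j; have [] := Xx i Logic.I j Logic.I.
apply: measurableI => //.
apply: fin_bigcap_measurable => [|i _]; first exact: finite_finset.
apply: fin_bigcap_measurable => [|j _]; first exact: finite_finset.
apply: mX => //.
have -> : [set y : R | `|y - ratr (c.1 i j)| < ratr c.2] = ball (ratr (c.1 i j) : R) (ratr c.2).
  by apply/seteqP; split=> y; rewrite -ball_normE /= distrC.
exact: measurable_ball.
Qed.

End matrix_measurability.

Lemma sub_interior_open {X : topologicalType} (A : set X) : A `<=` A° -> open A.
Proof. by rewrite openE. Qed.

(** * Joint measurability of the projection in the point and the matrix *)

Section bproj_measurable.
Context {R : realType} {k : nat} (S : set 'cV[R]_k).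
Hypotheses (Sclosed : closed S) (Sconvex : convex_set S) (S0 : S !=set0).

Lemma qform1 (u : 'cV[R]_k) : qform 1%:M u = enorm u ^+ 2.
Proof. by rewrite qformE /bdot mul1mx enorm2. Qed.

Local Notation E := (fun x => bproj S x 1%:M).

Lemma eproj_argmin x : argmin_on S (fun u => qform 1%:M (u - x)) (E x).
Proof.
by apply: (bproj_argmin _ Sclosed S0 ltr01) => u; rewrite qform1 mul1r.
Qed.

Lemma eproj_var x u : S u -> edot (x - E x) (u - E x) <= 0.
Proof.
move=> Su; have := bproj_var Sconvex (tr_scalar_mx _ _) (eproj_argmin x) Su.
by rewrite /bdot mul1mx.
Qed.

(** Adding the two variational inequalities gives |E x - E y|^2 <= <x - y, E x - E y>; nonnegativity
    of |(x - y) - (E x - E y)|^2 does the rest. *)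
Lemma eproj_lip x y : enorm (E x - E y) ^+ 2 <= enorm (x - y) ^+ 2.
Proof.
have [Sx _] := eproj_argmin x; have [Sy _] := eproj_argmin y.
have h1 := eproj_var x Sy; have h2 := eproj_var y Sx.
have := edot_ge0 ((x - y) - (E x - E y)).
move: h1 h2; set a := E x; set b := E y.
rewrite !enorm2 !(edotDl, edotNl, edotDr, edotNr).
by rewrite !(edotC b) !(edotC a) !(edotC y x); lra.
Qed.

Lemma eproj_unique x p : S p -> (forall u, S u -> edot (x - p) (u - p) <= 0) ->
  E x = p.
Proof.
move=> Sp pv; have [Sx _] := eproj_argmin x.
have h1 := eproj_var x Sp; have h2 := pv _ Sx.
apply/eqP; rewrite -subr_eq0; apply/eqP/enorm_eq0/eqP; rewrite -sqrf_eq0.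
rewrite eq_le sqr_ge0 andbT; move: h1 h2; set a := E x.
rewrite enorm2 !(edotDl, edotNl, edotDr, edotNr) ?(edotC p a) ?(edotC p x) ?(edotC a x); lra.
Qed.

Lemma enorm_le_mxnorm (u : 'cV[R]_k) : enorm u ^+ 2 <= k%:R * `|u| ^+ 2.
Proof.
rewrite enorm2_sum.
apply: (@le_trans _ _ (\sum_(j < k) `|u| ^+ 2)).
  apply: ler_sum => j _; rewrite -real_normK ?num_real//.
  rewrite lerXn2r ?nnegrE//; rewrite [leRHS]/Num.norm /= mx_normrE.
  by apply/bigmax_geP; right; exists (j, 0).
by rewrite sumr_const card_ord mulr_natl.
Qed.

Lemma eproj_measurable : measurable_fun setT E.
Proof.
apply: (measurability _ (mx_measurableE k 1)) => _ [A oA <-].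
rewrite setTI; apply: open_mx_measurable.
apply: sub_interior_open.
move=> x /= AEx.
have [e /= e0 Ae] : exists2 e : R, 0 < e & ball (E x) e `<=` A.
  by apply/nbhs_ballP; exact: open_nbhs_nbhs.
have k1 : 0 <= k%:R :> R by [].
have k0 : 0 < k%:R + 1 :> R by rewrite ltr_wpDl.
(* Balls are taken in the sup norm while [E] is nonexpansive in the Euclidean one; the comparison of
   squares costs a factor k, and k < (k + 1)^2. *)
apply/nbhs_ballP; exists (e / (k%:R + 1)) => /=; first by rewrite divr_gt0.
move=> y; rewrite -ball_normE /= ltr_pdivlMr// => h.
apply: Ae; rewrite -ball_normE /=.
apply: le_lt_trans (mxnorm_le_enorm _) _.
rewrite -(ltr_pXn2r (_ : 0 < 2)%N)// ?nnegrE ?enorm_ge0 ?(ltW e0)//.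
apply: le_lt_trans (eproj_lip _ _) _.
apply: le_lt_trans (enorm_le_mxnorm _) _.
have := normr_ge0 (x - y); move: h; set z := `|_|; set K : R := k%:R in k0 k1 *.
move=> h z0; have : (z * (K + 1)) ^+ 2 < e ^+ 2.
  by rewrite ltr_pXn2r// nnegrE ?(ltW e0)// mulr_ge0// ltW.
have [->|z1] := eqVneq z 0; first by rewrite expr0n mulr0 => _; rewrite exprn_gt0.
have z2 : 0 < z ^+ 2 by rewrite exprn_gt0// lt_neqAle eq_sym z1.
nra.
Qed.

Section fixpoint.
Context (B : 'M[R]_k) (vmin vmax : R) (v0 : 0 < vmin) (vmm : vmin <= vmax).
Hypotheses (Bsym : B^T = B)
  (Bge : forall u, vmin * enorm u ^+ 2 <= qform B u)
  (Ble : forall u, qform B u <= vmax * enorm u ^+ 2).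

Let vM0 : 0 < vmax. Proof. exact: lt_le_trans vmm. Qed.

(** Spectral theory is avoided: positivity of the form at v - B v / vmax, with the upper bound on
    the form at B v, yields |B v|^2 <= vmax <v, B v>, and then the lower bound gives the factor. *)
Lemma bproj_step_contract (v : 'cV[R]_k) :
  enorm (v - vmax^-1 *: (B *m v)) ^+ 2 <= (1 - vmin / vmax) * enorm v ^+ 2.
Proof.
have h1 : enorm (B *m v) ^+ 2 <= vmax * qform B v.
  have q0 : 0 <= qform B (v - vmax^-1 *: (B *m v)).
    by apply: le_trans (Bge _); rewrite mulr_ge0 ?sqr_ge0 ?ltW.
  have := Ble (B *m v); move: q0; rewrite !qformE.
  rewrite !(bdotDl, bdotDr, bdotNl, bdotNr, bdotZl, bdotZr) (bdotC v (B *m v) Bsym).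
  rewrite {2 3}/bdot -enorm2.
  set a := enorm _ ^+ 2; set b := bdot B v v; set c := bdot B _ _ => q0 ca.
  have i0 : 0 < vmax^-1 by rewrite invr_gt0.
  have : vmax^-1 * (vmax^-1 * c) <= vmax^-1 * a.
    by rewrite ler_pM2l// mulrC ler_pdivrMr// mulrC.
  move=> h; have {h q0} : vmax^-1 * a <= b by lra.
  by rewrite mulrC ler_pdivrMr// mulrC.
rewrite enormD2 enormN edotNr edotZr enormZ.
have -> : edot v (B *m v) = qform B v by rewrite qformE.
move: h1 (Bge v); set a := enorm (_ *m _) ^+ 2; set b := qform B v; set c := enorm v ^+ 2.
move=> h1 h2.
have i0 : 0 < vmax^-1 by rewrite invr_gt0.
have : vmax^-1 ^+ 2 * a <= vmax^-1 * b.
  by rewrite expr2 -mulrA ler_pM2l// mulrC ler_pdivrMr// mulrC.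
have : vmax^-1 * (vmin * c) <= vmax^-1 * b by rewrite ler_pM2l.
lra.
Qed.

(* bproj is defined by choice; as the limit of this projected-gradient
   iteration it is measurable jointly in the point and the matrix. *)
Definition bproj_iter (u : 'cV[R]_k) (j : nat) : 'cV[R]_k :=
  iter j (fun x => E (x - vmax^-1 *: (B *m (x - u)))) 0.

(** The B-projection p of u is a fixed point of the iteration: its variational inequality in the
    B-form is the Euclidean one for the point p - B (p - u) / vmax. Each round composes the
    contracting gradient step with the nonexpansive [E], and the start at 0 makes the initial error
    |p|^2. *)
Lemma bproj_iter_le (u : 'cV[R]_k) j :
  enorm (bproj_iter u j - bproj S u B) ^+ 2 <=
  (1 - vmin / vmax) ^+ j * enorm (bproj S u B) ^+ 2.
Proof.
have amin := bproj_argmin u Sclosed S0 v0 Bge.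
have i0 : 0 < vmax^-1 by rewrite invr_gt0.
have rho0 : 0 <= 1 - vmin / vmax by rewrite subr_ge0 ler_pdivrMr// mul1r.
set p := bproj S u B in amin *.
have pfix : E (p - vmax^-1 *: (B *m (p - u))) = p.
  apply: eproj_unique; first by case: amin.
  move=> v Sv; have := bproj_var Sconvex Bsym amin Sv.
  rewrite [_ - _ - p]addrAC subrr add0r -scalerN -mulmxN opprB edotZl => h.
  by rewrite pmulr_rle0// edotC -/(bdot B (v - p) (u - p)) bdotC.
elim: j => [|j IH].
  by rewrite /bproj_iter/= add0r enormN mul1r.
rewrite [bproj_iter u j.+1]/=; rewrite -/(bproj_iter u j) -{1}pfix.
apply: le_trans (eproj_lip _ _) _.
set x := bproj_iter u j in IH *.
have -> : x - vmax^-1 *: (B *m (x - u)) - (p - vmax^-1 *: (B *m (p - u))) =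
    (x - p) - vmax^-1 *: (B *m (x - p)).
  rewrite !mulmxBr !scalerBr !opprD !opprK.
  by apply/matrixP => a b; rewrite !mxE; ring.
apply: le_trans (bproj_step_contract _) _.
by rewrite (exprS _ j) -mulrA ler_wpM2l.
Qed.

Lemma bproj_iter_cvg (u : 'cV[R]_k) i :
  (bproj_iter u j i 0) @[j --> \oo] --> bproj S u B i 0.
Proof.
have i0 : 0 < vmax^-1 by rewrite invr_gt0.
have rho0 : 0 <= 1 - vmin / vmax by rewrite subr_ge0 ler_pdivrMr// mul1r.
apply/cvgrPdist_lt => e e0.
have hc : (1 - vmin / vmax) ^+ j * enorm (bproj S u B) ^+ 2 @[j --> \oo] --> (0 : R).
  rewrite -[X in _ --> X](mul0r (enorm (bproj S u B) ^+ 2)).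
  apply: cvgMl; apply: cvg_expr; rewrite ger0_norm// ltrBlDr ltrDl.
  by rewrite divr_gt0.
have e2 : 0 < e ^+ 2 by rewrite exprn_gt0.
near=> j.
rewrite -(ltr_pXn2r (_ : 0 < 2)%N)// ?nnegrE ?(ltW e0)// real_normK ?num_real//.
rewrite -sqrrN opprB.
have -> : bproj_iter u j i 0 - bproj S u B i 0 = (bproj_iter u j - bproj S u B) i 0.
  by rewrite !mxE.
apply: le_lt_trans (coord_sq_le _ _) _; apply: le_lt_trans (bproj_iter_le _ _) _.
near: j; have /cvgrPdist_lt/(_ _ e2) := hc.
apply: filterS => j; rewrite sub0r normrN; apply: le_lt_trans; exact: ler_norm.
Unshelve. all: by end_near. Qed.

End fixpoint.

Lemma bproj_measurable {d} {T : measurableType d} (u : T -> 'cV[R]_k)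
    (B : T -> 'M[R]_k) (vmin vmax : R) :
  0 < vmin <= vmax ->
  measurable_fun setT u -> measurable_fun setT B ->
  (forall t, (B t)^T = B t) ->
  (forall t v, vmin * enorm v ^+ 2 <= qform (B t) v <= vmax * enorm v ^+ 2) ->
  measurable_fun setT (fun t => bproj S (u t) (B t)).
Proof.
move=> /andP[v0 vmm] mu mB Bsym Bb; apply: measurable_fun_mx => i j; rewrite ord1.
have mit m : measurable_fun setT (fun t => bproj_iter (B t) vmax (u t) m).
  elim: m => [|m IH]; first exact: measurable_cst.
  apply: (measurableT_comp eproj_measurable).
  apply: measurable_fun_mx => a b; rewrite ord1.
  under eq_fun do rewrite !mxE.
  have mm c : measurable_fun setT (fun t => bproj_iter (B t) vmax (u t) m c 0).
    exact: measurable_fun_coord.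
  apply: measurable_funB => //; apply: measurable_funM => //.
  apply: measurable_sum => c; under eq_fun do rewrite !mxE.
  apply: measurable_funM; first exact: measurable_fun_coord.
  by apply: measurable_funB => //; exact: measurable_fun_coord.
apply: (measurable_fun_cvg (fun m => measurable_fun_coord i 0 (mit m))) => t _.
apply: (bproj_iter_cvg v0 vmm (Bsym t)) => v; by have /andP[] := Bb t v.
Qed.

End bproj_measurable.

(** * Pi-systems and variables centered on a sub-sigma-algebra *)

Section pi_lambda.
Context {T : Type}.

Lemma dynkin_induction (G H : set (set T)) : setI_closed G -> G `<=` H ->
  dynkin H -> <<s G >> `<=` H.
Proof.
move=> GI GH dH; apply: (lambda_system_subset GI _ GH) => //.
exact/dynkin_lambda_system.
Qed.

End pi_lambda.

Section sub_sigma_algebra.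
Context {d : measure_display} {T : measurableType d} {R : realType}.
Variable P : probability T R.
Implicit Types (G : set (set T)) (x y z f g : T -> R).

(** The domain is retyped with the sigma-algebra generated by [G], so that the closure lemmas for
    measurable functions apply to it unchanged. *)
Definition gmeas {d'} {E : measurableType d'} G (X : T -> E) : Prop :=
  measurable_fun setT (X : g_sigma_algebraType G -> E).

Lemma sub_salgebra_measurable G : G `<=` measurable -> <<s G >> `<=` measurable.
Proof. by apply: smallest_sub; exact: sigma_algebra_measurable. Qed.

Lemma gmeas_measurable {d'} {E : measurableType d'} G (X : T -> E) :
  G `<=` measurable -> gmeas G X -> measurable_fun setT X.
Proof.
move=> Gm mX _ Y mY; apply: (sub_salgebra_measurable Gm).
exact: (mX measurableT Y mY).
Qed.

Lemma gmeas_preimage {d'} {E : measurableType d'} G (X : T -> E) A :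
  gmeas G X -> measurable A -> <<s G >> (X @^-1` A).
Proof. by move=> mX mA; rewrite -(setTI (_ @^-1` _)); exact: (mX measurableT A mA). Qed.

Lemma gmeasP {d'} {E : measurableType d'} G (X : T -> E) :
  sigma_rv X `<=` <<s G >> <-> gmeas G X.
Proof.
split=> [h _ Y mY|h _ [Y mY <-]]; first by apply: h; exists Y.
exact: (h measurableT Y mY).
Qed.

Lemma gmeas_sub {d'} {E : measurableType d'} G H (X : T -> E) :
  G `<=` <<s H >> -> gmeas G X -> gmeas H X.
Proof.
move=> GH mX _ Y mY; have := mX measurableT Y mY.
by apply: smallest_sub => //; exact: smallest_sigma_algebra.
Qed.

(** Since z t is the length of ]0, z t[, Tonelli turns an integral weighted by z into integrals over
    superlevel sets of z. *)
Lemma layer_cake f z : measurable_fun setT f -> measurable_fun setT z ->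
  (forall t, 0 <= f t) -> (forall t, 0 <= z t) ->
  (\int[P]_t (f t * z t)%:E =
   \int[@lebesgue_measure R]_y
     if (0 < y)%R then \int[P]_(t in [set t | (y < z t)%R]) (f t)%:E else 0)%E.
Proof.
move=> mf mz f0 z0; pose GR := measurableTypeR R.
pose U := [set t : T * GR | (0 < t.2) && (t.2 < z t.1)].
have mU : measurable U.
  have : measurable_fun setT (fun t : T * GR => (0 < t.2) && (t.2 < z t.1)).
    apply: measurable_and; first by apply: measurable_fun_ltr.
    by apply: measurable_fun_ltr => //; exact: measurableT_comp.
  by move=> /(_ measurableT [set true]); rewrite setTI; apply.
pose k (t : T * GR) := (f t.1 * \1_U t)%:E.
have mk : measurable_fun setT k.
  apply/measurable_EFinP; apply: measurable_funM; first exact: measurableT_comp.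
  exact: measurable_indic.
have k0 t : (0 <= k t)%E by rewrite lee_fin mulr_ge0.
have := @fubini_tonelli _ _ T GR R P (@lebesgue_measure R) k mk k0.
rewrite /fubini_F /fubini_G => FT.
transitivity (\int[P]_t \int[@lebesgue_measure R]_y k (t, y))%E.
  apply: eq_integral => t _; rewrite /k /=.
  have h (y : R) : \1_U (t, y) = \1_(`]0, z t[%classic) y :> R.
    by rewrite !indicE; congr (_%:R); apply/idP/idP; rewrite !inE /U/= in_itv.
  have -> : (fun y : GR => (f t * \1_U (t, y))%:E) = (fun=> (f t)%:E) \_ (`]0, z t[%classic).
    apply/funext => y; rewrite h indicE /patch /=.
    by case: ifP => _; rewrite ?mulr1 ?mulr0.
  rewrite -integral_mkcond integral_cst//= lebesgue_measure_itv/= lte_fin.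
  have [zt|] := ltrP 0 (z t); first by rewrite oppr0 adde0 EFinM.
  move=> zt; have -> : z t = 0 by apply/eqP; rewrite eq_le zt z0.
  by rewrite mulr0 mule0.
rewrite FT; apply: eq_integral => y _; rewrite /k /=.
have [y0|y0] := ifPn; last first.
  apply: integral0_eq => t _; rewrite indicE memNset ?mulr0//=.
  by rewrite /U /= (negbTE y0).
rewrite [RHS]integral_mkcond; apply: eq_integral => t _.
rewrite /patch indicE.
have -> : ((t, y) \in U) = (t \in [set t | (y < z t)%R]).
  by apply/idP/idP; rewrite !inE /U/= y0.
by case: ifP => _; rewrite ?mulr1 ?mulr0.
Qed.

(** The superlevel sets of z belong to the sigma-algebra, so equality over its sets passes to the
    weight z through [layer_cake], without simple functions. *)
Lemma ge0_eq_integralM G f g z : measurable_fun setT f -> measurable_fun setT g ->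
  G `<=` measurable -> gmeas G z ->
  (forall t, 0 <= f t) -> (forall t, 0 <= g t) -> (forall t, 0 <= z t) ->
  (forall A, <<s G >> A ->
    \int[P]_(t in A) (f t)%:E = \int[P]_(t in A) (g t)%:E)%E ->
  (\int[P]_t (f t * z t)%:E = \int[P]_t (g t * z t)%:E)%E.
Proof.
move=> mf mg Gm mz f0 g0 z0 fg; have mz' := gmeas_measurable Gm mz.
rewrite !layer_cake//; apply: eq_integral => y _; case: ifP => // y0.
apply: fg; have -> : [set t | y < z t] = z @^-1` `]y, +oo[.
  by apply/seteqP; split => t /=; rewrite in_itv/= andbT.
exact: gmeas_preimage.
Qed.

(** This is E[x | G] = 0, stated through integrals over sets. *)
Definition centered_on G x : Prop :=
  P.-integrable setT (EFin \o x) /\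
  forall A, <<s G >> A -> (\int[P]_(t in A) (x t)%:E = 0)%E.

Lemma integrable_meas x : P.-integrable setT (EFin \o x) -> measurable_fun setT x.
Proof. by move=> /integrableP[/measurable_EFinP]. Qed.

Lemma integrable_sub x A : measurable A ->
  P.-integrable setT (EFin \o x) -> P.-integrable A (EFin \o x).
Proof. by move=> mA; apply: integrableS. Qed.

Lemma integrable_le x y : measurable_fun setT x ->
  P.-integrable setT (EFin \o y) -> (forall t, `|x t| <= `|y t|) ->
  P.-integrable setT (EFin \o x).
Proof.
move=> mx iy xy; apply: (le_integrable measurableT _ _ iy).
  exact/measurable_EFinP.
by move=> t _ /=; rewrite lee_fin.
Qed.

(** The pull-out rule. The four products of positive and negative parts are dominated by |x z|,
    hence integrable as soon as x z is; over sets of the sigma-algebra the two parts of x have equal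
    integrals, so they agree against each part of z. *)
Lemma centered_onM G x z : G `<=` measurable -> centered_on G x -> gmeas G z ->
  P.-integrable setT (EFin \o (fun t => x t * z t)) ->
  (\int[P]_t (x t * z t)%:E = 0)%E.
Proof.
move=> Gm [ix x0] mz ixz.
have mx := integrable_meas ix; have mz' := gmeas_measurable Gm mz.
have mxp : measurable_fun setT x^\+ by exact: measurable_funrpos.
have mxn : measurable_fun setT x^\- by exact: measurable_funrneg.
have xE t : x t = x^\+ t - x^\- t by rewrite -[in LHS](funrposBneg x).
have xN t : `|x t| = x^\+ t + x^\- t by rewrite -[LHS]/((Num.norm \o x) t) -funrposDneg.
have zE t : z t = z^\+ t - z^\- t by rewrite -[in LHS](funrposBneg z).
have zN t : `|z t| = z^\+ t + z^\- t by rewrite -[LHS]/((Num.norm \o z) t) -funrposDneg.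
have [p0 n0] : (forall t, 0 <= x^\+ t) /\ (forall t, 0 <= x^\- t) by [].
have [zp0 zn0] : (forall t, 0 <= z^\+ t) /\ (forall t, 0 <= z^\- t) by [].
have mzp : gmeas G z^\+ by exact: measurable_funrpos.
have mzn : gmeas G z^\- by exact: measurable_funrneg.
have mzp' := gmeas_measurable Gm mzp; have mzn' := gmeas_measurable Gm mzn.
set a := x^\+ in mxp xE xN p0 *; set b := x^\- in mxn xE xN n0 *.
set u := z^\+ in mzp mzp' zE zN zp0 *; set v := z^\- in mzn mzn' zE zN zn0 *.
clearbody a b u v.
have ia : P.-integrable setT (EFin \o a).
  by apply: (integrable_le mxp ix) => t; rewrite xN ger0_norm// lerDl.
have ib : P.-integrable setT (EFin \o b).
  by apply: (integrable_le mxn ix) => t; rewrite xN ger0_norm// lerDr.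
have ipr (c e : T -> R) : measurable_fun setT c -> measurable_fun setT e ->
    (forall t, 0 <= c t <= a t + b t) -> (forall t, 0 <= e t <= u t + v t) ->
    P.-integrable setT (EFin \o (fun t => c t * e t)).
  move=> mc me ch eh; apply: (integrable_le _ ixz) => [|t].
    exact: measurable_funM.
  have /andP[c0 c1] := ch t; have /andP[e0 e1] := eh t.
  by rewrite !normrM xN zN !ger0_norm// ler_pM.
have iau : P.-integrable setT (EFin \o (fun t => a t * u t)).
  by apply: ipr => // t; rewrite ?p0 ?zp0 ?n0 ?zn0 ?lerDl ?lerDr ?p0 ?zp0 ?n0 ?zn0.
have ibu : P.-integrable setT (EFin \o (fun t => b t * u t)).
  by apply: ipr => // t; rewrite ?p0 ?zp0 ?n0 ?zn0 ?lerDl ?lerDr ?p0 ?zp0 ?n0 ?zn0.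
have iav : P.-integrable setT (EFin \o (fun t => a t * v t)).
  by apply: ipr => // t; rewrite ?p0 ?zp0 ?n0 ?zn0 ?lerDl ?lerDr ?p0 ?zp0 ?n0 ?zn0.
have ibv : P.-integrable setT (EFin \o (fun t => b t * v t)).
  by apply: ipr => // t; rewrite ?p0 ?zp0 ?n0 ?zn0 ?lerDl ?lerDr ?p0 ?zp0 ?n0 ?zn0.
have ab A : <<s G >> A -> (\int[P]_(t in A) (a t)%:E = \int[P]_(t in A) (b t)%:E)%E.
  move=> GA; have mA := sub_salgebra_measurable Gm GA; have := x0 _ GA.
  under eq_integral do rewrite xE EFinB.
  have fa := integrable_fin_num mA (integrable_sub mA ia).
  have fb := integrable_fin_num mA (integrable_sub mA ib).
  rewrite integralB_EFin//; [|exact: integrable_sub|exact: integrable_sub].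
  by rewrite -(fineK fa) -(fineK fb) -EFinB => -[] /eqP; rewrite subr_eq0 => /eqP ->.
have eu := ge0_eq_integralM mxp mxn Gm mzp p0 n0 zp0 ab.
have ev := ge0_eq_integralM mxp mxn Gm mzn p0 n0 zn0 ab.
transitivity (\int[P]_t ((a t * u t - b t * u t)%:E - (a t * v t - b t * v t)%:E))%E.
  by apply: eq_integral => t _; rewrite -EFinB xE zE; congr EFin; ring.
have i1 := integrableB measurableT iau ibu.
have i2 := integrableB measurableT iav ibv.
rewrite integralB_EFin//.
under eq_integral do rewrite EFinB.
under [X in (_ - X)%E]eq_integral do rewrite EFinB.
rewrite !integralB_EFin// eu ev !subee ?sube0//.
- exact: (integrable_fin_num measurableT ibv).
- exact: (integrable_fin_num measurableT ibu).
Qed.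

(** The sets over which x integrates to zero form a Dynkin system: complements work because [setT]
    is in [G], disjoint unions because x is integrable. *)
Lemma centered_on_pi G x : G `<=` measurable -> setI_closed G -> G setT ->
  P.-integrable setT (EFin \o x) ->
  (forall A, G A -> (\int[P]_(t in A) (x t)%:E = 0)%E) -> centered_on G x.
Proof.
move=> Gm GI GT ix x0; split => //.
pose H := [set A | measurable A /\ (\int[P]_(t in A) (x t)%:E = 0)%E].
suff GH : <<s G >> `<=` H by move=> A /GH[].
have mx := integrable_meas ix.
apply: dynkin_induction => //; first by move=> A GA; split; [exact: Gm|exact: x0].
split.
- by split => //; exact: x0.
- move=> A [mA A0]; split; first exact: measurableC.
  have := x0 _ GT; rewrite -(setUv A) integral_setU//.
  + by rewrite A0 add0e.
  + exact: measurableC.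
  + by rewrite setUv; exact/measurable_EFinP.
  + by apply/disj_set2P; rewrite setICr.
- move=> F tF FH; have mF k : measurable (F k) by have [] := FH k.
  split; first exact: bigcupT_measurable.
  rewrite integral_bigcup//; last first.
    by apply: integrable_sub => //; exact: bigcupT_measurable.
  by apply: eseries0 => k _ _; have [] := FH k.
Qed.

End sub_sigma_algebra.

(** * Conditional expectations given by their defining integrals *)

Section conditional.
Context {d : measure_display} {T : measurableType d} {R : realType}.
Variable P : probability T R.
Implicit Types (G : set (set T)) (x y z f g : T -> R).
Local Notation integrable := (P.-integrable setT).

Definition mean0 x : Prop := integrable (EFin \o x) /\ (\int[P]_t (x t)%:E = 0)%E.

Lemma mean0D x y : mean0 x -> mean0 y -> mean0 (fun t => x t + y t).
Proof.
move=> [ix x0] [iy y0]; split; first exact: (integrableD measurableT ix iy).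
by under eq_integral do rewrite EFinD; rewrite integralD// x0 y0 adde0.
Qed.

Lemma mean0Z c x : mean0 x -> mean0 (fun t => c * x t).
Proof.
move=> [ix x0]; split; first exact: (integrableZl measurableT c ix).
by under eq_integral do rewrite EFinM; rewrite integralZl// x0 mule0.
Qed.

Lemma mean0N x : mean0 x -> mean0 (fun t => - x t).
Proof. by move=> /(mean0Z (-1)); under eq_fun do rewrite mulN1r. Qed.

Lemma mean0B x y : mean0 x -> mean0 y -> mean0 (fun t => x t - y t).
Proof. by move=> mx /mean0N; exact: mean0D. Qed.

Lemma integral_setE x A :
  (\int[P]_(t in A) (x t)%:E = \int[P]_t (x t * \1_A t)%:E)%E.
Proof.
rewrite integral_mkcond; apply: eq_integral => t _.
by rewrite /patch indicE; case: ifP => _; rewrite ?mulr1 ?mulr0.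
Qed.

Lemma bounded_integrable c x : measurable_fun setT x -> (forall t, `|x t| <= c) ->
  integrable (EFin \o x).
Proof.
move=> mx xc; apply: measurable_bounded_integrable => //.
  by rewrite -ge0_fin_numE //= fin_num_measure.
by exists c; split; rewrite ?num_real// => M cM t _; exact: (le_trans (xc t) (ltW cM)).
Qed.

Lemma bounded_integrableM c x y : measurable_fun setT x -> (forall t, `|x t| <= c) ->
  integrable (EFin \o y) -> integrable (EFin \o (fun t => x t * y t)).
Proof.
move=> mx xc iy; have my := integrable_meas iy.
have c0 (t : T) : 0 <= c by exact: le_trans (xc t).
apply: (integrable_le (y := fun t => c * y t)); first exact: measurable_funM.
  exact: (integrableZl measurableT c iy).
by move=> t; rewrite !normrM ler_wpM2r// (ger0_norm (c0 t)).
Qed.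

Lemma salgebra_id G : sigma_algebra setT G -> <<s G >> = G.
Proof. exact: sigma_algebra_id. Qed.

Section cond_exp.
Variable G : set (set T).
Hypotheses (sG : sigma_algebra setT G) (Gm : G `<=` measurable).

Lemma cond_exp_gmeas X Y : is_cond_exp P G X Y -> gmeas G Y.
Proof. by move=> [_ YG _]; apply/gmeasP; rewrite salgebra_id. Qed.

(** Integrability is required of X only; that of Y follows from the defining identity on the set
    where Y is nonnegative and on its complement, both in [G]. *)
Lemma cond_exp_integrable X Y : is_cond_exp P G X Y -> integrable (EFin \o Y).
Proof.
move=> cXY; have mY := cond_exp_gmeas cXY; have [iX _ XY] := cXY.
have mY' := gmeas_measurable Gm mY.
apply/integrableP; split; first exact/measurable_EFinP.
pose A := [set t | 0 <= Y t].
have GA : G A.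
  rewrite -(salgebra_id sG) (_ : A = Y @^-1` `[0, +oo[); first exact: gmeas_preimage.
  by apply/seteqP; split => t; rewrite /A /= in_itv/= andbT.
have GAC : G (~` A) by have [_ GC _] := sG; rewrite -setTD; exact: GC.
have mA := Gm GA; have mAC := Gm GAC.
rewrite -(setUv A) ge0_integral_setU//; last 2 first.
- by rewrite setUv; apply: measurableT_comp => //; exact/measurable_EFinP.
- by apply/disj_set2P; rewrite setICr.
have -> : (\int[P]_(t in A) `|(EFin \o Y) t| = \int[P]_(t in A) (Y t)%:E)%E.
  by apply: eq_integral => t; rewrite inE /A/= => Yt; rewrite ger0_norm.
have -> : (\int[P]_(t in ~` A) `|(EFin \o Y) t| = - \int[P]_(t in ~` A) (Y t)%:E)%E.
  rewrite -[LHS]oppeK; congr (- _)%E; rewrite -integral_ge0N; last by [].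
  apply: eq_integral => t; rewrite inE /A/= => /negP; rewrite -ltNge => Yt.
  by rewrite /= ltr0_norm// opprK.
rewrite -!XY//; apply: lte_add_pinfty.
  by rewrite ltey_eq (integrable_fin_num mA (integrable_sub mA iX)).
by rewrite ltey_eq fin_numN (integrable_fin_num mAC (integrable_sub mAC iX)).
Qed.

Lemma cond_exp_centered X Y : is_cond_exp P G X Y ->
  centered_on P G (fun t => X t - Y t).
Proof.
move=> cXY; have iY := cond_exp_integrable cXY; have [iX _ XY] := cXY.
split; first exact: (integrableB measurableT iX iY).
rewrite salgebra_id// => A GA; have mA := Gm GA.
under eq_integral do rewrite EFinB.
rewrite integralB_EFin//; [|exact: integrable_sub|exact: integrable_sub].
by rewrite XY// subee// (integrable_fin_num mA (integrable_sub mA iY)).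
Qed.

(** Over the set of [G] where Y exceeds Y', the integral of Y - Y' is nonpositive although the
    integrand is positive, so that set is null. *)
Lemma cond_exp_le X Y X' Y' : is_cond_exp P G X Y -> is_cond_exp P G X' Y' ->
  (forall t, X t <= X' t) -> {ae P, forall t, Y t <= Y' t}.
Proof.
move=> cXY cXY' XX'.
have [iY iY'] := (cond_exp_integrable cXY, cond_exp_integrable cXY').
have [iX iX'] : integrable (EFin \o X) /\ integrable (EFin \o X').
  by have [] := cXY; have [] := cXY'.
have [mY mY'] := (integrable_meas iY, integrable_meas iY').
pose A := [set t | Y' t < Y t].
have GA : G A.
  rewrite -(salgebra_id sG) (_ : A = (fun t => Y t - Y' t) @^-1` `]0, +oo[).
    apply: gmeas_preimage => //.
    exact: (measurable_funB (cond_exp_gmeas cXY) (cond_exp_gmeas cXY')).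
  by apply/seteqP; split => t; rewrite /A /= in_itv/= andbT subr_gt0.
have mA := Gm GA.
have : (\int[P]_(t in A) (Y t - Y' t)%:E <= 0)%E.
  under eq_integral do rewrite EFinB.
  rewrite integralB_EFin//; [|exact: integrable_sub|exact: integrable_sub].
  have [_ _ <-//] := cXY; have [_ _ <-//] := cXY'.
  rewrite leeBlDr ?add0e ?(integrable_fin_num mA (integrable_sub mA iX'))//.
  apply: le_integral => //; [exact: integrable_sub|exact: integrable_sub|].
  by move=> t _; rewrite lee_fin.
move=> h.
have h0 : (\int[P]_(t in A) `|(Y t - Y' t)%:E| = 0)%E.
  apply/eqP; rewrite eq_le integral_ge0// andbT; apply: le_trans h.
  rewrite le_eqVlt; apply/orP; left; apply/eqP; apply: eq_integral => t.
  by rewrite inE /A /= => At; rewrite gtr0_norm// subr_gt0.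
move/ae_eq_integral_abs : h0; case => //.
  by apply/measurable_EFinP; apply: measurable_funTS; exact: measurable_funB.
move=> N [mN PN sN]; exists N; split => // t /= /negP; rewrite -ltNge => tA.
apply: sN => /= /(_ tA) /eqP; rewrite eqe subr_eq0 => /eqP e.
by move: tA; rewrite e ltxx.
Qed.

Lemma cond_exp_cst (c : R) : is_cond_exp P G (fun=> c) (fun=> c).
Proof.
split => //; first exact: (bounded_integrable (c := `|c|)).
rewrite -(salgebra_id sG); apply/gmeasP; exact: measurable_cst.
Qed.

End cond_exp.
End conditional.

(** * Conditional independence implies vanishing correlation *)

Section conditional_independence.
Context {d : measure_display} {T : measurableType d} {R : realType}.
Variable P : probability T R.
Context {d' : measure_display} {E : measurableType d'} {n : nat}.
Variables (G : set (set T)) (X : 'I_n -> T -> E).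
Hypotheses (sG : sigma_algebra setT G) (Gm : G `<=` measurable)
  (mX : forall i, measurable_fun setT (X i)) (cX : cond_indep P G X).
Local Notation integrable := (P.-integrable setT).

(** A version of a conditional probability lies in [0, 1] only almost surely; clamping gives one
    bounded everywhere, by which integrable variables can be multiplied. *)
Let clamp (y : R) : R := Num.max 0 (Num.min y 1).

Let clamp_in01 y : 0 <= clamp y <= 1.
Proof. by rewrite /clamp le_max lexx ge_max ler01 ge_min lexx orbT. Qed.

Let clamp_id y : 0 <= y <= 1 -> clamp y = y.
Proof. by move=> /andP[y0 y1]; rewrite /clamp (min_idPl y1) (max_idPr y0). Qed.

Let mpre i A : measurable A -> measurable (X i @^-1` A).
Proof. by move=> mA; rewrite -(setTI (_ @^-1` _)); exact: mX. Qed.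

Lemma ae_eq_cond_exp Z Y Y' : is_cond_exp P G Z Y -> gmeas G Y' ->
  {ae P, forall t, Y t = Y' t} -> is_cond_exp P G Z Y'.
Proof.
move=> cZ mY' YY'; have [iZ YG ZY] := cZ; split => //.
  by rewrite -(salgebra_id sG); apply/gmeasP.
move=> A GA; rewrite ZY//; apply: ae_eq_integral; first exact: Gm.
- apply/measurable_EFinP; apply: measurable_funTS.
  exact: (gmeas_measurable Gm (cond_exp_gmeas sG cZ)).
- by apply/measurable_EFinP; apply: measurable_funTS; exact: (gmeas_measurable Gm mY').
- by apply: filterS YY' => t -> _.
Qed.

Lemma cond_exp_indic_clamp A Y : measurable A -> is_cond_exp P G \1_A Y ->
  {ae P, forall t, Y t = clamp (Y t)}.
Proof.
move=> mA cY.
have h0 : {ae P, forall t, 0 <= Y t}.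
  by apply: (cond_exp_le sG Gm (cond_exp_cst P sG 0) cY) => t; rewrite indicE.
have h1 : {ae P, forall t, Y t <= 1}.
  apply: (cond_exp_le sG Gm cY (cond_exp_cst P sG 1)) => t.
  by rewrite indicE lern1 leq_b1.
by apply: filterS2 h0 h1 => t y0 y1; rewrite clamp_id// y0.
Qed.

(** All other factors are taken to be the full space; their conditional probabilities equal 1 almost
    surely and drop out of the product. *)
Lemma cond_indep_pair i j A A' : i != j -> measurable A -> measurable A' ->
  exists Yi Yj : T -> R,
    [/\ is_cond_exp P G \1_(X i @^-1` A) Yi,
        is_cond_exp P G \1_(X j @^-1` A') Yj,
        (forall t, 0 <= Yi t <= 1 /\ 0 <= Yj t <= 1) &
        is_cond_exp P G (\1_(X i @^-1` A `&` X j @^-1` A')) (fun t => Yi t * Yj t)].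
Proof.
move=> ij mA mA'.
pose F k := if k == i then A else if k == j then A' else setT.
have mF k : measurable (F k) by rewrite /F; case: ifP => // _; case: ifP.
have [Y [cY cYY]] := cX mF.
have Fi : F i = A by rewrite /F eqxx.
have Fj : F j = A' by rewrite /F eqxx eq_sym (negbTE ij).
have Y1 k : k != i -> k != j -> {ae P, forall t, Y k t = 1}.
  move=> ki kj; have := cY k; rewrite /F (negbTE ki) (negbTE kj) => ck.
  have i1 t : \1_(X k @^-1` setT) t = 1 :> R by rewrite preimage_setT indicT.
  have h1 : {ae P, forall t, Y k t <= 1}.
    by apply: (cond_exp_le sG Gm ck (cond_exp_cst P sG 1)) => t; rewrite i1.
  have h2 : {ae P, forall t, 1 <= Y k t}.
    by apply: (cond_exp_le sG Gm (cond_exp_cst P sG 1) ck) => t; rewrite i1.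
  by apply: filterS2 h1 h2 => t h1 h2; apply/eqP; rewrite eq_le h1.
have mYk k : gmeas G (Y k) := cond_exp_gmeas sG (cY k).
have mck k : gmeas G (fun t => clamp (Y k t)).
  apply: measurable_maxr; first exact: measurable_cst.
  by apply: measurable_minr; [exact: mYk|exact: measurable_cst].
have ci k : {ae P, forall t, Y k t = clamp (Y k t)}.
  by apply: cond_exp_indic_clamp (cY k); exact: mpre.
exists (fun t => clamp (Y i t)), (fun t => clamp (Y j t)); split => //.
- by rewrite -Fi; apply: ae_eq_cond_exp (cY i) _ _.
- by rewrite -Fj; apply: ae_eq_cond_exp (cY j) _ _.
have -> : X i @^-1` A `&` X j @^-1` A' = \bigcap_k (X k @^-1` F k).
  apply/seteqP; split => [t [ti tj] k _|t h].
    rewrite /F /preimage /=; case: eqP => [->//|_]; case: eqP => [->//|//].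
  by split; [have := h i Logic.I; rewrite Fi|have := h j Logic.I; rewrite Fj].
apply: (ae_eq_cond_exp cYY); first exact: (measurable_funM (mck i) (mck j)).
have oth : {ae P, forall t k, k != i -> k != j -> Y k t = 1}.
  apply: filter_forall => k; have [->|ki] := eqVneq k i.
    by apply: filterE => t /eqP.
  have [->|kj] := eqVneq k j; first by apply: filterE => t _ /eqP.
  by apply: filterS (Y1 _ ki kj) => t ->.
apply: filterS3 (ci i) (ci j) oth => t <- <- h.
rewrite /= (bigD1 i)//= (bigD1 j)//=; last by rewrite eq_sym.
rewrite big1 ?mulr1// => k /andP[? ?].
exact: h.
Qed.

(** A pi-system generating the join of [G] and the sigma-algebra of [X i], on which [centered_on_pi]
    can be checked. *)
Let pi_gen i : set (set T) := [set B `&` X i @^-1` A | B in G & A in measurable].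

Let pi_gen_setI i : setI_closed (pi_gen i).
Proof.
move=> _ _ [B GB [A mA <-]] [B' GB' [A' mA' <-]].
exists (B `&` B'); last by exists (A `&` A'); [exact: measurableI|rewrite setIACA].
by rewrite -(salgebra_id sG); apply: (@measurableI _ (g_sigma_algebraType G)); rewrite /measurable/= salgebra_id.
Qed.

Let GT : G setT.
Proof. by rewrite -(salgebra_id sG); exact: (@measurableT _ (g_sigma_algebraType G)). Qed.

Let pi_gen_measurable i : pi_gen i `<=` measurable.
Proof. by move=> _ [B GB [A mA <-]]; apply: measurableI; [exact: Gm|exact: mpre]. Qed.

Let pi_gen_T i : pi_gen i setT.
Proof. by exists setT => //; exists setT => //; rewrite preimage_setT setIT. Qed.

Let gen_pi i : G `|` sigma_rv (X i) `<=` <<s pi_gen i >>.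
Proof.
move=> B [GB|[A mA <-]]; apply: sub_sigma_algebra.
  by exists B => //; exists setT => //; rewrite preimage_setT setIT.
by exists setT => //; exists A.
Qed.

Let G_pi i : G `<=` <<s pi_gen i >>.
Proof. by move=> B GB; apply: gen_pi; left. Qed.

Let gmeas_indic H B : <<s H >> B -> gmeas H (\1_B : T -> R).
Proof. by move=> HB; apply: (@measurable_indic _ (g_sigma_algebraType H)). Qed.

Let indic_le1 (B : set T) t : `|\1_B t| <= 1 :> R.
Proof. by rewrite indicE ger0_norm// lern1 leq_b1. Qed.

(** Adding [X i] to the conditioning does not alter the conditional law of [X j]. Over a set of
    [pi_gen i] the integrand decomposes into four variables, each centered by one conditional
    expectation given [G]. *)
Let cond_centered i j A' Yj : i != j -> measurable A' ->
  is_cond_exp P G \1_(X j @^-1` A') Yj -> (forall t, 0 <= Yj t <= 1) ->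
  centered_on P (pi_gen i) (fun t => \1_(X j @^-1` A') t - Yj t).
Proof.
move=> ij mA' cYj Yj01.
have mYj := cond_exp_gmeas sG cYj; have mYj' := gmeas_measurable Gm mYj.
have mI : measurable_fun setT (\1_(X j @^-1` A') : T -> R).
  by apply: measurable_indic; exact: mpre.
have [iw _] := cond_exp_centered sG Gm cYj.
apply: (centered_on_pi (@pi_gen_measurable i) (@pi_gen_setI i) (pi_gen_T i) iw).
move=> _ [B GB [A mA <-]].
have [Yi [Zj [cYi cZj Y01 cYZ]]] := cond_indep_pair ij mA mA'.
have mYi := cond_exp_gmeas sG cYi; have mYi' := gmeas_measurable Gm mYi.
have mB : gmeas G (\1_B : T -> R) by apply: gmeas_indic; rewrite salgebra_id.
have mB' := gmeas_measurable Gm mB.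
have mAi : measurable_fun setT (\1_(X i @^-1` A) : T -> R).
  by apply: measurable_indic; exact: mpre.
have bnd (x : T -> R) : measurable_fun setT x -> (forall t, `|x t| <= 1) -> forall y : T -> R,
  integrable (EFin \o y) -> integrable (EFin \o (fun t => y t * x t)).
  move=> mx x1 y iy; under eq_fun do rewrite mulrC.
  exact: (bounded_integrableM mx x1).
have Yi1 t : `|Yi t| <= 1 by have [/andP[? ?] _] := Y01 t; rewrite ger0_norm.
have Yj1 t : `|Yj t| <= 1 by have /andP[? ?] := Yj01 t; rewrite ger0_norm.
have m1 : mean0 P (fun t => (\1_(X i @^-1` A `&` X j @^-1` A') t - Yi t * Zj t) * \1_B t).
  have c := cond_exp_centered sG Gm cYZ; have [ic _] := c.
  have i' := bnd _ mB' (indic_le1 B) _ ic.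
  by split => //; exact: (centered_onM Gm c mB i').
(* The difference of [m2] and [m3] exchanges the version [Zj] supplied with the pair for the given
   [Yj], with no appeal to almost sure uniqueness. *)
have m2 : mean0 P (fun t => (\1_(X j @^-1` A') t - Yj t) * (Yi t * \1_B t)).
  have c := cond_exp_centered sG Gm cYj; have [ic _] := c.
  have mm : gmeas G (fun t => Yi t * \1_B t) by exact: measurable_funM.
  have b1 t : `|Yi t * \1_B t| <= 1.
    by rewrite normrM (le_trans (ler_piMr _ (indic_le1 B t))).
  have i' := bnd _ (gmeas_measurable Gm mm) b1 _ ic.
  by split => //; exact: (centered_onM Gm c mm i').
have m3 : mean0 P (fun t => (\1_(X j @^-1` A') t - Zj t) * (Yi t * \1_B t)).
  have c := cond_exp_centered sG Gm cZj; have [ic _] := c.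
  have mm : gmeas G (fun t => Yi t * \1_B t) by exact: measurable_funM.
  have b1 t : `|Yi t * \1_B t| <= 1.
    by rewrite normrM (le_trans (ler_piMr _ (indic_le1 B t))).
  have i' := bnd _ (gmeas_measurable Gm mm) b1 _ ic.
  by split => //; exact: (centered_onM Gm c mm i').
have m4 : mean0 P (fun t => (\1_(X i @^-1` A) t - Yi t) * (Yj t * \1_B t)).
  have c := cond_exp_centered sG Gm cYi; have [ic _] := c.
  have mm : gmeas G (fun t => Yj t * \1_B t) by exact: measurable_funM.
  have b1 t : `|Yj t * \1_B t| <= 1.
    by rewrite normrM (le_trans (ler_piMr _ (indic_le1 B t))).
  have i' := bnd _ (gmeas_measurable Gm mm) b1 _ ic.
  by split => //; exact: (centered_onM Gm c mm i').
have [_ <-] := mean0B (mean0D m1 (mean0B m2 m3)) m4.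
rewrite integral_setE; apply: eq_integral => t _; congr EFin.
by rewrite !indicI /=; ring.
Qed.

(** It suffices that x stays centered when [X j] joins the conditioning. Over a set of [pi_gen j],
    the indicator of X j in A' is [Yj], which is [G]-measurable and hence orthogonal to x, plus a
    remainder centered on [pi_gen i], for which x is a measurable multiplier. *)
Lemma cond_indep_uncorr i j x y : i != j -> centered_on P G x ->
  gmeas (G `|` sigma_rv (X i)) x -> gmeas (G `|` sigma_rv (X j)) y ->
  integrable (EFin \o (fun t => x t * y t)) ->
  (\int[P]_t (x t * y t)%:E = 0)%E.
Proof.
move=> ij cx mx my ixy; have [ix _] := cx; have mx' := integrable_meas ix.
have mxi : gmeas (pi_gen i) x := gmeas_sub (@gen_pi i) mx.
have myj : gmeas (pi_gen j) y := gmeas_sub (@gen_pi j) my.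
apply: (centered_onM (@pi_gen_measurable j) _ myj ixy).
apply: (centered_on_pi (@pi_gen_measurable j) (@pi_gen_setI j) (pi_gen_T j) ix).
move=> _ [B GB [A' mA' <-]].
have [Zi [Yj [_ cYj Y01' _]]] := cond_indep_pair ij measurableT mA'.
have Y01 t : 0 <= Yj t <= 1 by have [] := Y01' t.
have mYj := cond_exp_gmeas sG cYj; have mYj' := gmeas_measurable Gm mYj.
have mB : gmeas G (\1_B : T -> R) by apply: gmeas_indic; rewrite salgebra_id.
have mB' := gmeas_measurable Gm mB.
have cw := cond_centered ij mA' cYj Y01; have [iw _] := cw.
have mw := integrable_meas iw.
have w1 t : `|\1_(X j @^-1` A') t - Yj t| <= 1.
  have := Y01 t; have := indic_le1 (X j @^-1` A') t; rewrite !ler_norml indicE.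
  by move=> /andP[_ h] /andP[? ?]; have : 0 <= (t \in X j @^-1` A')%:R :> R by []; lra.
have m1 : mean0 P (fun t => (\1_(X j @^-1` A') t - Yj t) * (x t * \1_B t)).
  have ii : integrable (EFin \o (fun t => x t * \1_B t)).
    under eq_fun do rewrite mulrC; exact: (bounded_integrableM mB' (indic_le1 B)).
  have i' := bounded_integrableM mw w1 ii.
  split => //; apply: (centered_onM (@pi_gen_measurable i) cw _ i').
  by apply: measurable_funM => //; exact: (gmeas_sub (@G_pi i) mB).
have m2 : mean0 P (fun t => x t * (Yj t * \1_B t)).
  have mm : gmeas G (fun t => Yj t * \1_B t) by exact: measurable_funM.
  have b1 t : `|Yj t * \1_B t| <= 1.
    rewrite normrM (le_trans (ler_piMr _ (indic_le1 B t)))//.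
    by have /andP[? ?] := Y01 t; rewrite ger0_norm.
  have i' : integrable (EFin \o (fun t => x t * (Yj t * \1_B t))).
    under eq_fun do rewrite mulrC.
    exact: (bounded_integrableM (gmeas_measurable Gm mm) b1).
  by split => //; exact: (centered_onM Gm cx mm i').
have [_ <-] := mean0D m1 m2.
rewrite integral_setE; apply: eq_integral => t _; congr EFin.
by rewrite !indicI /=; ring.
Qed.

End conditional_independence.

(** * Integration over an independent variable with all else frozen *)

Section freezing.
Context {d d' : measure_display} {T : measurableType d} {E : measurableType d'}
  {R : realType}.
Variable P : probability T R.
Local Notation integrable := (P.-integrable setT).

Definition mk_mfun {d1 d2} {A : measurableType d1} {B : measurableType d2}
    (f : A -> B) (mf : measurable_fun setT f) : {mfun A >-> B} :=
  MeasurableFun.Pack (MeasurableFun.Class (isMeasurableFun.Build _ _ _ _ f mf)).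

Variables (H : set (set T)) (Y : T -> E).
Hypotheses (Hm : H `<=` measurable) (mY : measurable_fun setT Y).
Hypothesis HY : forall A B, <<s H >> A -> measurable B ->
  P (A `&` Y @^-1` B) = (P A * P (Y @^-1` B))%E.

Local Notation TH := (g_sigma_algebraType H).

Let mid : measurable_fun setT (idfun : T -> TH).
Proof.
move=> _ A mA; rewrite setTI preimage_id; exact: (sub_salgebra_measurable Hm).
Qed.

Let mpair : measurable_fun setT ((fun t => (t, Y t)) : T -> TH * E).
Proof. by apply: measurable_fun_pair. Qed.

(** Independence says that the law of t |-> (t, Y t) is a product, and Tonelli applies. The first
    factor is the whole probability space with the smaller sigma-algebra, so every [H]-measurable
    quantity is frozen at once without being listed. *)
Lemma ge0_integral_freeze (F : TH * E -> \bar R) :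
  measurable_fun setT F -> (forall z, 0 <= F z)%E ->
  (\int[P]_t F (t, Y t) = \int[P]_t \int[P]_u F (t, Y u))%E.
Proof.
move=> mF F0.
pose m1 := distribution P (mk_mfun mid).
pose m2 := distribution P (mk_mfun mY).
pose m12 := distribution P (mk_mfun mpair).
have h X : measurable X -> (m1 \x m2)%E X = m12 X.
  apply: product_measure_unique => A B mA mB.
  by rewrite /m12 /m1 /m2 /distribution /pushforward /= -HY.
have -> : (\int[P]_t F (t, Y t) = \int[m12]_z F z)%E.
  by rewrite /m12 ge0_integral_distribution.
rewrite (eq_measure_integral (m1 \x m2)%E); last by move=> A mA _; symmetry; exact: h.
rewrite fubini_tonelli1// /fubini_F ge0_integral_distribution//; last first.
- by move=> t; exact: integral_ge0.
- exact: measurable_fun_fubini_tonelli_F.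
apply: eq_integral => t _ /=.
rewrite ge0_integral_distribution//.
exact: measurableT_comp.
Qed.

Lemma mean0_funrpos_funrneg (x : T -> R) : mean0 P x ->
  (\int[P]_t (x^\+ t)%:E = \int[P]_t (x^\- t)%:E)%E.
Proof.
move=> [ix x0]; have mx := integrable_meas ix.
have xE t : x t = x^\+ t - x^\- t by rewrite -[in LHS](funrposBneg x).
have xN t : `|x t| = x^\+ t + x^\- t.
  by rewrite -[LHS]/((Num.norm \o x) t) -funrposDneg.
have ip : integrable (EFin \o x^\+).
  apply: (integrable_le (measurable_funrpos mx) ix) => t.
  by rewrite xN ger0_norm// lerDl.
have in_ : integrable (EFin \o x^\-).
  apply: (integrable_le (measurable_funrneg mx) ix) => t.
  by rewrite xN ger0_norm// lerDr.
have fp := integrable_fin_num measurableT ip.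
have fn := integrable_fin_num measurableT in_.
move: x0; under eq_integral do rewrite xE EFinB.
rewrite integralB_EFin// -(fineK fp) -(fineK fn) -EFinB => -[] /eqP.
by rewrite subr_eq0 => /eqP ->.
Qed.

(** For each frozen t the positive and negative parts of F have equal means; the nonnegative case
    gives equal integrals, and integrability of F (t, Y t) allows their subtraction. *)
Lemma integral_freeze0 (F : TH * E -> R) : measurable_fun setT F ->
  integrable (EFin \o (fun t => F (t, Y t))) ->
  (forall t, mean0 P (fun u => F (t, Y u))) ->
  (\int[P]_t (F (t, Y t))%:E = 0)%E.
Proof.
move=> mF iF F0.
have mFp : measurable_fun setT (EFin \o F^\+).
  by apply/measurable_EFinP; exact: measurable_funrpos.
have mFn : measurable_fun setT (EFin \o F^\-).
  by apply/measurable_EFinP; exact: measurable_funrneg.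
have mx := integrable_meas iF.
have e : (\int[P]_t (F^\+ (t, Y t))%:E = \int[P]_t (F^\- (t, Y t))%:E)%E.
  have p0 (z : TH * E) : (0 <= ((F^\+)%R z)%:E)%E by rewrite lee_fin.
  have n0 (z : TH * E) : (0 <= ((F^\-)%R z)%:E)%E by rewrite lee_fin.
  rewrite (ge0_integral_freeze mFp p0) (ge0_integral_freeze mFn n0).
  by apply: eq_integral => t _; exact: (mean0_funrpos_funrneg (F0 t)).
have xE t : F (t, Y t) = F^\+ (t, Y t) - F^\- (t, Y t).
  by rewrite -[in LHS](funrposBneg F).
have xN t : `|F (t, Y t)| = F^\+ (t, Y t) + F^\- (t, Y t).
  by rewrite -[LHS]/((Num.norm \o F) (t, Y t)) -funrposDneg.
have ip : integrable (EFin \o (fun t => F^\+ (t, Y t))).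
  apply: (integrable_le _ iF); first exact: (measurable_funrpos mx).
  by move=> t; rewrite xN ger0_norm// lerDl.
have in_ : integrable (EFin \o (fun t => F^\- (t, Y t))).
  apply: (integrable_le _ iF); first exact: (measurable_funrneg mx).
  by move=> t; rewrite xN ger0_norm// lerDr.
have fn := integrable_fin_num measurableT in_.
transitivity (\int[P]_t ((F^\+ (t, Y t))%:E - (F^\- (t, Y t))%:E))%E.
  by apply: eq_integral => t _; rewrite xE EFinB.
by rewrite integralB_EFin// e subee.
Qed.

End freezing.

(** * One source of randomness against all the others *)

Section sources.
Context {d : measure_display} {T : measurableType d} {R : realType}.
Variable P : probability T R.
Context {I : finType} (G : I -> set (set T)) (k0 : I).
Hypotheses (Gm : forall k, G k `<=` measurable) (GT : forall k, G k setT)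
  (GI : forall k, setI_closed (G k)) (iG : mutual_indep P G).

Definition other_sources : set (set T) := \bigcup_(k in [set k | k != k0]) G k.

(** Finite intersections across the other sources: a pi-system generating their join, on which
    mutual independence speaks directly. *)
Let pi_other : set (set T) :=
  [set B | exists A : I -> set T, (forall k, G k (A k)) /\
     B = \bigcap_(k in [set k | k != k0]) A k].

Let fin_bigcapE (A : I -> set T) (Q : pred I) :
  \bigcap_(k in [set k | Q k]) A k = \bigcap_(k in [set` enum Q]) A k.
Proof.
apply/seteqP; split => t h k /=; first by rewrite mem_enum => Qk; exact: h.
by move=> Qk; apply: h; rewrite /= mem_enum.
Qed.

(** The claim says that 1_B - P(B) is centered on the join of the other sources; it is checked on
    [pi_other], where the products factor. *)
Lemma other_sources_indep A B : <<s other_sources >> A -> G k0 B ->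
  P (A `&` B) = (P A * P B)%E.
Proof.
move=> oA GB.
have mB := Gm GB.
have finPB := fin_num_measure P B mB.
have mpi : pi_other `<=` measurable.
  move=> _ [F [GF ->]]; apply: fin_bigcap_measurable; first exact: finite_finset.
  by move=> k _; exact: Gm.
pose x t : R := \1_B t - fine (P B).
have mI : measurable_fun setT (\1_B : T -> R) by exact: measurable_indic.
have i1 : P.-integrable setT (EFin \o (\1_B : T -> R)).
  by apply: (@bounded_integrable _ _ _ P 1) => // t; rewrite indicE ger0_norm// lern1 leq_b1.
have i2 : P.-integrable setT (EFin \o (fun _ : T => fine (P B))).
  exact: (@bounded_integrable _ _ _ P `|fine (P B)|).
have ix : P.-integrable setT (EFin \o x) := integrableB measurableT i1 i2.
have xA C : measurable C -> (\int[P]_(t in C) (x t)%:E = P (C `&` B) - P C * P B)%E.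
  move=> mC; under eq_integral do rewrite EFinB.
  rewrite integralB_EFin//; [|exact: integrable_sub|exact: integrable_sub].
  by rewrite integral_indic// setIC integral_cst// fineK// muleC.
suff [_ /(_ A)] : centered_on P pi_other x.
  have mA : measurable A.
    move: oA; apply: smallest_sub; first exact: sigma_algebra_measurable.
    by move=> C [k _ /Gm].
  have finA := fin_num_measure P A mA.
  have finAB := fin_num_measure P _ (measurableI _ _ mA mB).
  rewrite xA// => h.
  have sA : <<s pi_other >> A.
    move: oA; apply: smallest_sub; first exact: smallest_sigma_algebra.
    move=> C [k /= kk0 GC]; apply: sub_sigma_algebra.
    exists (fun j => if j == k then C else setT); split.
      by move=> j; case: eqP => [->|_].
    apply/seteqP; split => [t Ct j _|t /(_ k kk0)]; first by case: ifP.
    by rewrite eqxx.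
  have /eqP := h sA; rewrite -(fineK finA) -(fineK finPB) -(fineK finAB).
  by rewrite -EFinM -EFinB eqe subr_eq0 => /eqP ->.
apply: centered_on_pi => //.
- move=> _ _ [F [GF ->]] [F' [GF' ->]].
  exists (fun k => F k `&` F' k); split; first by move=> k; exact: GI.
  apply/seteqP; split => [t [h h'] k kk|t h]; first by split; [exact: h|exact: h'].
  by split => k kk; have [] := h k kk.
- exists (fun=> setT); split => //.
  by apply/seteqP; split.
move=> _ [F [GF ->]]; rewrite xA; last by apply: mpi; exists F.
pose F' k := if k == k0 then B else F k.
have GF' k : G k (F' k) by rewrite /F'; case: eqP => [->|].
have e1 : \bigcap_(k in [set k | k != k0]) F k `&` B = \bigcap_(k in [set` enum I]) F' k.
  apply/seteqP; split => [t [h hB] k _|t h].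
    by rewrite /F'; case: eqP => [//|/eqP kk]; exact: h.
  split; last by have := h k0; rewrite /F' eqxx /=; apply; rewrite mem_enum.
  move=> k /= kk; have := h k; rewrite /F' (negbTE kk); apply.
  by rewrite /= mem_enum.
rewrite e1 iG ?enum_uniq// fin_bigcapE iG ?enum_uniq//.
rewrite !big_enum/= (bigD1 k0)//= {1}/F' eqxx.
rewrite (eq_bigr (fun k => P (F k))); last first.
  by move=> k kk; rewrite /F' (negbTE kk).
have finF : (\prod_(k | k != k0) P (F k))%E \is a fin_num.
  elim/big_rec : _ => // k y _ fy.
  by rewrite fin_numM// fin_num_measure//; exact: Gm.
by rewrite muleC subee// fin_numM.
Qed.

End sources.

(** * Measurability of vector operations *)

Section vector_measurability.
Context {d : measure_display} {T : measurableType d} {R : realType} {k : nat}.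
Implicit Types (X Y : T -> 'cV[R]_k) (c : T -> R).

Lemma measurable_edot X Y : measurable_fun setT X -> measurable_fun setT Y ->
  measurable_fun setT (fun t => edot (X t) (Y t)).
Proof.
move=> mX mY; apply: measurable_sum => j.
by apply: measurable_funM; exact: measurable_fun_coord.
Qed.

Lemma measurable_enorm2 X : measurable_fun setT X ->
  measurable_fun setT (fun t => enorm (X t) ^+ 2).
Proof. by move=> mX; under eq_fun do rewrite enorm2; exact: measurable_edot. Qed.

Lemma measurable_addv X Y : measurable_fun setT X -> measurable_fun setT Y ->
  measurable_fun setT (fun t => X t + Y t).
Proof.
move=> mX mY; apply: measurable_fun_mx => i j; under eq_fun do rewrite mxE.
by apply: measurable_funD; exact: measurable_fun_coord.
Qed.

Lemma measurable_scalev c X : measurable_fun setT c -> measurable_fun setT X ->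
  measurable_fun setT (fun t => c t *: X t).
Proof.
move=> mc mX; apply: measurable_fun_mx => i j; under eq_fun do rewrite mxE.
by apply: measurable_funM => //; exact: measurable_fun_coord.
Qed.

Lemma measurable_scalev_cst (a : R) X : measurable_fun setT X ->
  measurable_fun setT (fun t => a *: X t).
Proof. by move=> mX; apply: measurable_scalev. Qed.

Lemma measurable_oppv X : measurable_fun setT X ->
  measurable_fun setT (fun t => - X t).
Proof.
by move=> mX; under eq_fun do rewrite -scaleN1r; exact: measurable_scalev_cst.
Qed.

Lemma measurable_subv X Y : measurable_fun setT X -> measurable_fun setT Y ->
  measurable_fun setT (fun t => X t - Y t).
Proof. by move=> mX mY; apply: measurable_addv => //; exact: measurable_oppv. Qed.

Lemma measurable_sumv (I : Type) (r : seq I) (Q : pred I) (X : I -> T -> 'cV[R]_k) :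
  (forall i, measurable_fun setT (X i)) ->
  measurable_fun setT (fun t => \sum_(i <- r | Q i) X i t).
Proof.
move=> mX; apply: measurable_fun_mx => i j; under eq_fun do rewrite summxE.
rewrite (_ : (fun t => _) = (fun t => \sum_(l <- r) if Q l then X l t i j else 0)).
  by apply: measurable_sum => l; case: (Q l) => //; exact: measurable_fun_coord.
by apply/funext => t; rewrite big_mkcond.
Qed.

End vector_measurability.

(** * Second moments and orthogonality of random vectors *)

Section square_integrable.
Context {d : measure_display} {T : measurableType d} {R : realType} {k : nat}.
Variable P : probability T R.
Implicit Types X Y Z : T -> 'cV[R]_k.

(** Extended-real valued, so that moment bounds can be written before finiteness is known. *)
Definition sqn X : \bar R := (\int[P]_t (enorm (X t) ^+ 2)%:E)%E.

Definition L2 X : Prop := measurable_fun setT X /\ (sqn X < +oo)%E.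

Definition orth X Y : Prop := mean0 P (fun t => edot (X t) (Y t)).

Lemma sqn_ge0 X : (0 <= sqn X)%E.
Proof. by apply: integral_ge0 => t _; rewrite lee_fin sqr_ge0. Qed.

Lemma sqn_fin_num X : L2 X -> sqn X \is a fin_num.
Proof. by move=> [_ X2]; rewrite ge0_fin_numE ?sqn_ge0. Qed.

Lemma L2P X : measurable_fun setT X ->
  L2 X <-> P.-integrable setT (EFin \o (fun t => enorm (X t) ^+ 2)).
Proof.
move=> mX; have mn := measurable_enorm2 mX.
have e : (\int[P]_t `|(EFin \o (fun t => enorm (X t) ^+ 2)%R) t| = sqn X)%E.
  by apply: eq_integral => t _ /=; rewrite ger0_norm// sqr_ge0.
split => [[_ X2]|/integrableP[_]]; last by rewrite e.
by apply/integrableP; split; [exact/measurable_EFinP|rewrite e].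
Qed.

Lemma L2_integrable X : L2 X ->
  P.-integrable setT (EFin \o (fun t => enorm (X t) ^+ 2)).
Proof. by move=> LX; have [mX _] := LX; apply/L2P. Qed.

Lemma sqnZ c X : measurable_fun setT X ->
  sqn (fun t => c *: X t) = ((c ^+ 2)%:E * sqn X)%E.
Proof.
move=> mX; rewrite /sqn; under eq_integral do rewrite enormZ EFinM.
rewrite ge0_integralZl//.
- by apply/measurable_EFinP; exact: measurable_enorm2.
- by move=> t _; rewrite lee_fin sqr_ge0.
- by rewrite lee_fin sqr_ge0.
Qed.

Lemma L2Z c X : L2 X -> L2 (fun t => c *: X t).
Proof.
move=> LX; have [mX X2] := LX; split; first exact: measurable_scalev_cst.
by rewrite sqnZ// lte_mul_pinfty// ?lee_fin ?sqr_ge0// sqn_fin_num.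
Qed.

Lemma sqnD_le X Y : measurable_fun setT X -> measurable_fun setT Y ->
  (sqn (fun t => X t + Y t)%R <= 2%:E * sqn X + 2%:E * sqn Y)%E.
Proof.
move=> mX mY.
have [nX nY] := (measurable_enorm2 mX, measurable_enorm2 mY).
rewrite /sqn -!ge0_integralZl//; last 4 first.
- by apply/measurable_EFinP.
- by move=> t _; rewrite lee_fin sqr_ge0.
- by apply/measurable_EFinP.
- by move=> t _; rewrite lee_fin sqr_ge0.
rewrite -ge0_integralD//; last 4 first.
- by move=> t _; rewrite -EFinM lee_fin mulr_ge0// sqr_ge0.
- by apply/measurable_EFinP; exact: measurable_funM.
- by move=> t _; rewrite -EFinM lee_fin mulr_ge0// sqr_ge0.
- by apply/measurable_EFinP; exact: measurable_funM.
apply: ge0_le_integral => //.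
- by move=> t _; rewrite lee_fin sqr_ge0.
- by apply/measurable_EFinP; apply: measurable_enorm2; exact: measurable_addv.
- by apply/measurable_EFinP; apply: measurable_funD; exact: measurable_funM.
- by move=> t _; rewrite -!EFinM -EFinD lee_fin enormD2_le.
Qed.

Lemma L2D X Y : L2 X -> L2 Y -> L2 (fun t => X t + Y t).
Proof.
move=> LX LY; have [[mX X2] [mY Y2]] := (LX, LY).
split; first exact: measurable_addv.
apply: le_lt_trans (sqnD_le mX mY) _.
by apply: lte_add_pinfty; rewrite lte_mul_pinfty// sqn_fin_num.
Qed.

Lemma L2_0 : L2 (fun=> 0).
Proof.
split; first exact: measurable_cst.
rewrite /sqn; under eq_integral do rewrite enorm0 expr0n.
by rewrite integral0.
Qed.

Lemma L2_sum (I : Type) (r : seq I) (X : I -> T -> 'cV[R]_k) :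
  (forall i, L2 (X i)) -> L2 (fun t => \sum_(i <- r) X i t).
Proof.
move=> LX; elim: r => [|i r IH].
  by under eq_fun do rewrite big_nil; exact: L2_0.
by under eq_fun do rewrite big_cons; exact: L2D.
Qed.

Lemma edot_integrable X Y : L2 X -> L2 Y ->
  P.-integrable setT (EFin \o (fun t => edot (X t) (Y t))).
Proof.
move=> LX LY; have [[mX _] [mY _]] := (LX, LY).
have iX := L2_integrable LX; have iY := L2_integrable LY.
apply: (integrable_le _ (integrableD measurableT iX iY)).
  exact: measurable_edot.
move=> t /=; rewrite [leRHS]ger0_norm ?addr_ge0 ?sqr_ge0//.
apply: le_trans (edot_le _ _) _.
move: (enorm (X t)) (enorm (Y t)) => a b.
have := sqr_ge0 (a - b); have := sqr_ge0 (a + b).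
by lra.
Qed.

Lemma coord_mul_integrable X Y j : L2 X -> L2 Y ->
  P.-integrable setT (EFin \o (fun t => X t j 0 * Y t j 0)).
Proof.
move=> LX LY; have [[mX _] [mY _]] := (LX, LY).
have iX := L2_integrable LX; have iY := L2_integrable LY.
apply: (integrable_le _ (integrableD measurableT iX iY)).
  by apply: measurable_funM; exact: measurable_fun_coord.
move=> t /=; rewrite [leRHS]ger0_norm ?addr_ge0 ?sqr_ge0//.
have := coord_sq_le (X t) j; have := coord_sq_le (Y t) j.
move: (X t j 0) (Y t j 0) (enorm (X t) ^+ 2) (enorm (Y t) ^+ 2) => a b c e.
have := sqr_ge0 a; have := sqr_ge0 b.
have := sqr_ge0 (a + b); have := sqr_ge0 (a - b).
by rewrite ler_norml => *; apply/andP; split; lra.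
Qed.

Lemma orth_coord X Y : L2 X -> L2 Y ->
  (forall j, (\int[P]_t (X t j 0 * Y t j 0)%:E = 0)%E) -> orth X Y.
Proof.
move=> LX LY h; split; first exact: edot_integrable.
rewrite /edot; under eq_integral do rewrite -sumEFin.
rewrite integral_sum//; first by rewrite big1.
by move=> j; exact: coord_mul_integrable.
Qed.

Lemma orthC X Y : orth X Y -> orth Y X.
Proof. by rewrite /orth; under eq_fun do rewrite edotC. Qed.

Lemma orthDr X Y Z : orth X Y -> orth X Z -> orth X (fun t => Y t + Z t).
Proof. by move=> h1 h2; rewrite /orth; under eq_fun do rewrite edotDr; exact: mean0D. Qed.

Lemma orthZr c X Y : orth X Y -> orth X (fun t => c *: Y t).
Proof. by move=> h1; rewrite /orth; under eq_fun do rewrite edotZr; exact: mean0Z. Qed.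

Lemma orthDl X Y Z : orth X Z -> orth Y Z -> orth (fun t => X t + Y t) Z.
Proof. by move=> /orthC h1 /orthC h2; exact/orthC/orthDr. Qed.

Lemma orthZl c X Y : orth X Y -> orth (fun t => c *: X t) Y.
Proof. by move=> /orthC h1; exact/orthC/orthZr. Qed.

Lemma orth0r X : orth X (fun=> 0).
Proof.
rewrite /orth; under eq_fun do rewrite edotC edot0l.
by split; [exact: integrable0|rewrite integral0].
Qed.

Lemma sqnD X Y : L2 X -> L2 Y -> orth X Y ->
  sqn (fun t => X t + Y t) = (sqn X + sqn Y)%E.
Proof.
move=> LX LY oXY; have [ixy i0] := oXY.
have iX := L2_integrable LX; have iY := L2_integrable LY.
have iXY := integrableZl measurableT 2 ixy.
rewrite /sqn.
transitivity (\int[P]_t ((enorm (X t) ^+ 2)%:E + (enorm (Y t) ^+ 2 + 2 * edot (X t) (Y t))%:E))%E.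
  by apply: eq_integral => t _; rewrite -EFinD enormD2; congr EFin; ring.
rewrite integralD//; last exact: (integrableD measurableT iY iXY).
congr (_ + _)%E; under eq_integral do rewrite EFinD.
rewrite integralD//; under [X in (_ + X)%E]eq_integral do rewrite EFinM.
by rewrite integralZl// i0 mule0 adde0.
Qed.

Lemma sqn_sum (I : eqType) (r : seq I) (X : I -> T -> 'cV[R]_k) :
  uniq r -> (forall i, L2 (X i)) -> (forall i j, i != j -> orth (X i) (X j)) ->
  sqn (fun t => \sum_(i <- r) X i t) = (\sum_(i <- r) sqn (X i))%E.
Proof.
move=> + LX oX; elim: r => [_|i r IH /andP[ir ur]].
  rewrite big_nil; rewrite /sqn; under eq_integral do rewrite big_nil enorm0 expr0n.
  by rewrite integral0.
rewrite big_cons -IH// -sqnD//; last 2 first.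
- exact: L2_sum.
- have : (forall l, l \in r -> orth (X i) (X l)).
    by move=> l lr; apply: oX; apply: contraNneq ir => ->.
  elim: r {IH ir ur} => [_|l r IH h].
    by under eq_fun do rewrite big_nil; exact: orth0r.
  under eq_fun do rewrite big_cons; apply: orthDr.
    by apply: h; rewrite mem_head.
  by apply: IH => m mr; apply: h; rewrite inE mr orbT.
by congr sqn; apply/funext => t; rewrite big_cons.
Qed.

End square_integrable.

(** * Adaptedness of the algorithm to its filtration *)

Section fedmm_measurability.
Context {R : realType} {n p d q : nat} (M : mm_data R n p d q).
Context {dO : measure_display} {Omega : measurableType dO}
  {dE : measure_display} {E : measurableType dE}
  (I : fedmm_input R n q Omega E).
Context (Cstar Cstar2 vmin vmax : R).
Hypotheses (hmm : mm_framework M)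
  (hin : fedmm_admissible M I)
  (hmetric : metric_assumption M (fi_B I) Cstar Cstar2 vmin vmax)
  (hclosed : closed (mm_S M)).
Local Notation S := (mm_S M).
Local Notation V t i := (fun w => st_Vi (fedmm M I t w) i).
Local Notation filt := (filt M I).
Local Notation Shat := (Shat M I).
Local Notation Qtilde := (Qtilde M I).

Lemma Shat_S t w : S (Shat t w).
Proof.
case: t => [|t]; first exact: (fa_S0 hin).
apply: (bproj_S hmetric hclosed).
elim: t => [|t IH]; first exact: (fa_S0 hin).
exact: (bproj_S hmetric hclosed).
Qed.

(** For an inactive worker [Qtilde] vanishes, which merges the two branches of the update. *)
Lemma V_succ t i w :
  st_Vi (fedmm M I t.+1 w) i = st_Vi (fedmm M I t w) i + fi_alpha I *: Qtilde t.+1 i w.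
Proof.
rewrite /Defs.Qtilde /Delta [LHS]/=; case: ifP => _.
  by rewrite scalerA mul1r mulrC.
by rewrite mul0r scale0r scaler0 addr0.
Qed.

Lemma stV_sum t w :
  st_V (fedmm M I t w) = \sum_i mm_mu M i *: st_Vi (fedmm M I t w) i.
Proof.
elim: t => [//|t IH].
under eq_bigr do rewrite V_succ scalerDr scalerA.
rewrite big_split/= -IH; congr (_ + _).
rewrite big_mkcond scaler_sumr; apply: eq_bigr => i _.
rewrite /Defs.Qtilde /Delta; case: ifP => _; rewrite !scalerA ?mul1r.
  by congr (_ *: _); ring.
by rewrite mul0r mulr0 scale0r scaler0.
Qed.

(** The server direction of round t.+1, with the sum over active workers rewritten over all workers
    and the server memory as the average of the local ones. *)
Definition Hrv t w : 'cV[R]_q :=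
  \sum_i mm_mu M i *: (st_Vi (fedmm M I t w) i + Qtilde t.+1 i w).

Lemma Shat_succ t w :
  Shat t.+1 w = bproj S (Shat t w + fi_gamma I t.+1 *: Hrv t w) (fi_B I (Shat t w)).
Proof.
have <- : st_V (fedmm M I t w) + (fi_p I)^-1 *: \sum_(i in fi_active I t.+1 w)
    mm_mu M i *: Quant I t.+1 i w (fedmm_delta I t.+1 w (fedmm M I t w) i) =
    Hrv t w; last by [].
rewrite /Hrv; under [RHS]eq_bigr do rewrite scalerDr.
rewrite big_split/= -stV_sum; congr (_ + _).
rewrite big_mkcond scaler_sumr; apply: eq_bigr => i _.
rewrite /Defs.Qtilde /Delta; case: ifP => _; rewrite !scalerA ?mul1r.
  by rewrite mulrC.
by rewrite mul0r mulr0 scale0r scaler0.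
Qed.

Lemma S_measurable : measurable S.
Proof.
rewrite -(setCK S); apply: measurableC; apply: open_mx_measurable.
exact: closed_openC.
Qed.

Lemma comp_S_measurable {d1 d2} {T1 : measurableType d1} {T2 : measurableType d2}
    (f : 'cV[R]_q -> T2) (X : T1 -> 'cV[R]_q) :
  measurable_fun S f -> measurable_fun setT X -> (forall t, S (X t)) ->
  measurable_fun setT (fun t => f (X t)).
Proof.
move=> mf mX SX; apply: (measurable_comp S_measurable _ mf mX).
by move=> _ [t _ <-].
Qed.

Lemma bproj_comp_measurable {d1} {T1 : measurableType d1}
    (X Y : T1 -> 'cV[R]_q) :
  measurable_fun setT X -> measurable_fun setT Y -> (forall t, S (X t)) ->
  measurable_fun setT (fun t => bproj S (Y t) (fi_B I (X t))).
Proof.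
move=> mX mY SX; apply: (bproj_measurable hclosed (mf_S_convex hmm) _ (ma_v hmetric)) => //.
- by exists (X point).
- exact: comp_S_measurable (ma_meas hmetric) mX SX.
- by move=> t; exact: (B_sym hmetric).
- by move=> t v; exact: (ma_bounds hmetric).
Qed.

Lemma quant_comp_measurable {d1} {T1 : measurableType d1} t i
    (X : T1 -> E) (Y : T1 -> 'cV[R]_q) :
  measurable_fun setT X -> measurable_fun setT Y ->
  measurable_fun setT (fun w => fi_quant I t.+1 i (X w) (Y w)).
Proof.
move=> mX mY.
exact: (measurableT_comp (fa_quant_meas hin t i) (measurable_fun_pair mX mY)).
Qed.

Lemma active_measurable t i :
  measurable_fun setT (fun w => i \in fi_active I t.+1 w).
Proof.
apply: (measurable_fun_bool true); rewrite setTI; exact: (fa_active_meas hin).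
Qed.

Lemma filt_salgebra t : sigma_algebra setT (filt t).
Proof. by case: t => [|t]; exact: smallest_sigma_algebra. Qed.

Lemma filt_succ t A : filt t A -> filt t.+1 A.
Proof. by move=> FA; apply: sub_sigma_algebra; left. Qed.

Lemma sigma_rv_measurable {d2} {T2 : measurableType d2} (X : Omega -> T2) :
  measurable_fun setT X -> sigma_rv X `<=` measurable.
Proof. by move=> mX _ [A mA <-]; exact: mX. Qed.

Lemma filt_gmeas {d2} {T2 : measurableType d2} t (X : Omega -> T2) :
  gmeas (filt t) X -> gmeas (filt t.+1) X.
Proof.
by apply: gmeas_sub => A FA; apply: sub_sigma_algebra; exact: filt_succ.
Qed.

Lemma Qtilde_gmeas t i : gmeas (filt t.+1) (Qtilde t.+1 i).
Proof.
apply/gmeasP => A QA; apply: sub_sigma_algebra; apply: sub_sigma_algebra.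
by right; exists i => //; right.
Qed.

Lemma fedmm_gmeas t :
  gmeas (filt t) (Shat t) /\ forall i, gmeas (filt t) (V t i).
Proof.
elim: t => [|t [IHS IHV]].
  split=> [|i]; apply/gmeasP => A XA; apply: sub_sigma_algebra; apply: sub_sigma_algebra.
    by left.
  by right; exists i.
have mV i := filt_gmeas (IHV i); have mS := filt_gmeas IHS.
have mQ i := @Qtilde_gmeas t i.
split=> [|i]; last first.
  rewrite /gmeas; under eq_fun do rewrite V_succ.
  exact: (measurable_addv (mV i) (measurable_scalev_cst (fi_alpha I) (mQ i))).
rewrite (_ : Shat t.+1 = fun w => bproj S (Shat t w + fi_gamma I t.+1 *: Hrv t w)
  (fi_B I (Shat t w))); last by apply/funext => w; rewrite Shat_succ.
have mH : gmeas (filt t.+1) (Hrv t).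
  apply: measurable_sumv => i; apply: measurable_scalev_cst.
  exact: (measurable_addv (mV i) (mQ i)).
apply: (bproj_comp_measurable mS); last by move=> w; exact: Shat_S.
exact: (measurable_addv mS (measurable_scalev_cst _ mH)).
Qed.

Lemma Shat_gmeas t : gmeas (filt t) (Shat t).
Proof. by have [] := fedmm_gmeas t. Qed.

Lemma V_gmeas t i : gmeas (filt t) (V t i).
Proof. by have [] := fedmm_gmeas t. Qed.

(** The generators of the filtration include [Qtilde t.+1 i], which is built from the state at t;
    adaptedness of that state and the induction hypothesis make it measurable. *)
Lemma filt_measurable t : filt t `<=` measurable.
Proof.
elim: t => [|t IH].
  apply: smallest_sub; first exact: sigma_algebra_measurable.
  by move=> A [|[i _]]; apply: sigma_rv_measurable; exact: measurable_funP.
apply: smallest_sub; first exact: sigma_algebra_measurable.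
move=> A [/IH//|[i _ []]]; apply: sigma_rv_measurable; first exact: measurable_funP.
have [mS mV] : measurable_fun setT (Shat t) /\ measurable_fun setT (V t i).
  by split; [exact: (gmeas_measurable IH (@Shat_gmeas t))|exact: (gmeas_measurable IH (@V_gmeas t i))].
apply: measurable_scalev.
  apply: measurable_funM => //.
  apply: (measurableT_comp (f := fun b : bool => b%:R : R)) => //.
  exact: active_measurable.
apply: quant_comp_measurable; first exact: measurable_funP.
apply: measurable_subv => //; apply: measurable_subv => //.
Qed.

Lemma Shat_measurable t : measurable_fun setT (Shat t).
Proof. exact: (gmeas_measurable (@filt_measurable t) (@Shat_gmeas t)). Qed.

Lemma V_measurable t i : measurable_fun setT (V t i).
Proof. exact: (gmeas_measurable (@filt_measurable t) (@V_gmeas t i)). Qed.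

Lemma Qtilde_measurable t i : measurable_fun setT (Qtilde t.+1 i).
Proof. exact: (gmeas_measurable (@filt_measurable t.+1) (@Qtilde_gmeas t i)). Qed.

End fedmm_measurability.

(** * Compression and participation noise of one round *)

Section round_moments.
Context {R : realType} {n p d q : nat} (M : mm_data R n p d q).
Context {dO : measure_display} {Omega : measurableType dO}
  (P : probability Omega R)
  {dE : measure_display} {E : measurableType dE}
  (I : fedmm_input R n q Omega E).
Context (sig : 'I_n -> R) (nu : 'cV[R]_q -> probability 'cV[R]_q R)
  (omega Cstar Cstar2 vmin vmax : R).
Hypotheses (hmm : mm_framework M)
  (hin : fedmm_admissible M I)
  (horacle : oracle_assumption M I P sig)
  (hcomp : compression_assumption I P nu omega)
  (hpart : participation_assumption I P)
  (hindep : sources_independent M I P)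
  (hmetric : metric_assumption M (fi_B I) Cstar Cstar2 vmin vmax)
  (hclosed : closed (mm_S M)).
Variable t : nat.
Local Notation filt := (filt M I).
Local Notation Shat := (Shat M I).
Local Notation V i := (fun w => st_Vi (fedmm M I t w) i).
Local Notation D i := (Delta M I t.+1 i).
Local Notation src := (round_sources M I t).
Local Notation oth := (other_sources src).
Local Notation act i := (fun w => i \in fi_active I t.+1 w).

Local Notation filt_meas := (filt_measurable hmm hin hmetric hclosed).

Lemma src_measurable k : src k `<=` measurable.
Proof.
case: k => [[i|i]|] /=.
- by apply: sigma_rv_measurable; exact: measurable_funP.
- by apply: sigma_rv_measurable; exact: (active_measurable hin).
apply: smallest_sub; first exact: sigma_algebra_measurable.
move=> A [/filt_meas//|[i _]].
by apply: sigma_rv_measurable; exact: measurable_funP.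
Qed.

Lemma sigma_rvT {d2} {T2 : measurableType d2} (X : Omega -> T2) : sigma_rv X setT.
Proof. by exists setT => //; rewrite preimage_setT setTI. Qed.

Lemma sigma_rvI {d2} {T2 : measurableType d2} (X : Omega -> T2) :
  setI_closed (sigma_rv X).
Proof.
move=> _ _ [A mA <-] [B mB <-]; exists (A `&` B); first exact: measurableI.
by rewrite !setTI preimage_setI.
Qed.

Lemma src_T k : src k setT.
Proof.
case: k => [[i|i]|] /=; try exact: sigma_rvT.
exact: (@measurableT _ (g_sigma_algebraType _)).
Qed.

Lemma src_I k : setI_closed (src k).
Proof.
case: k => [[i|i]|] /=; try exact: sigma_rvI.
exact: (@measurableI _ (g_sigma_algebraType _)).
Qed.

Lemma oth_measurable k : oth k `<=` measurable.
Proof. by move=> A [j _ /src_measurable]. Qed.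

Lemma src_oth j k : j != k -> src j `<=` oth k.
Proof. by move=> jk A sA; exists j. Qed.

Lemma src_gmeas {d2} {T2 : measurableType d2} (X : Omega -> T2) j k : j != k ->
  sigma_rv X `<=` src j -> gmeas (oth k) X.
Proof.
move=> jk Xj; apply/gmeasP => A /Xj sA.
by apply: sub_sigma_algebra; exact: (src_oth jk).
Qed.

Lemma filt_oth {d2} {T2 : measurableType d2} (X : Omega -> T2) x :
  gmeas (filt t) X -> gmeas (oth (Some x)) X.
Proof.
move=> mX; apply: (@src_gmeas _ _ _ None) => // A XA.
apply: sub_sigma_algebra; left; move/gmeasP: mX => /(_ _ XA).
by rewrite salgebra_id//; exact: filt_salgebra.
Qed.

Lemma oracle_oth i x : gmeas (oth (Some x)) (fi_oracle I t.+1 i).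
Proof.
apply: (@src_gmeas _ _ _ None) => // A XA.
by apply: sub_sigma_algebra; right; exists i.
Qed.

Lemma seed_oth i k : Some (inl i) != k -> gmeas (oth k) (fi_seed I t.+1 i).
Proof. by move=> ik; apply: (src_gmeas ik). Qed.

Lemma act_oth i k : Some (inr i) != k -> gmeas (oth k) (act i).
Proof. by move=> ik; apply: (src_gmeas ik). Qed.

(** The source [None] contains the past and all oracles, hence everything in [Delta]; it is distinct
    from every seed and every selection. *)
Lemma D_oth i x : gmeas (oth (Some x)) (D i).
Proof.
have mS : gmeas (oth (Some x)) (Shat t).
  by apply: filt_oth; exact: (Shat_gmeas hmm hin hmetric hclosed).
have mV : gmeas (oth (Some x)) (V i).
  by apply: filt_oth; exact: (V_gmeas hmm hin hmetric hclosed).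
have h := measurable_subv (measurable_subv (@oracle_oth i x) mS) mV.
 
rewrite /gmeas /Delta /fedmm_delta; exact: h.
Qed.

Lemma D_measurable i : measurable_fun setT (D i).
Proof. exact: (gmeas_measurable (@oth_measurable _) (@D_oth i (inl i))). Qed.

Lemma oth_indep_seed i A B : <<s oth (Some (inl i)) >> A -> measurable B ->
  P (A `&` fi_seed I t.+1 i @^-1` B) = (P A * P (fi_seed I t.+1 i @^-1` B))%E.
Proof.
move=> oA mB.
have sB : src (Some (inl i)) (fi_seed I t.+1 i @^-1` B) by exists B => //; rewrite setTI.
exact: (other_sources_indep src_measurable src_T src_I (@hindep t) oA sB).
Qed.

Lemma oth_indep_act i A B : <<s oth (Some (inr i)) >> A -> measurable B ->
  P (A `&` act i @^-1` B) = (P A * P (act i @^-1` B))%E.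
Proof.
move=> oA mB.
have sB : src (Some (inr i)) (act i @^-1` B) by exists B => //; rewrite setTI.
exact: (other_sources_indep src_measurable src_T src_I (@hindep t) oA sB).
Qed.

Lemma quant_measurable i s : measurable_fun setT (fun w => Quant I t.+1 i w s).
Proof.
by apply: (quant_comp_measurable hin t i) => //; exact: measurable_funP.
Qed.

Lemma quant_var i s :
  (sqn P (fun w => Quant I t.+1 i w s - s)%R <= (omega * enorm s ^+ 2)%:E)%E.
Proof.
apply: le_trans (ca_var hcomp s).
have mq := quant_measurable i s.
have mF : measurable_fun setT (fun x : 'cV[R]_q => (enorm (x - s) ^+ 2)%:E).
  by apply/measurable_EFinP; apply: measurable_enorm2; exact: measurable_subv.
rewrite (eq_measure_integral (distribution P (mk_mfun mq))); last first.
  by move=> A mA _; symmetry; exact: (ca_law hcomp s t i mA).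
rewrite ge0_integral_distribution//.
by move=> y; rewrite lee_fin sqr_ge0.
Qed.

Lemma quant_L2 i s : L2 P (fun w => Quant I t.+1 i w s - s).
Proof.
split; first by apply: measurable_subv => //; exact: quant_measurable.
exact: le_lt_trans (quant_var i s) (ltry _).
Qed.

Lemma L2_cst (s : 'cV[R]_q) : L2 P (fun=> s).
Proof.
split; first exact: measurable_cst.
by rewrite /sqn integral_cst// [X in (_ * X)%E]probability_setT mule1 ltry.
Qed.

Lemma L2_coord_integrable (X : Omega -> 'cV[R]_q) j : L2 P X ->
  P.-integrable setT (EFin \o (fun w => X w j 0)).
Proof.
move=> LX; have := @coord_mul_integrable _ _ _ _ _ _ (fun=> const_mx 1) j LX (L2_cst _).
by under eq_fun do rewrite mxE mulr1.
Qed.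

Lemma quant_mean i s j : mean0 P (fun w => (Quant I t.+1 i w s - s) j 0).
Proof.
have mq := quant_measurable i s.
have iQ := L2_coord_integrable j (quant_L2 i s); split => //.
have is_ : P.-integrable setT (EFin \o (fun w => Quant I t.+1 i w s j 0)).
  have := integrableD measurableT iQ (L2_coord_integrable j (L2_cst s)).
  apply: eq_integrable => // w _.
  by rewrite /= -EFinD; congr EFin; rewrite !mxE subrK.
have := congr1 (fun v : 'cV[R]_q => v j 0) (ca_mean hcomp s).
rewrite /vmean mxE /Rintegral.
rewrite (eq_measure_integral (distribution P (mk_mfun mq))); last first.
  by move=> A mA _; symmetry; exact: (ca_law hcomp s t i mA).
have mz : measurable_fun setT (fun z : 'cV[R]_q => (z j 0)%:E).
  by apply/measurable_EFinP; exact: coord_measurable.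
rewrite (@integral_distribution _ _ _ _ _ P (mk_mfun mq))//= => e.
under eq_integral do rewrite mxE EFinD.
rewrite integralD//; last exact: (L2_coord_integrable j (L2_cst (- s))).
rewrite -(fineK (integrable_fin_num measurableT is_)) e.
under eq_integral do rewrite mxE.
by rewrite integral_cst// [X in (_ * X)%E]probability_setT mule1 -EFinD subrr.
Qed.

Lemma quant_orth_cst i s z : orth P (fun w => Quant I t.+1 i w s - s) (fun=> z).
Proof.
apply: orth_coord; [exact: quant_L2|exact: L2_cst|move=> j].
have [_] := mean0Z (z j 0) (quant_mean i s j).
by under eq_integral do rewrite mulrC.
Qed.

(** Together, [Qtilde] - Delta = [e1] + [e2]. The weight U / p is attached to the compression error,
    so that [e1] is centered by the seed of worker i alone and [e2] by its selection alone. *)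
Definition e1 i w : 'cV[R]_q :=
  ((act i w)%:R / fi_p I) *: (Quant I t.+1 i w (D i w) - D i w).

Definition e2 i w : 'cV[R]_q := ((act i w)%:R / fi_p I - 1) *: D i w.

Let act_div_meas i k : Some (inr i) != k ->
  gmeas (oth k) (fun w => (act i w)%:R / fi_p I).
Proof.
move=> ik; apply: measurable_funM => //.
apply: (measurableT_comp (f := fun b : bool => b%:R : R)) => //.
exact: act_oth.
Qed.

Lemma e1_oth i x : x != inl i -> x != inr i -> gmeas (oth (Some x)) (e1 i).
Proof.
move=> x1 x2; apply: measurable_scalev.
  by apply: act_div_meas; rewrite eq_sym.
apply: measurable_subv; last exact: D_oth.
apply: (quant_comp_measurable hin t i); last exact: D_oth.
by apply: seed_oth; rewrite eq_sym.
Qed.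

Lemma e2_oth i x : x != inr i -> gmeas (oth (Some x)) (e2 i).
Proof.
move=> x2; apply: measurable_scalev; last exact: D_oth.
by apply: measurable_funB => //; apply: act_div_meas; rewrite eq_sym.
Qed.

Lemma e1_measurable i : measurable_fun setT (e1 i).
Proof.
apply: measurable_scalev.
  exact: (gmeas_measurable (@oth_measurable _) (@act_div_meas i (Some (inl i)) isT)).
apply: measurable_subv; last exact: D_measurable.
by apply: (quant_comp_measurable hin t i); [exact: measurable_funP|exact: D_measurable].
Qed.

Lemma e2_measurable i : measurable_fun setT (e2 i).
Proof.
apply: (gmeas_measurable (@oth_measurable (Some (inl i)))).
exact: e2_oth.
Qed.

(** With everything but the seed of worker i frozen, Delta, Z and the selection are constants, and
    the compression error of a fixed vector has mean zero. *)
Lemma e1_orth i Z : L2 P (e1 i) -> L2 P Z -> gmeas (oth (Some (inl i))) Z ->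
  orth P (e1 i) Z.
Proof.
move=> L1 LZ mZ; have ii := edot_integrable L1 LZ; split => //.
pose TH := g_sigma_algebraType (oth (Some (inl i))).
pose F (z : TH * E) : R := ((act i z.1)%:R / fi_p I) *
  edot (fi_quant I t.+1 i z.2 (D i z.1) - D i z.1) (Z z.1).
have e w : edot (e1 i w) (Z w) = F (w, fi_seed I t.+1 i w) by rewrite edotZl.
have mF : measurable_fun setT F.
  have mD : measurable_fun setT (fun z : TH * E => D i z.1).
    exact: (measurableT_comp (@D_oth i (inl i)) measurable_fst).
  apply: measurable_funM.
    by apply: (measurableT_comp (@act_div_meas i (Some (inl i)) isT)); exact: measurable_fst.
  apply: measurable_edot; last by apply: (measurableT_comp mZ); exact: measurable_fst.
  apply: measurable_subv => //; apply: (quant_comp_measurable hin t i) => //.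
under eq_integral do rewrite e.
apply: (integral_freeze0 (@oth_measurable _) _ (@oth_indep_seed i) mF).
- exact: measurable_funP.
- by move: ii; apply: eq_integrable => // w _; rewrite /= e.
move=> w; exact: (mean0Z ((act i w)%:R / fi_p I) (quant_orth_cst i (D i w) (Z w))).
Qed.

Lemma integral_act i (phi : bool -> R) :
  P.-integrable setT (EFin \o (fun w => phi (act i w))) /\
  (\int[P]_w (phi (act i w))%:E =
   (fi_p I * phi true + (1 - fi_p I) * phi false)%:E)%E.
Proof.
pose A := [set w | act i w].
have mA : measurable A by exact: (fa_active_meas hin).
have PA : P A = (fi_p I)%:E by exact: hpart.
have iI (B : set Omega) : measurable B ->
    P.-integrable setT (EFin \o (\1_B : Omega -> R)).
  move=> mB; apply: (@bounded_integrable _ _ _ P 1) => [|w].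
    exact: measurable_indic.
  by rewrite indicE ger0_norm// lern1 leq_b1.
have mAC := measurableC mA.
have e w : phi (act i w) = phi true * \1_A w + phi false * \1_(~` A) w.
  rewrite !indicE in_setC; have -> : (w \in A) = act i w.
    by apply/idP/idP; rewrite inE.
  by case: (act i w); rewrite ?mulr1 ?mulr0 ?addr0 ?add0r.
have i1 := integrableZl measurableT (phi true) (iI _ mA).
have i2 := integrableZl measurableT (phi false) (iI _ mAC).
split.
  by have := integrableD measurableT i1 i2; apply: eq_integrable => // w _; rewrite /= e.
under eq_integral do rewrite e EFinD.
rewrite integralD//.
under eq_integral do rewrite EFinM.
under [X in (_ + X)%E]eq_integral do rewrite EFinM.
rewrite !integralZl//; [|exact: iI|exact: iI].
have hA : (\int[P]_w (\1_A w)%:E = (fi_p I)%:E)%E.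
  by rewrite integral_indic// setIT; exact: PA.
have hAC : (\int[P]_w (\1_(~` A) w)%:E = (1 - fi_p I)%:E)%E.
  rewrite integral_indic// setIT; transitivity (1 - P A)%E; last by rewrite PA.
  exact: probability_setC.
rewrite hA hAC.
by rewrite -!EFinM -EFinD; congr EFin; ring.
Qed.

Lemma ge0_integral_actM i (phi : bool -> R) (f : Omega -> R) :
  gmeas (oth (Some (inr i))) f -> (forall b, 0 <= phi b) -> (forall w, 0 <= f w) ->
  (\int[P]_w (phi (act i w) * f w)%:E =
   (fi_p I * phi true + (1 - fi_p I) * phi false)%:E * \int[P]_w (f w)%:E)%E.
Proof.
move=> mf phi0 f0.
pose TH := g_sigma_algebraType (oth (Some (inr i))).
pose F (z : TH * bool) : \bar R := (phi z.2 * f z.1)%:E.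
have mF : measurable_fun setT F.
  apply/measurable_EFinP; apply: measurable_funM.
    exact: (measurableT_comp (f := phi)).
  by apply: (measurableT_comp mf); exact: measurable_fst.
have F0 z : (0 <= F z)%E by rewrite lee_fin mulr_ge0.
have := ge0_integral_freeze (@oth_measurable _) (@active_measurable _ _ _ _ _ _ _ _ _ _ _ hin t i) (@oth_indep_act i) mF F0.
rewrite /F /= => ->.
have mf' := gmeas_measurable (@oth_measurable _) mf.
have [iphi ephi] := integral_act i phi.
have mphi := integrable_meas iphi.
transitivity (\int[P]_w ((\int[P]_u (phi (act i u))%:E) * (f w)%:E))%E.
  apply: eq_integral => w _; under eq_integral do rewrite EFinM.
  rewrite ge0_integralZr//.
  - exact/measurable_EFinP.
  - by move=> u _; rewrite lee_fin.
  - by rewrite lee_fin.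
rewrite ephi ge0_integralZl//.
- exact/measurable_EFinP.
- by move=> w _; rewrite lee_fin.
- rewrite -ephi; apply: integral_ge0 => w _; by rewrite lee_fin.
Qed.

Lemma p_gt0 : 0 < fi_p I. Proof. by have /andP[] := fa_p hin. Qed.
Lemma p_le1 : fi_p I <= 1. Proof. by have /andP[] := fa_p hin. Qed.

(** Freezing all but the seed leaves (U / p)^2 times at most omega |Delta|^2; the selection is
    independent of Delta, and (U / p)^2 has mean 1 / p. *)
Lemma e1_sqn i : (sqn P (e1 i) <= (omega / fi_p I)%:E * sqn P (D i))%E.
Proof.
pose TH := g_sigma_algebraType (oth (Some (inl i))).
pose c w : R := ((act i w)%:R / fi_p I) ^+ 2.
pose F (z : TH * E) : \bar R :=
  (c z.1 * enorm (fi_quant I t.+1 i z.2 (D i z.1) - D i z.1) ^+ 2)%:E.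
have c0 w : 0 <= c w by exact: sqr_ge0.
have mD : measurable_fun setT (fun z : TH * E => D i z.1).
  exact: (measurableT_comp (@D_oth i (inl i)) measurable_fst).
have mc : gmeas (oth (Some (inl i))) c.
  by apply: measurable_funX; exact: act_div_meas.
have mF : measurable_fun setT F.
  apply/measurable_EFinP; apply: measurable_funM.
    by apply: (measurableT_comp mc); exact: measurable_fst.
  apply: measurable_enorm2; apply: measurable_subv => //.
  by apply: (quant_comp_measurable hin t i).
have F0 z : (0 <= F z)%E by rewrite lee_fin mulr_ge0// sqr_ge0.
have omega0 := ca_omega hcomp.
have mD2 := measurable_enorm2 (D_measurable i).
have -> : sqn P (e1 i) = (\int[P]_w F (w, fi_seed I t.+1 i w))%E.
  by apply: eq_integral => w _; rewrite /F /= /e1 enormZ.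
rewrite (ge0_integral_freeze (@oth_measurable _) _ (@oth_indep_seed i) mF F0); last exact: measurable_funP.
have mc' := gmeas_measurable (@oth_measurable _) mc.
apply: (@le_trans _ _ (\int[P]_w ((omega * c w) * enorm (D i w) ^+ 2)%:E)%E).
  apply: ge0_le_integral => //.
  - by move=> w _; apply: integral_ge0.
  (* The inner integral is a Tonelli section for the law of the seed, hence measurable. *)
  - have mI : gmeas (oth (Some (inl i))) (fubini_F (distribution P (fi_seed I t.+1 i)) F).
      exact: (measurable_fun_fubini_tonelli_F F mF F0).
    rewrite (_ : (fun w => _) = fubini_F (distribution P (fi_seed I t.+1 i)) F).
      exact: (gmeas_measurable (@oth_measurable _) mI).
    apply/funext => w; rewrite /fubini_F ge0_integral_distribution//.
    by apply: (measurableT_comp mF); exact: measurable_fun_pair.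
  - by apply/measurable_EFinP; apply: measurable_funM => //; exact: measurable_funM.
  - move=> w _; rewrite /F /=; under eq_integral do rewrite EFinM.
    rewrite ge0_integralZl//; last 3 first.
    + apply/measurable_EFinP; apply: measurable_enorm2; apply: measurable_subv => //.
      exact: quant_measurable.
    + by move=> u _; rewrite lee_fin sqr_ge0.
    + by rewrite lee_fin.
    rewrite (_ : omega * c w * _ = c w * (omega * enorm (D i w) ^+ 2)); last by ring.
    rewrite [leRHS]EFinM; have cw0 : (0 <= (c w)%:E)%E by rewrite lee_fin.
    exact: (lee_wpmul2l cw0 (quant_var i (D i w))).
have := @ge0_integral_actM i (fun b => omega * (b%:R / fi_p I) ^+ 2) (fun w => enorm (D i w) ^+ 2).
move=> ->.
- rewrite (_ : fi_p I * _ + _ = omega / fi_p I)//.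
  rewrite /= mul0r expr0n/= !mulr0 addr0 mulr1n; field.
  by rewrite gt_eqF//; exact: p_gt0.
- apply: measurable_enorm2; exact: D_oth.
- by move=> b; rewrite mulr_ge0// sqr_ge0.
- by move=> w; exact: sqr_ge0.
Qed.

(** The factor is the variance of U / p, and U is independent of Delta. *)
Lemma e2_sqn i : (sqn P (e2 i) = ((1 - fi_p I) / fi_p I)%:E * sqn P (D i))%E.
Proof.
have := @ge0_integral_actM i (fun b => (b%:R / fi_p I - 1) ^+ 2) (fun w => enorm (D i w) ^+ 2).
rewrite (_ : fi_p I * _ + _ = (1 - fi_p I) / fi_p I); last first.
  by rewrite /= mul0r mulr1n; field; rewrite gt_eqF//; exact: p_gt0.
move=> <-.
- by apply: eq_integral => w _; rewrite /e2 enormZ.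
- apply: measurable_enorm2; exact: D_oth.
- by move=> b; exact: sqr_ge0.
- by move=> w; exact: sqr_ge0.
Qed.

Lemma e2_orth i Z : L2 P (e2 i) -> L2 P Z -> gmeas (oth (Some (inr i))) Z ->
  orth P (e2 i) Z.
Proof.
move=> L1 LZ mZ; have ii := edot_integrable L1 LZ; split => //.
pose TH := g_sigma_algebraType (oth (Some (inr i))).
pose F (z : TH * bool) : R := (z.2%:R / fi_p I - 1) * edot (D i z.1) (Z z.1).
have e w : edot (e2 i w) (Z w) = F (w, act i w) by rewrite edotZl.
have mF : measurable_fun setT F.
  apply: measurable_funM; first exact: (measurableT_comp (f := fun b : bool => b%:R / fi_p I - 1)).
  apply: measurable_edot; last by apply: (measurableT_comp mZ); exact: measurable_fst.
  exact: (measurableT_comp (@D_oth i (inr i)) measurable_fst).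
under eq_integral do rewrite e.
apply: (integral_freeze0 (@oth_measurable _) _ (@oth_indep_act i) mF).
- exact: (active_measurable hin).
- by move: ii; apply: eq_integrable => // w _; rewrite /= e.
move=> w; have [iphi ephi] := integral_act i (fun b => b%:R / fi_p I - 1).
have m0 : mean0 P (fun w => (act i w)%:R / fi_p I - 1).
  split => //; rewrite ephi; congr EFin; rewrite mul0r mulr1n; field.
  by rewrite gt_eqF//; exact: p_gt0.
have := mean0Z (edot (D i w) (Z w)) m0.
by under eq_fun do rewrite mulrC.
Qed.

End round_moments.

(** * Total noise of one round and contraction of the control variates *)

Section round_noise.
Context {R : realType} {n p d q : nat} (M : mm_data R n p d q).
Context {dO : measure_display} {Omega : measurableType dO}
  (P : probability Omega R)
  {dE : measure_display} {E : measurableType dE}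
  (I : fedmm_input R n q Omega E).
Context (sig : 'I_n -> R) (nu : 'cV[R]_q -> probability 'cV[R]_q R)
  (omega Cstar Cstar2 vmin vmax : R).
Hypotheses (hmm : mm_framework M)
  (hin : fedmm_admissible M I)
  (horacle : oracle_assumption M I P sig)
  (hcomp : compression_assumption I P nu omega)
  (hpart : participation_assumption I P)
  (hindep : sources_independent M I P)
  (hmetric : metric_assumption M (fi_B I) Cstar Cstar2 vmin vmax)
  (hclosed : closed (mm_S M)).
Variable t : nat.
Local Notation filt := (filt M I).
Local Notation Shat := (Shat M I).
Local Notation D i := (Delta M I t.+1 i).
Local Notation src := (round_sources M I t).
Local Notation oth := (other_sources src).
Local Notation filt_meas := (filt_measurable hmm hin hmetric hclosed).
Local Notation e1 := (e1 M I t).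
Local Notation e2 := (e2 M I t).
Local Notation omegap := (omega_part omega (fi_p I)).

Definition hS i w := mm_hi M i (Shat t w).

Definition xi i w := fi_oracle I t.+1 i w - oracle_mean M I i t w.

(** By [etaE], the error with which V_i + [Qtilde] estimates h_i at the current iterate, split by
    what centers each part: oracle, seed, selection. *)
Definition eta i w := xi i w + e1 i w + e2 i w.

(** Read off the oracle assumption, where this mean is a version of a conditional expectation;
    measurability of the integral in the iterate need not be established. *)
Lemma oracle_mean_gmeas i : gmeas (filt t) (oracle_mean M I i t).
Proof.
apply: measurable_fun_mx => j k; rewrite ord1.
exact: (cond_exp_gmeas (filt_salgebra M I t) (oa_mean horacle t i j)).
Qed.

Lemma hS_gmeas i : gmeas (filt t) (hS i).
Proof.
have h := measurable_subv (oracle_mean_gmeas i) (Shat_gmeas hmm hin hmetric hclosed (t:=t)).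
exact: h.
Qed.

Lemma hS_measurable i : measurable_fun setT (hS i).
Proof. exact: (gmeas_measurable (@filt_meas t) (hS_gmeas i)). Qed.

Lemma xi_measurable i : measurable_fun setT (xi i).
Proof.
apply: measurable_subv; first exact: measurable_funP.
exact: (gmeas_measurable (@filt_meas t) (oracle_mean_gmeas i)).
Qed.

Lemma xi_L2 i : L2 P (xi i).
Proof.
have [Y [cY _]] := oa_var horacle t i.
by apply/(L2P _ (xi_measurable i)); have [] := cY.
Qed.

Lemma xi_sqn i : (sqn P (xi i) <= (sig i ^+ 2)%:E)%E.
Proof.
have [Y [cY Yle]] := oa_var horacle t i.
have iY := cond_exp_integrable (filt_salgebra M I t) (@filt_meas t) cY.
rewrite /sqn /xi; have [_ _ /(_ setT) ->] := cY; last first.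
  by rewrite -(salgebra_id (filt_salgebra M I t)); exact: (@measurableT _ (g_sigma_algebraType _)).
have mY := integrable_meas iY.
(* The bound on Y is only almost sure, and comparison up to null sets is made between nonnegative
   functions; hence the positive part. *)
have iYp : P.-integrable setT (EFin \o Y^\+).
  apply: (integrable_le _ iY); first exact: measurable_funrpos.
  move=> w; rewrite ger0_norm// /funrpos ge_max normr_ge0 andbT.
  exact: ler_norm.
apply: (@le_trans _ _ (\int[P]_w (Y^\+ w)%:E)%E).
  by apply: le_integral => // w _; rewrite lee_fin /funrpos le_max lexx.
apply: (@le_trans _ _ (\int[P]_w (cst (sig i ^+ 2)%:E w))%E); last first.
  by rewrite integral_cst// [X in (_ * X)%E]probability_setT mule1.
apply: ae_ge0_le_integral => //.
- by move=> w _; rewrite lee_fin.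
- by apply/measurable_EFinP; exact: measurable_funrpos.
- by move=> w _; rewrite lee_fin sqr_ge0.
by apply: filterS Yle => w Yw _; rewrite lee_fin /funrpos ge_max Yw sqr_ge0.
Qed.

Lemma xi_centered i j : centered_on P (filt t) (fun w => xi i w j 0).
Proof.
have := cond_exp_centered (filt_salgebra M I t) (@filt_meas t) (oa_mean horacle t i j).
by rewrite (_ : (fun w => _ - _) = fun w => xi i w j 0)//; apply/funext => w; rewrite !mxE.
Qed.

Lemma xi_orth i Z : L2 P Z -> gmeas (filt t) Z -> orth P (xi i) Z.
Proof.
move=> LZ mZ; have Lx := xi_L2 i; apply: orth_coord => // j.
apply: (centered_onM (@filt_meas t) (xi_centered i j)).
  exact: measurable_fun_coord.
exact: coord_mul_integrable.
Qed.

Lemma xi_xi_orth i j : i != j -> orth P (xi i) (xi j).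
Proof.
move=> ij; have Li := xi_L2 i; have Lj := xi_L2 j; apply: orth_coord => // k.
have mx l : gmeas (filt t `|` sigma_rv (fi_oracle I t.+1 l)) (fun w => xi l w k 0).
  apply: measurable_fun_coord; apply: measurable_subv.
    by apply/gmeasP => A XA; apply: sub_sigma_algebra; right.
  apply: gmeas_sub (oracle_mean_gmeas l) => A FA.
  by apply: sub_sigma_algebra; left.
apply: (cond_indep_uncorr (filt_salgebra M I t) (@filt_meas t) _ (oa_indep horacle t) ij
  (xi_centered i k) (mx i) (mx j)); last exact: coord_mul_integrable.
by move=> l; exact: measurable_funP.
Qed.

Lemma xi_oth i x : gmeas (oth (Some x)) (xi i).
Proof.
apply: measurable_subv; first exact: oracle_oth.
exact: (filt_oth (oracle_mean_gmeas i)).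
Qed.

Lemma etaE i w : eta i w = st_Vi (fedmm M I t w) i + Qtilde M I t.+1 i w - hS i w.
Proof.
rewrite /eta /xi /Qtilde /e1 /e2 /hS /mm_hi -/(oracle_mean M I i t w).
rewrite /Delta /fedmm_delta -/(Shat t w) /=.
by apply/matrixP => a b; rewrite !mxE; ring.
Qed.

Lemma omegap_ge0 : 0 <= omegap.
Proof.
have p0 := p_gt0 hin; have p1 := p_le1 hin; have o0 := ca_omega hcomp.
by rewrite addr_ge0// mulr_ge0 ?addr_ge0// divr_ge0 ?subr_ge0// ltW.
Qed.

(** The two summands are the factors of |Delta|^2 in the second moments of [e1] and [e2]. *)
Lemma omegapE : omegap = omega / fi_p I + (1 - fi_p I) / fi_p I.
Proof. by rewrite /omega_part; field; rewrite gt_eqF//; exact: (p_gt0 hin). Qed.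

Section eta.
Variable i : 'I_n.
(** Finiteness is asked of the product: it is automatic when [omegap] is zero, whatever the second
    moment of [D i], and otherwise follows from square integrability of [Vdev]. *)
Hypothesis hD : (omegap%:E * sqn P (D i) < +oo)%E.

Lemma e12_sqn : (sqn P (e1 i) + sqn P (e2 i) <= omegap%:E * sqn P (D i))%E.
Proof.
have p0 := p_gt0 hin; have p1 := p_le1 hin; have o0 := ca_omega hcomp.
rewrite omegapE EFinD ge0_muleDl ?lee_fin; last 2 first.
- by rewrite divr_ge0// ltW.
- by rewrite divr_ge0 ?subr_ge0// ltW.
apply: leeD; first exact: (e1_sqn hmm hin hcomp hpart hindep hmetric hclosed).
by rewrite (e2_sqn hmm hin hpart hindep hmetric hclosed).
Qed.

Lemma e1_L2 : L2 P (e1 i).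
Proof.
split; first exact: (e1_measurable hmm hin hmetric hclosed).
apply: le_lt_trans hD; apply: le_trans e12_sqn.
by rewrite leeDl// sqn_ge0.
Qed.

Lemma e2_L2 : L2 P (e2 i).
Proof.
split; first exact: (e2_measurable hmm hin hmetric hclosed).
apply: le_lt_trans hD; apply: le_trans e12_sqn.
by rewrite leeDr// sqn_ge0.
Qed.

Lemma eta_L2 : L2 P (eta i).
Proof. by apply: L2D; [apply: L2D; [exact: xi_L2|exact: e1_L2]|exact: e2_L2]. Qed.

Lemma eta_sqn : (sqn P (eta i) <= (sig i ^+ 2)%:E + omegap%:E * sqn P (D i))%E.
Proof.
have Lx := xi_L2 i; have L1 := e1_L2; have L2' := e2_L2.
have o1 : orth P (e1 i) (xi i).
  exact: (e1_orth hmm hin hcomp hindep hmetric hclosed L1 Lx (@xi_oth i (inl i))).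
have o2 : orth P (e2 i) (xi i).
  exact: (e2_orth hmm hin hpart hindep hmetric hclosed L2' Lx (@xi_oth i (inr i))).
have o12 : orth P (e1 i) (e2 i).
  apply: (e1_orth hmm hin hcomp hindep hmetric hclosed L1 L2').
  exact: (e2_oth hmm hin hmetric hclosed).
have s1 : sqn P (eta i) = (sqn P (fun w => xi i w + e1 i w)%R + sqn P (e2 i))%E :=
  sqnD (L2D Lx L1) L2' (orthDl (orthC o2) o12).
by rewrite s1 (sqnD Lx L1 (orthC o1)) -addeA; apply: leeD; [exact: xi_sqn|exact: e12_sqn].
Qed.

Lemma eta_orth_filt Z : L2 P Z -> gmeas (filt t) Z -> orth P (eta i) Z.
Proof.
move=> LZ mZ; apply: orthDl; first (apply: orthDl; first exact: xi_orth).
- apply: (e1_orth hmm hin hcomp hindep hmetric hclosed e1_L2 LZ).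
  exact: filt_oth.
- apply: (e2_orth hmm hin hpart hindep hmetric hclosed e2_L2 LZ).
  exact: filt_oth.
Qed.

End eta.

(** Of the nine pairs, eight contain an [e1] or [e2] whose own source does not enter the other
    factor; the pair of oracle noises relies on conditional independence. *)
Lemma eta_eta_orth i j : i != j -> (omegap%:E * sqn P (D i) < +oo)%E ->
  (omegap%:E * sqn P (D j) < +oo)%E -> orth P (eta i) (eta j).
Proof.
move=> ij hi hj.
have E1 a : (omegap%:E * sqn P (D a) < +oo)%E -> forall Z, L2 P Z ->
    gmeas (oth (Some (inl a))) Z -> orth P (e1 a) Z.
  by move=> ha Z; exact: (e1_orth hmm hin hcomp hindep hmetric hclosed (e1_L2 ha)).
have E2 a : (omegap%:E * sqn P (D a) < +oo)%E -> forall Z, L2 P Z ->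
    gmeas (oth (Some (inr a))) Z -> orth P (e2 a) Z.
  by move=> ha Z; exact: (e2_orth hmm hin hpart hindep hmetric hclosed (e2_L2 ha)).
have O1 a b : a != b -> (omegap%:E * sqn P (D a) < +oo)%E ->
    (omegap%:E * sqn P (D b) < +oo)%E -> orth P (e1 a) (e1 b).
  move=> ab ha hb; apply: E1 => //; first exact: e1_L2.
  exact: (e1_oth hmm hin hmetric hclosed).
have O2 a b : a != b -> (omegap%:E * sqn P (D a) < +oo)%E ->
    (omegap%:E * sqn P (D b) < +oo)%E -> orth P (e2 a) (e2 b).
  move=> ab ha hb; apply: E2 => //; first exact: e2_L2.
  exact: (e2_oth hmm hin hmetric hclosed).
have O12 a b : (omegap%:E * sqn P (D a) < +oo)%E ->
    (omegap%:E * sqn P (D b) < +oo)%E -> orth P (e1 a) (e2 b).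
  move=> ha hb; apply: E1 => //; first exact: e2_L2.
  exact: (e2_oth hmm hin hmetric hclosed).
have Ox1 a b : (omegap%:E * sqn P (D a) < +oo)%E -> orth P (e1 a) (xi b).
  by move=> ha; apply: E1 => //; [exact: xi_L2|exact: xi_oth].
have Ox2 a b : (omegap%:E * sqn P (D a) < +oo)%E -> orth P (e2 a) (xi b).
  by move=> ha; apply: E2 => //; [exact: xi_L2|exact: xi_oth].
apply: orthDr; first apply: orthDr.
- apply: orthDl; first apply: orthDl.
  + exact: xi_xi_orth.
  + exact: Ox1.
  + exact: Ox2.
- apply: orthDl; first apply: orthDl.
  + exact/orthC/Ox1.
  + exact: O1.
  + exact/orthC/O12.
- apply: orthDl; first apply: orthDl.
  + exact/orthC/Ox2.
  + exact: O12.
  + exact: O2.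
Qed.

Definition Vdev i w := st_Vi (fedmm M I t w) i - hS i w.

Lemma Vdev_gmeas i : gmeas (filt t) (Vdev i).
Proof.
have h := measurable_subv (V_gmeas hmm hin hmetric hclosed (t:=t) i) (hS_gmeas i).
exact: h.
Qed.

Lemma Vdev_measurable i : measurable_fun setT (Vdev i).
Proof. exact: (gmeas_measurable (@filt_meas t) (Vdev_gmeas i)). Qed.

(** Delta is the oracle noise minus [Vdev], and [Vdev] is known at time t, so the two are
    orthogonal. *)
Lemma D_sqn i : L2 P (Vdev i) ->
  (sqn P (D i) <= (sig i ^+ 2)%:E + sqn P (Vdev i))%E.
Proof.
move=> LV.
have -> : sqn P (D i) = sqn P (fun w => xi i w + - 1 *: Vdev i w).
  congr sqn; apply/funext => w; rewrite scaleN1r /xi /Vdev /hS /mm_hi.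
  rewrite -/(oracle_mean M I i t w) /Delta /fedmm_delta -/(Shat t w) /=.
  by apply/matrixP => a b; rewrite !mxE; ring.
rewrite sqnD; [|exact: xi_L2|exact: L2Z|]; last first.
  by apply: orthZr; apply: xi_orth => //; exact: Vdev_gmeas.
rewrite sqnZ; last exact: Vdev_measurable.
by rewrite sqrrN expr1n mul1e leeD2r// xi_sqn.
Qed.

Lemma H_sqn : (forall i, omegap%:E * sqn P (D i) < +oo)%E ->
  (sqn P (fun w => Hrv M I t w - \sum_i mm_mu M i *: hS i w)%R <=
   \sum_i (mm_mu M i ^+ 2)%:E * ((sig i ^+ 2)%:E + omegap%:E * sqn P (D i)))%E.
Proof.
move=> hD.
have -> : sqn P (fun w => Hrv M I t w - \sum_i mm_mu M i *: hS i w) =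
    sqn P (fun w => \sum_i mm_mu M i *: eta i w).
  congr sqn; apply/funext => w; rewrite /Hrv -sumrB; apply: eq_bigr => i _.
  by rewrite etaE -scalerBr.
rewrite sqn_sum; first last.
- move=> i j ij; apply: orthZl; apply: orthZr; exact: eta_eta_orth.
- by move=> i; apply: L2Z; exact: eta_L2.
- exact: index_enum_uniq.
apply: lee_sum => i _; rewrite sqnZ; last by have [] := eta_L2 (hD i).
apply: lee_wpmul2l; first by rewrite lee_fin sqr_ge0.
exact: eta_sqn.
Qed.

(** The deviation, still measured from h_i at the old iterate, is (1 - alpha) [Vdev] + alpha [eta],
    an orthogonal sum. *)
Lemma Vnext_sqn i : L2 P (Vdev i) ->
  (sqn P (fun w => st_Vi (fedmm M I t.+1 w) i - hS i w)%R <=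
   ((1 - fi_alpha I) ^+ 2)%:E * sqn P (Vdev i)
   + (fi_alpha I ^+ 2)%:E * ((sig i ^+ 2)%:E + omegap%:E * sqn P (D i)))%E.
Proof.
move=> LV.
have hD : (omegap%:E * sqn P (D i) < +oo)%E.
  apply: lte_mul_pinfty => //; first by rewrite lee_fin omegap_ge0.
  apply: le_lt_trans (D_sqn LV) _; apply: lte_add_pinfty; first exact: ltry.
  by have [] := LV.
have -> : sqn P (fun w => st_Vi (fedmm M I t.+1 w) i - hS i w) =
    sqn P (fun w => (1 - fi_alpha I) *: Vdev i w + fi_alpha I *: eta i w).
  congr sqn; apply/funext => w; rewrite V_succ etaE /Vdev.
  by apply/matrixP => a b; rewrite !mxE; ring.
have Le := eta_L2 hD.
rewrite sqnD; [|exact: L2Z|exact: L2Z|]; last first.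
  apply: orthZl; apply: orthZr; apply: orthC; apply: eta_orth_filt => //.
  exact: Vdev_gmeas.
rewrite (sqnZ P (1 - fi_alpha I) (@Vdev_measurable i)) (sqnZ P (fi_alpha I) Le.1).
apply: leeD => //; apply: lee_wpmul2l; first by rewrite lee_fin sqr_ge0.
exact: eta_sqn.
Qed.

End round_noise.

(** * Integration against the mixture of the local laws *)

Section mixture.
Context {d : measure_display} {T : measurableType d} {R : realType} {n : nat}.
Variables (mu : 'I_n -> R) (pi : 'I_n -> probability T R) (mix : probability T R).
Hypotheses (mu0 : forall i, 0 < mu i)
  (mixE : forall A, measurable A -> mix A = (\sum_i (mu i)%:E * pi i A)%E).

(** [msum] takes a sequence of measures indexed by naturals; entries from [n] on are set to zero. *)
Let component (k : nat) : {measure set T -> \bar R} :=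
  if insub k is Some i then mscale (NngNum (ltW (mu0 i))) (pi i) else mzero.

Lemma ge0_integral_mixture (f : T -> \bar R) : measurable_fun setT f ->
  (forall z, 0 <= f z)%E ->
  (\int[mix]_z f z = \sum_i (mu i)%:E * \int[pi i]_z f z)%E.
Proof.
move=> mf f0.
have cE (i : 'I_n) : component i = mscale (NngNum (ltW (mu0 i))) (pi i).
  by rewrite /component valK.
rewrite (eq_measure_integral (msum component n)); last first.
  move=> A mA _; transitivity (\sum_i (mu i)%:E * pi i A)%E; first exact: mixE.
  by rewrite /= /msum; apply: eq_bigr => i _; rewrite cE.
rewrite ge0_integral_measure_sum//; apply: eq_bigr => i _.
by rewrite cE ge0_integral_mscale.
Qed.

Lemma mixture_integrable (f : T -> R) : mix.-integrable setT (EFin \o f) ->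
  forall i, (pi i).-integrable setT (EFin \o f).
Proof.
move=> /integrableP[mf fi] i; apply/integrableP; split => //.
move: fi; rewrite ge0_integral_mixture//; last exact: measurableT_comp.
set F := fun i => (\int[pi i]_z `|(EFin \o f) z|)%E.
have F0 j : (0 <= F j)%E by exact: integral_ge0.
rewrite (bigD1 i)//= -/(F i) => h.
have {h} : ((mu i)%:E * F i < +oo)%E.
  apply: le_lt_trans h; rewrite leeDl// sume_ge0// => j _.
  by apply: mule_ge0; [rewrite lee_fin ltW|exact: F0].
rewrite -/(F i); case: (F i) (F0 i) => [r _ _|_|//]; first exact: ltry.
by rewrite gt0_muley ?lte_fin.
Qed.

Lemma Rintegral_mixture (f : T -> R) : mix.-integrable setT (EFin \o f) ->
  \int[mix]_z f z = \sum_i mu i * \int[pi i]_z f z.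
Proof.
move=> ifm; have mf := integrable_meas ifm.
have ifi := mixture_integrable ifm.
have mp : measurable_fun setT (EFin \o f^\+) by apply/measurable_EFinP; exact: measurable_funrpos.
have mn : measurable_fun setT (EFin \o f^\-) by apply/measurable_EFinP; exact: measurable_funrneg.
have fE t : f t = f^\+ t - f^\- t by rewrite -[in LHS](funrposBneg f).
have fN t : `|f t| = f^\+ t + f^\- t.
  by rewrite -[LHS]/((Num.norm \o f) t) -funrposDneg.
have ip (P : probability T R) : P.-integrable setT (EFin \o f) ->
    P.-integrable setT (EFin \o f^\+) /\ P.-integrable setT (EFin \o f^\-).
  move=> iP; split; apply: (integrable_le _ iP).
  - exact: measurable_funrpos.
  - by move=> t; rewrite fN ger0_norm// lerDl.
  - exact: measurable_funrneg.
  - by move=> t; rewrite fN ger0_norm// lerDr.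
have RB (P : probability T R) : P.-integrable setT (EFin \o f) ->
    \int[P]_z f z = \int[P]_z f^\+ z - \int[P]_z f^\- z.
  move=> iP; have [i1 i2] := ip _ iP.
  rewrite -RintegralB//; apply: eq_Rintegral => z _; exact: fE.
have ge (g : T -> R) : measurable_fun setT (EFin \o g) -> (forall z, 0 <= g z) ->
    (forall i, (pi i).-integrable setT (EFin \o g)) ->
    \int[mix]_z g z = \sum_i mu i * \int[pi i]_z g z.
  move=> mg g0 ig; rewrite /Rintegral ge0_integral_mixture//.
  transitivity (fine (\sum_i (mu i * fine (\int[pi i]_z (g z)%:E))%:E)%E).
    congr fine; apply: eq_bigr => i _.
    by rewrite EFinM fineK//; exact: (integrable_fin_num measurableT (ig i)).
  by rewrite sumEFin.
rewrite RB// !ge//; first last.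
- by move=> i; have [] := ip _ (ifi i).
- by move=> i; have [] := ip _ (ifi i).
rewrite -sumrB; apply: eq_bigr => i _.
by rewrite -mulrBr RB.
Qed.

End mixture.

(** * Measurability of the objective and the decomposition of [mm_h] *)

Section mm_measurability.
Context {R : realType} {n p d q : nat} (M : mm_data R n p d q).
Hypotheses (hprob : federated_problem M) (hmm : mm_framework M)
  (hclosed : closed (mm_S M)).

(** The sets where g exceeds a real are open by lower semicontinuity, and they generate. *)
Lemma g_measurable : measurable_fun setT (mm_g M).
Proof.
apply: (measurability _ (ErealGenOInfty.measurableE R)) => _ [_ [a ->] <-].
rewrite setTI; apply: open_mx_measurable; rewrite preimage_itvoy.
by move/lower_semicontinuousP : (fp_g_lsc hprob); exact.
Qed.

Lemma Theta_measurable : measurable (mm_Theta M).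
Proof.
have := measurable_fun_lte g_measurable (measurable_cst +oo%E).
by move=> /(_ measurableT [set true]); rewrite setTI; apply.
Qed.

(** Measurability of [ell] being given over Theta only, it is extended by zero before Tonelli is
    applied to its positive and negative parts; on Theta the extension changes nothing. *)
Lemma fi_measurable i : measurable_fun (mm_Theta M) (mm_fi M i).
Proof.
pose l (x : 'cV[R]_p * 'cV[R]_d) : \bar R :=
  ((fun x => mm_ell M x.1 x.2) \_ (setT `*` mm_Theta M) x)%:E.
have mD : measurable ([set: 'cV[R]_p] `*` mm_Theta M).
  by apply: measurableX => //; exact: Theta_measurable.
have ml : measurable_fun setT l.
  apply/measurable_EFinP.
  apply/(measurable_restrictT _ mD); exact: (fp_ell_meas hprob).
have h : measurable_fun setT (fun th => fine (\int[mm_pi M i]_z l (z, th)))%E.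
  apply: (measurableT_comp (f := fine)) => //.
  rewrite (_ : (fun th => _) = (fun th =>
      \int[mm_pi M i]_z (l^\+ (z, th)) - \int[mm_pi M i]_z (l^\- (z, th)))%E).
    apply: emeasurable_funB.
    - apply: (measurable_fun_fubini_tonelli_G (l^\+)%E) => //.
      exact: measurable_funepos.
    - apply: (measurable_fun_fubini_tonelli_G (l^\-)%E) => //.
      exact: measurable_funeneg.
  apply/funext => th; rewrite [LHS]integralE.
  by congr (_ - _)%E; apply: eq_integral => z _; [rewrite !funeposE|rewrite !funenegE].
have h' := @measurable_funTS _ _ _ _ (mm_Theta M) _ h.
apply: (eq_measurable_fun _ _ h') => th thT.
rewrite /mm_fi /Rintegral; congr fine; apply: eq_integral => z _.
by rewrite /l patchE mem_set//; split => //; rewrite inE in thT.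
Qed.

Lemma mm_W_measurable : measurable_fun (mm_S M) (mm_W M).
Proof.
have mS : measurable (mm_S M).
  rewrite -(setCK (mm_S M)); apply: measurableC; apply: open_mx_measurable.
  exact: closed_openC.
have mf : measurable_fun (mm_Theta M) (fun th => mm_f M th + fine (mm_g M th)).
  apply: measurable_funD.
    apply: measurable_sum => i; apply: measurable_funM => //; exact: fi_measurable.
  apply: (measurableT_comp (f := fine)) => //.
  by apply: measurable_funTS; exact: g_measurable.
apply: (measurable_comp Theta_measurable _ mf (mf_T_meas hmm)).
by move=> _ [s Ss <-]; exact: (T_Theta hprob hmm).
Qed.

Lemma Sbar_coord_integrable th j : mm_Theta M th ->
  (mm_mix M).-integrable setT (EFin \o (fun z => mm_Sbar M z th j 0)).
Proof.
move=> thT.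
have mSb : measurable_fun setT (fun z => mm_Sbar M z th).
  have mD : measurable ([set: 'cV[R]_p] `*` mm_Theta M).
    by apply: measurableX => //; exact: Theta_measurable.
  apply: (measurable_comp (f := fun x => mm_Sbar M x.1 x.2) (g := fun z => (z, th)) mD _ (mf_Sbar_meas hmm)).
    by move=> _ [z _ <-]; split.
  exact: measurable_fun_pair.
apply: (integrable_le _ (mf_Sbar_int hmm thT)).
  exact: measurable_fun_coord.
move=> z; rewrite [leRHS]ger0_norm ?enorm_ge0//.
rewrite -(ler_pXn2r (_ : 0 < 2)%N)// ?nnegrE ?enorm_ge0//.
by rewrite real_normK ?num_real// coord_sq_le.
Qed.

Lemma mm_hE s : mm_S M s -> mm_h M s = \sum_i mm_mu M i *: mm_hi M i s.
Proof.
move=> Ss; rewrite /mm_h /mm_hi; apply/matrixP => j j'; rewrite ord1.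
rewrite !mxE summxE.
rewrite (Rintegral_mixture (fp_mu_gt0 hprob) (fp_mix hprob)); last first.
  by apply: Sbar_coord_integrable; exact: (T_Theta hprob hmm).
transitivity (\sum_i mm_mu M i * (\int[mm_pi M i]_z mm_Sbar M z (mm_T M s) j 0 - s j 0)); last first.
  by apply: eq_bigr => i _; rewrite !mxE.
under [RHS]eq_bigr do rewrite mulrBr.
by rewrite sumrB -mulr_suml (fp_mu_sum hprob) mul1r.
Qed.

End mm_measurability.

(** * The descent inequality in expectation *)

Section lyapunov.
Context {R : realType} {n p d q : nat} (M : mm_data R n p d q).
Context {dO : measure_display} {Omega : measurableType dO}
  (P : probability Omega R)
  {dE : measure_display} {E : measurableType dE}
  (I : fedmm_input R n q Omega E).
Context (fgmin : R) (sig L : 'I_n -> R) (nu : 'cV[R]_q -> probability 'cV[R]_q R)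
  (omega Cstar Cstar2 vmin vmax : R).
Hypotheses (hprob : federated_problem M)
  (hmin : is_min_value (mm_obj M) fgmin)
  (hmm : mm_framework M)
  (hin : fedmm_admissible M I)
  (horacle : oracle_assumption M I P sig)
  (hcomp : compression_assumption I P nu omega)
  (hpart : participation_assumption I P)
  (hindep : sources_independent M I P)
  (hfield : field_assumption M L)
  (hmetric : metric_assumption M (fi_B I) Cstar Cstar2 vmin vmax)
  (hclosed : closed (mm_S M)).
Local Notation Shat := (Shat M I).
Local Notation C := (Cbar M Cstar Cstar2).
Local Notation gam := (fi_gamma I).
Local Notation Ebar := (Ebar M I).

Definition gap t w : R := mm_W M (Shat t w) - fgmin.

Definition dS t w := Shat t.+1 w - Shat t w.

Definition Hdev t w := Hrv M I t w - \sum_i mm_mu M i *: hS M I t i w.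

(** The gap is nonnegative, so this is meaningful without integrability. *)
Definition Egap t : \bar R := (\int[P]_w (gap t w)%:E)%E.

Lemma Sh t w : mm_S M (Shat t w).
Proof. exact: (Shat_S hin hmetric hclosed). Qed.

Lemma gap_ge0 t w : 0 <= gap t w.
Proof.
have [_ /(_ (mm_T M (Shat t w)))] := hmin.
by rewrite (mm_obj_T hprob hmm (Sh t w)) lee_fin subr_ge0.
Qed.

Lemma gap_measurable t : measurable_fun setT (gap t).
Proof.
apply: measurable_funB => //.
apply: (comp_S_measurable hclosed (mm_W_measurable hprob hmm hclosed)).
  exact: (Shat_measurable hmm hin hmetric hclosed).
by move=> w; exact: Sh.
Qed.

Lemma Egap0E :
  (\int[P]_w (mm_obj M (mm_T M (Shat 0 w)) - fgmin%:E))%E = Egap 0.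
Proof.
by apply: eq_integral => w _; rewrite (mm_obj_T hprob hmm (Sh 0 w)).
Qed.

Lemma h_hS t w : mm_h M (Shat t w) = \sum_i mm_mu M i *: hS M I t i w.
Proof. exact: (mm_hE hprob hmm (Sh t w)). Qed.

Lemma gam_gt0 t : 0 < gam t.+1.
Proof. by have /andP[] := fa_gamma hin t. Qed.

Lemma EbarE t w : Ebar t.+1 w =
  qform (fi_B I (Shat t w))
    (bproj (mm_S M) (Shat t w + gam t.+1 *: mm_h M (Shat t w)) (fi_B I (Shat t w)) - Shat t w)
  / gam t.+1 ^+ 2.
Proof. by rewrite /Defs.Ebar /= bnorm2//; exact: (B_ge0 hmetric _ (Sh t w)). Qed.

Lemma Ebar_ge0 t w : 0 <= Ebar t.+1 w.
Proof.
by rewrite EbarE divr_ge0 ?sqr_ge0//; exact: (B_ge0 hmetric _ (Sh t w)).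
Qed.

Lemma Shat_meas t : measurable_fun setT (Shat t).
Proof. exact: (Shat_measurable hmm hin hmetric hclosed). Qed.

Lemma hS_sum_measurable t :
  measurable_fun setT (fun w => \sum_i mm_mu M i *: hS M I t i w).
Proof.
apply: measurable_sumv => i; apply: measurable_scalev_cst.
exact: (hS_measurable hmm hin horacle hmetric hclosed).
Qed.

Lemma Ebar_measurable t : measurable_fun setT (Ebar t.+1).
Proof.
(* The field is replaced by its decomposition into the [hS], whose measurability comes from the
   oracle assumption. *)
rewrite (_ : Ebar t.+1 = fun w => qform (fi_B I (Shat t w))
    (bproj (mm_S M) (Shat t w + gam t.+1 *: \sum_i mm_mu M i *: hS M I t i w) (fi_B I (Shat t w)) - Shat t w)
  / gam t.+1 ^+ 2); last by apply/funext => w; rewrite EbarE h_hS.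
have mS := Shat_meas t.
apply: measurable_funM => //.
have mB : measurable_fun setT (fun w => fi_B I (Shat t w)).
  apply: (comp_S_measurable hclosed (ma_meas hmetric) mS).
  by move=> w; exact: Sh.
have mb : measurable_fun setT (fun w =>
    bproj (mm_S M) (Shat t w + gam t.+1 *: \sum_i mm_mu M i *: hS M I t i w) (fi_B I (Shat t w)) - Shat t w).
  apply: measurable_subv => //; apply: (bproj_comp_measurable hmm hmetric hclosed mS).
    apply: measurable_addv => //; apply: measurable_scalev_cst.
    exact: hS_sum_measurable.
  by move=> w; exact: Sh.
under eq_fun do rewrite qformE /bdot.
apply: measurable_edot => //; apply: measurable_fun_mx => a b.
under eq_fun do rewrite mxE.
by apply: measurable_sum => l; apply: measurable_funM; exact: measurable_fun_coord.
Qed.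

Lemma dS_measurable t : measurable_fun setT (dS t).
Proof. by apply: measurable_subv; exact: Shat_meas. Qed.

Lemma Hdev_measurable t : measurable_fun setT (Hdev t).
Proof.
apply: measurable_subv; last exact: hS_sum_measurable.
apply: measurable_sumv => i; apply: measurable_scalev_cst.
apply: measurable_addv; first exact: (V_measurable hmm hin hmetric hclosed).
exact: (Qtilde_measurable hmm hin hmetric hclosed).
Qed.

(** What the curvature term leaves of the squared displacement in [fedmm_descent]; in expectation
    this surplus pays for the drift of the h_i between rounds. *)
Definition step_coef t : R := (gam t.+1)^-1 * (2^-1 - gam t.+1 * C / vmin).

Lemma descent_pointwise t w : 0 <= step_coef t ->
  gap t.+1 w + gam t.+1 / 2 * Ebar t.+1 w
    + step_coef t * vmin * enorm (dS t w) ^+ 2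
  <= gap t w + gam t.+1 / 2 * vmax * enorm (Hdev t w) ^+ 2.
Proof.
move=> c0.
have := fedmm_descent hprob hmm hfield hmetric hclosed (Hrv M I t w) (Sh t w) (gam_gt0 t).
cbv zeta; rewrite -(Shat_succ M I t w) -EbarE h_hS -/(dS t w) -/(Hdev t w) -/(step_coef t) => h.
have hB := B_ge hmetric (dS t w) (Sh t w).
have hH := B_le hmetric (Hdev t w) (Sh t w).
have := ler_wpM2l c0 hB.
have g2 : 0 <= gam t.+1 / 2 by rewrite divr_ge0// ltW// gam_gt0.
have := ler_wpM2l g2 hH.
by move: h; rewrite /gap; lra.
Qed.

(** Both sides are arranged as sums of nonnegative terms, so the pointwise inequality integrates in
    the extended reals without any subtraction. *)
Lemma descent_expectation t : 0 <= step_coef t ->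
  (Egap t.+1 + (gam t.+1 / 2)%:E * 'E_P[Ebar t.+1]
    + (step_coef t * vmin)%:E * sqn P (dS t)
  <= Egap t + (gam t.+1 / 2 * vmax)%:E * sqn P (Hdev t))%E.
Proof.
move=> c0.
have g2 : 0 <= gam t.+1 / 2 by rewrite divr_ge0// ltW// gam_gt0.
have v0 : 0 <= vmin := ltW (vmin_gt0 hmetric).
have vx0 : 0 <= vmax by have /andP[_] := ma_v hmetric; exact: le_trans.
have mg u : measurable_fun setT (EFin \o gap u) by apply/measurable_EFinP; exact: gap_measurable.
have mE : measurable_fun setT (EFin \o Ebar t.+1) by apply/measurable_EFinP; exact: Ebar_measurable.
have md : measurable_fun setT (EFin \o (fun w => enorm (dS t w) ^+ 2)).
  by apply/measurable_EFinP; apply: measurable_enorm2; exact: dS_measurable.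
have mh : measurable_fun setT (EFin \o (fun w => enorm (Hdev t w) ^+ 2)).
  by apply/measurable_EFinP; apply: measurable_enorm2; exact: Hdev_measurable.
have sc (c : R) (f : Omega -> R) : 0 <= c -> measurable_fun setT (EFin \o f) ->
    (forall w, 0 <= f w) ->
    (c%:E * \int[P]_w (f w)%:E = \int[P]_w (c * f w)%:E)%E.
  by move=> c1 mf f0; rewrite -ge0_integralZl// => w _; rewrite lee_fin.
have add (f g : Omega -> R) : measurable_fun setT (EFin \o f) ->
    measurable_fun setT (EFin \o g) -> (forall w, 0 <= f w) -> (forall w, 0 <= g w) ->
    (\int[P]_w (f w)%:E + \int[P]_w (g w)%:E = \int[P]_w (f w + g w)%:E)%E.
  by move=> mf mg' f0 g0; rewrite -ge0_integralD// => w _; rewrite lee_fin.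
have mZ (c : R) (f : Omega -> R) : measurable_fun setT (EFin \o f) ->
    measurable_fun setT (EFin \o (fun w => c * f w)).
  by move=> /measurable_EFinP mf; apply/measurable_EFinP; exact: measurable_funM.
have mD (f g : Omega -> R) : measurable_fun setT (EFin \o f) ->
    measurable_fun setT (EFin \o g) -> measurable_fun setT (EFin \o (fun w => f w + g w)).
  by move=> /measurable_EFinP mf /measurable_EFinP mg'; apply/measurable_EFinP; exact: measurable_funD.
have cv : 0 <= step_coef t * vmin by rewrite mulr_ge0.
have gv : 0 <= gam t.+1 / 2 * vmax by rewrite mulr_ge0.
have Z0 (c : R) (f : Omega -> R) : 0 <= c -> (forall w, 0 <= f w) -> forall w, 0 <= c * f w.
  by move=> c1 f0 w; rewrite mulr_ge0.
have sq0 (X : Omega -> 'cV[R]_q) w : 0 <= enorm (X w) ^+ 2 by exact: sqr_ge0.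
have g0 u := @gap_ge0 u; have e0 := @Ebar_ge0 t.
rewrite expectation.unlock /Egap /sqn !sc//.
have m1 := mZ (gam t.+1 / 2) _ mE.
have m2 := mZ (step_coef t * vmin) _ md.
have m3 := mZ (gam t.+1 / 2 * vmax) _ mh.
have z1 := Z0 _ _ g2 e0.
have z2 := Z0 _ _ cv (sq0 (dS t)).
have z3 := Z0 _ _ gv (sq0 (Hdev t)).
have m12 := mD _ _ (mg t.+1) m1.
have z12 w : 0 <= gap t.+1 w + gam t.+1 / 2 * Ebar t.+1 w by rewrite addr_ge0// ?z1.
rewrite (add _ _ (mg t.+1) m1 (g0 _) z1) (add _ _ m12 m2 z12 z2).
rewrite (add _ _ (mg t) m3 (g0 _) z3).
apply: ge0_le_integral => //.
- by move=> w _; rewrite lee_fin addr_ge0// ?z12// ?z2.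
- exact: (mD _ _ m12 m2).
- exact: (mD _ _ (mg t) m3).
- by move=> w _; rewrite lee_fin; exact: descent_pointwise.
Qed.

End lyapunov.

(** * One round of the Lyapunov recursion *)

Lemma enormB2_young {R : realType} {k : nat} (b : R) (x y : 'cV[R]_k) : 0 < b ->
  enorm (x - y) ^+ 2 <= (1 + b) * enorm x ^+ 2 + (1 + b^-1) * enorm y ^+ 2.
Proof.
move=> b0; have := sqr_ge0 (enorm (b *: x + y)).
rewrite !enormD2 enormZ enormN edotZl edotNr.
set X := enorm x ^+ 2; set Y := enorm y ^+ 2; set z := edot x y => h.
have : 0 <= b^-1 * (b ^+ 2 * X + 2 * (b * z) + Y).
  by rewrite mulr_ge0// invr_ge0 ltW.
have -> : b^-1 * (b ^+ 2 * X + 2 * (b * z) + Y) = b * X + 2 * z + b^-1 * Y.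
  by field; rewrite gt_eqF.
lra.
Qed.

Lemma mule_fin_num {R : realType} (c : R) (y : \bar R) : 0 < c -> (0 <= y)%E ->
  (c%:E * y < +oo)%E -> y \is a fin_num.
Proof.
by move=> c0; case: y => [r||]//=; rewrite gt0_muley ?lte_fin// ltxx.
Qed.

Section iteration.
Context {R : realType} {n p d q : nat} (M : mm_data R n p d q).
Context {dO : measure_display} {Omega : measurableType dO}
  (P : probability Omega R)
  {dE : measure_display} {E : measurableType dE}
  (I : fedmm_input R n q Omega E).
Context (fgmin : R) (sig L : 'I_n -> R) (nu : 'cV[R]_q -> probability 'cV[R]_q R)
  (omega Cstar Cstar2 vmin vmax : R).
Hypotheses (hprob : federated_problem M)
  (hmin : is_min_value (mm_obj M) fgmin)
  (hmm : mm_framework M)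
  (hin : fedmm_admissible M I)
  (horacle : oracle_assumption M I P sig)
  (hcomp : compression_assumption I P nu omega)
  (hpart : participation_assumption I P)
  (hindep : sources_independent M I P)
  (hfield : field_assumption M L)
  (hmetric : metric_assumption M (fi_B I) Cstar Cstar2 vmin vmax)
  (hclosed : closed (mm_S M)).
Local Notation gam := (fi_gamma I).
Local Notation alpha := (fi_alpha I).
Local Notation omegap := (omega_part omega (fi_p I)).
Local Notation D t i := (Delta M I t.+1 i).
Local Notation Ebar := (Ebar M I).
Local Notation Vdev t i := (Vdev M I t i).

Local Notation gap t := (Egap M P I fgmin t).
Local Notation dS t := (dS M I t).
Local Notation Hdev t := (Hdev M I t).
Local Notation step_coef t := (step_coef M I Cstar Cstar2 vmin t).
Local Notation s2 := (\sum_i mm_mu M i ^+ 2 * sig i ^+ 2).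
Local Notation l2 := (\sum_i mm_mu M i ^+ 2 * L i ^+ 2).

Lemma Egap_ge0 t : (0 <= gap t)%E.
Proof.
apply: integral_ge0 => w _; rewrite lee_fin.
exact: (gap_ge0 hprob hmin hmm hin hmetric hclosed).
Qed.

Lemma EEbar_ge0 t : (0 <= 'E_P[Ebar t.+1])%E.
Proof.
rewrite expectation.unlock; apply: integral_ge0 => w _; rewrite lee_fin.
exact: (Ebar_ge0 hin hmetric hclosed).
Qed.

Lemma Vdev_succ_sqn t i : 0 < alpha ->
  (sqn P (Vdev t.+1 i) <=
   (1 + alpha / 2)%:E * sqn P (fun w => st_Vi (fedmm M I t.+1 w) i - hS M I t i w)%R
   + ((1 + 2 / alpha) * L i ^+ 2)%:E * sqn P (dS t))%E.
Proof.
move=> a0.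
have mV : measurable_fun setT (fun w => st_Vi (fedmm M I t.+1 w) i - hS M I t i w).
  apply: measurable_subv; first exact: (V_measurable hmm hin hmetric hclosed).
  exact: (hS_measurable hmm hin horacle hmetric hclosed).
have md := dS_measurable hmm hin hmetric hclosed t.
have mW := Vdev_measurable hmm hin horacle hmetric hclosed t.+1 i.
have c1 : 0 <= 1 + alpha / 2 by rewrite addr_ge0// divr_ge0// ltW.
have c2 : 0 <= (1 + 2 / alpha) * L i ^+ 2.
  by rewrite mulr_ge0 ?sqr_ge0// addr_ge0// divr_ge0// ltW.
have [nV nd nW] := And3 (measurable_enorm2 mV) (measurable_enorm2 md) (measurable_enorm2 mW).
rewrite /sqn -!ge0_integralZl//; first last.
- by move=> w _; rewrite lee_fin sqr_ge0.
- by apply/measurable_EFinP.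
- by move=> w _; rewrite lee_fin sqr_ge0.
- by apply/measurable_EFinP.
rewrite -ge0_integralD//; first last.
- by apply/measurable_EFinP; exact: measurable_funM.
- by move=> w _; rewrite -EFinM lee_fin mulr_ge0// sqr_ge0.
- by apply/measurable_EFinP; exact: measurable_funM.
- by move=> w _; rewrite -EFinM lee_fin mulr_ge0// sqr_ge0.
apply: ge0_le_integral => //.
- by move=> w _; rewrite lee_fin sqr_ge0.
- by apply/measurable_EFinP.
- by apply/measurable_EFinP; apply: measurable_funD; exact: measurable_funM.
move=> w _; rewrite -!EFinM -EFinD lee_fin.
rewrite (_ : Vdev t.+1 i w = (st_Vi (fedmm M I t.+1 w) i - hS M I t i w) -
    (hS M I t.+1 i w - hS M I t i w)); last first.
  by rewrite (opprB (hS M I t.+1 i w)) addrA subrK.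
(* The parameter alpha / 2 is chosen because (1 + alpha / 2)(1 - alpha) stays below 1 - alpha / 2,
   so half of the contraction survives the drift. *)
apply: le_trans (enormB2_young _ _ (b := alpha / 2) _) _; first by rewrite divr_gt0.
rewrite lerD2l invf_div -mulrA ler_wpM2l ?addr_ge0 ?divr_ge0 ?(ltW a0)//.
have := fl_lip hfield i (Sh hin hmetric hclosed t w) (Sh hin hmetric hclosed t.+1 w).
rewrite -exprMn => h; rewrite lerXn2r// ?nnegrE ?enorm_ge0//.
by rewrite mulr_ge0 ?enorm_ge0// (fl_L hfield).
Qed.

(** The noise bound reduces to [s2]: the second moment of Delta appears times zero, which is 0 even
    when that moment is +oo. *)
Lemma caseA_step t : omegap = 0 -> 0 <= step_coef t ->
  (gap t.+1 + (gam t.+1 / 2)%:E * 'E_P[Ebar t.+1] <=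
   gap t + (gam t.+1 / 2 * vmax * s2)%:E)%E.
Proof.
move=> o0 c0.
have := descent_expectation hprob hmin hmm hin horacle hfield hmetric hclosed c0.
have g2 : 0 <= gam t.+1 / 2 by rewrite divr_ge0// ltW// (gam_gt0 hin).
have v0 : 0 <= vmin := ltW (vmin_gt0 hmetric).
have vx0 : 0 <= vmax by have /andP[_] := ma_v hmetric; exact: le_trans.
move=> h; apply: le_trans (le_trans h _).
  by rewrite leeDl// mule_ge0 ?sqn_ge0// lee_fin mulr_ge0.
rewrite leeD2l// [leRHS]EFinM; apply: lee_wpmul2l; first by rewrite lee_fin mulr_ge0.
have := H_sqn hmm hin horacle hcomp hpart hindep hmetric hclosed (t := t).
rewrite o0 => /(_ (fun i => _)) h'.
apply: le_trans (h' _) _; first by move=> i; rewrite mul0e ltry.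
rewrite -sumEFin; apply: lee_sum => i _.
by rewrite mul0e adde0 -EFinM.
Qed.

(** Finiteness is transported along with the inequalities: the expected descent bounds a sum of
    nonnegative terms by a real, which forces each to be finite, and [s] is the resulting second
    moment of the displacement, shared by the two inequalities. *)
Lemma caseB_step t x (v : 'I_n -> R) : 0 < omegap ->
  0 < alpha -> alpha * (1 + omegap) <= 1 -> 0 < step_coef t ->
  gap t = x%:E -> (forall i, sqn P (Vdev t i) = (v i)%:E) ->
  exists x' e s (v' : 'I_n -> R),
    [/\ gap t.+1 = x'%:E, ('E_P[Ebar t.+1] = e%:E)%E,
        forall i, sqn P (Vdev t.+1 i) = (v' i)%:E, 0 <= e /\ 0 <= s &
        x' + gam t.+1 / 2 * e + step_coef t * vmin * s <=
          x + gam t.+1 / 2 * vmax * ((1 + omegap) * s2 + omegap * \sum_i mm_mu M i ^+ 2 * v i) /\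
        \sum_i mm_mu M i ^+ 2 * v' i <=
          (1 - alpha / 2) * (\sum_i mm_mu M i ^+ 2 * v i) + 3 * alpha / 2 * s2 + 3 / alpha * l2 * s].
Proof.
move=> o0 a0 a1 c0 xE vE.
have g2 : 0 < gam t.+1 / 2 by rewrite divr_gt0// (gam_gt0 hin).
have v0 := vmin_gt0 hmetric.
have vx0 : 0 <= vmax by have /andP[_] := ma_v hmetric; apply: le_trans; exact: ltW.
have LV i : L2 P (Vdev t i).
  split; first exact: (Vdev_measurable hmm hin horacle hmetric hclosed).
  by rewrite vE ltry.
have Dle i : (sqn P (D t i) <= (sig i ^+ 2 + v i)%:E)%E.
  by rewrite EFinD -vE; exact: (D_sqn hmm hin horacle hmetric hclosed).
have oD i : (omegap%:E * sqn P (D t i) <= (omegap * (sig i ^+ 2 + v i))%:E)%E.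
  by rewrite EFinM lee_wpmul2l// lee_fin ltW.
have hD i : (omegap%:E * sqn P (D t i) < +oo)%E := le_lt_trans (oD i) (ltry _).
have hH : (sqn P (Hdev t) <= ((1 + omegap) * s2 + omegap * \sum_i mm_mu M i ^+ 2 * v i)%:E)%E.
  apply: le_trans (H_sqn hmm hin horacle hcomp hpart hindep hmetric hclosed hD) _.
  rewrite !mulr_sumr -big_split/= -sumEFin; apply: lee_sum => i _.
  rewrite [leRHS](_ : _ = (mm_mu M i ^+ 2)%:E * ((sig i ^+ 2)%:E + (omegap * (sig i ^+ 2 + v i))%:E))%E.
    by apply: lee_wpmul2l; [rewrite lee_fin sqr_ge0|rewrite leeD2l].
  by rewrite -EFinD -EFinM; congr EFin; ring.
have des := descent_expectation hprob hmin hmm hin horacle hfield hmetric hclosed (ltW c0).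
set K := (_ * s2 + _) in hH *.
have des' : (gap t.+1 + (gam t.+1 / 2)%:E * 'E_P[Ebar t.+1]
    + (step_coef t * vmin)%:E * sqn P (dS t) <= (x + gam t.+1 / 2 * vmax * K)%:E)%E.
  apply: le_trans des _; rewrite xE EFinD leeD2l// [leRHS]EFinM.
  by apply: lee_wpmul2l => //; rewrite lee_fin mulr_ge0// ltW.
have cv : 0 < step_coef t * vmin by rewrite mulr_gt0.
have [G0 E0 S0] := And3 (Egap_ge0 t.+1) (EEbar_ge0 t) (sqn_ge0 P (dS t)).
have E0' : (0 <= (gam t.+1 / 2)%:E * 'E_P[Ebar t.+1])%E by rewrite mule_ge0// lee_fin ltW.
have S0' : (0 <= (step_coef t * vmin)%:E * sqn P (dS t))%E by rewrite mule_ge0// lee_fin ltW.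
have lt := le_lt_trans des' (ltry _).
have fG : gap t.+1 \is a fin_num.
  rewrite ge0_fin_numE//; apply: le_lt_trans lt.
  by rewrite -addeA leeDl// adde_ge0.
have fE : 'E_P[Ebar t.+1]%E \is a fin_num.
  apply: (mule_fin_num g2 E0); apply: le_lt_trans lt.
  by rewrite addeC addeA leeDr// adde_ge0.
have fS : sqn P (dS t) \is a fin_num.
  apply: (mule_fin_num cv S0); apply: le_lt_trans lt.
  by rewrite leeDr// adde_ge0.
have vn i : (sqn P (fun w => st_Vi (fedmm M I t.+1 w) i - hS M I t i w)%R <=
    ((1 - alpha) * v i + alpha * sig i ^+ 2)%:E)%E.
  apply: le_trans (Vnext_sqn hmm hin horacle hcomp hpart hindep hmetric hclosed (LV i)) _.
  rewrite vE.
  apply: (@le_trans _ _ ((1 - alpha) ^+ 2 * v i + alpha ^+ 2 * (sig i ^+ 2 + omegap * (sig i ^+ 2 + v i)))%:E).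
    rewrite [leRHS]EFinD; apply: leeD; first by rewrite -EFinM.
    rewrite [leRHS]EFinM; apply: lee_wpmul2l; first by rewrite lee_fin sqr_ge0.
    by rewrite [leRHS]EFinD leeD2l.
  rewrite lee_fin.
  have vi0 : 0 <= v i by rewrite -lee_fin -vE sqn_ge0.
  have s0 : 0 <= sig i ^+ 2 by exact: sqr_ge0.
  (* The step condition on alpha absorbs the compression variance: (1 - alpha)^2 + alpha^2 omegap <=
     1 - alpha, and alpha^2 (1 + omegap) <= alpha in front of the oracle variance. *)
  have h : alpha ^+ 2 * (1 + omegap) <= alpha by rewrite expr2 -mulrA ger_pMr.
  have := ler_wpM2r vi0 h; have := ler_wpM2r s0 h; lra.
have vn' i : (sqn P (Vdev t.+1 i) <= ((1 + alpha / 2) * ((1 - alpha) * v i + alpha * sig i ^+ 2)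
    + (1 + 2 / alpha) * L i ^+ 2 * fine (sqn P (dS t)))%:E)%E.
  apply: le_trans (Vdev_succ_sqn t i a0) _.
  rewrite [leRHS]EFinD (EFinM _ (fine _)) fineK// leeD2r// [leRHS]EFinM.
  by apply: lee_wpmul2l => //; rewrite lee_fin addr_ge0// divr_ge0// ltW.
have fV i : sqn P (Vdev t.+1 i) \is a fin_num.
  by rewrite ge0_fin_numE ?sqn_ge0//; exact: le_lt_trans (vn' i) (ltry _).
exists (fine (gap t.+1)), (fine 'E_P[Ebar t.+1]%E), (fine (sqn P (dS t))),
  (fun i => fine (sqn P (Vdev t.+1 i))).
split; rewrite ?fineK//; first by move=> i; rewrite fineK.
  by split; apply: fine_ge0.
split.
  by rewrite -lee_fin !EFinD !EFinM !fineK// -!EFinM -!EFinD.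
have s0 : 0 <= fine (sqn P (dS t)) by apply: fine_ge0.
set s := fine (sqn P (dS t)) in vn' s0 *.
rewrite !mulr_sumr [X in _ <= _ + X]mulr_suml -!big_split/=; apply: ler_sum => i _.
have := vn' i; rewrite -(fineK (fV i)) lee_fin => h.
apply: le_trans (ler_wpM2l (sqr_ge0 _) h) _.
have vi0 : 0 <= v i by rewrite -lee_fin -vE sqn_ge0.
have si0 : 0 <= sig i ^+ 2 by exact: sqr_ge0.
have Li0 : 0 <= L i ^+ 2 * s by rewrite mulr_ge0// sqr_ge0.
have aa : alpha <= 1 by have := mulr_gt0 a0 o0; move: a1; lra.
have ia : 1 <= alpha^-1 by rewrite invf_ge1.
have a20 : 0 <= alpha ^+ 2 by exact: sqr_ge0.
have a2 : alpha ^+ 2 <= alpha by rewrite expr2 ger_pMr.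
(* The constants come from alpha <= 1: (1 + alpha / 2) alpha <= 3 alpha / 2 and 1 + 2 / alpha <= 3 /
   alpha. *)
rewrite [leRHS](_ : _ = mm_mu M i ^+ 2 * ((1 - alpha / 2) * v i + 3 * alpha / 2 * sig i ^+ 2 + 3 * alpha^-1 * (L i ^+ 2 * s))); last by ring.
apply: ler_wpM2l; first exact: sqr_ge0.
have h1 := mulr_ge0 a20 vi0.
have h2 := ler_wpM2r si0 a2.
have h3 := ler_wpM2r Li0 ia.
move: h1 h2 h3; rewrite mul1r; lra.
Qed.

End iteration.

(** * Real arithmetic of the telescoping *)

Lemma big_nat1_ord {V : Type} (op : V -> V -> V) (idx : V) (F : nat -> V) T :
  \big[op/idx]_(1 <= t < T.+1) F t = \big[op/idx]_(t < T) F t.+1.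
Proof. by rewrite big_add1 big_mkord. Qed.

(* The multiplier [vmax omegap / alpha] of v makes the [v t] terms cancel: the
   contraction by [1 - alpha / 2] pays for the compression variance. *)
Lemma lyapunov_telescope {R : realType} (x v e gam : nat -> R)
    (alpha omegap vmin vmax c s2 l2 : R) :
  0 < alpha -> 0 < omegap -> 0 < vmin -> 0 < vmax ->
  (forall t, 0 < gam t) -> (forall t, gam t.+1 <= gam t) ->
  (forall t, 3 * (omegap / alpha ^+ 2) * (vmax / vmin) * l2 * gam t ^+ 2
     <= 2^-1 - gam t * c / vmin) ->
  (forall t, 0 <= v t) ->
  (forall t, exists s, [/\ 0 <= s,
     x t.+1 + gam t / 2 * e t + (gam t)^-1 * (2^-1 - gam t * c / vmin) * vmin * s <=
       x t + gam t / 2 * vmax * ((1 + omegap) * s2 + omegap * v t) &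
     v t.+1 <= (1 - alpha / 2) * v t + 3 * alpha / 2 * s2 + 3 / alpha * l2 * s]) ->
  forall T, x T + vmax * omegap / alpha * gam T * v T + \sum_(t < T) gam t / 2 * e t <=
    x 0 + vmax * omegap / alpha * gam 0 * v 0
      + vmax * s2 * ((1 + omegap) / 2 + 3 * omegap / 2) * \sum_(t < T) gam t.
Proof.
move=> a0 o0 v0 vx0 g0 gn hl v_ge0 step T.
elim: T => [|T IH]; first by rewrite !big_ord0 mulr0.
rewrite !big_ord_recr/=.
have [s [s0 h1 h2]] := step T.
move: IH h1 h2 (g0 T) (gn T) (hl T) (v_ge0 T.+1).
set SE := \sum_(t < T) _; set SG := \sum_(t < T) _; set r := x 0 + _.
set G := gam T; set G' := gam T.+1; set g := v T; set g' := v T.+1.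
move=> IH h1 h2 G0 GG hlT g'0.
set k := vmax * omegap / alpha in r IH *.
have kpos : 0 < k by rewrite /k divr_gt0// mulr_gt0.
have hc : k * (alpha / 2) = vmax * omegap / 2 by rewrite /k; field; rewrite gt_eqF.
have hca : k * alpha = vmax * omegap by rewrite /k; field; rewrite gt_eqF.
(* The weighted drift of the control variates is covered by the surplus of the descent; after
   division by vmin / G this is the smallness hypothesis. *)
have hs : k * G * (3 / alpha * l2) <= G^-1 * (2^-1 - G * c / vmin) * vmin.
  have -> : k * G * (3 / alpha * l2) = G^-1 * vmin *
      (3 * (omegap / alpha ^+ 2) * (vmax / vmin) * l2 * G ^+ 2).
    by rewrite /k; field; rewrite !gt_eqF.
  rewrite [leRHS](_ : _ = G^-1 * vmin * (2^-1 - G * c / vmin)); last by ring.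
  by rewrite ler_wpM2l// mulr_ge0 ?(ltW v0)// invr_ge0 ltW.
(* Nonincreasing steps let the weight of the new deviation be raised to that of the old one. *)
have h3 : k * G' * g' <= k * G * g' by rewrite ler_wpM2r// ler_wpM2l ?(ltW kpos).
have kG : 0 <= k * G by rewrite mulr_ge0// ltW.
have h4 := ler_wpM2l kG h2.
have h5 := ler_wpM2r s0 hs.
have e1 : k * G * ((1 - alpha / 2) * g) = k * G * g - G * (k * (alpha / 2)) * g by ring.
have e2 : k * G * (3 * alpha / 2 * s2) = 3 / 2 * G * (k * alpha) * s2 by field.
have e3 : k * G * (3 / alpha * l2 * s) = k * G * (3 / alpha * l2) * s by ring.
move: h4; rewrite mulrDr mulrDr e1 e2 e3 hc hca => h4.
clearbody k SE SG r; move: (k * G * (3 / alpha * l2)) h4 h5 => z h4 h5.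
rewrite mulrDr; move: IH h1 h3 h4 h5.
move: (G^-1 * (2^-1 - G * c / vmin) * vmin) => y; lra.
Qed.

(** Passes from the constants 1 and 1/2 + 2 o delivered by the telescoping to 4 and 2 (1 + 5 o). *)
Lemma caseB_arith (R : realType) (gT gp vT v0 SE SB vx o al g' g1 ss G : R) :
  gT + vx * o / al * g' * vT + SE <=
    gp + vx * o / al * g1 * v0 + vx * ss * ((1 + o) / 2 + 3 * o / 2) * G ->
  0 <= gT -> 0 <= vx * o / al * g' * vT -> 0 <= vx * o / al * g1 * v0 ->
  SB <= SE -> 0 <= vx * ss * G -> 0 <= o ->
  SB <= gp + 4 * o * vx / al * g1 * v0 + 2 * vx * (1 + 5 * o) * ss * G.
Proof.
move=> tele gT0 vT0 v00 SBE h1 o0; have h2 := mulr_ge0 o0 h1.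
have e1 : 4 * o * vx / al * g1 * v0 = 4 * (vx * o / al * g1 * v0) by ring.
rewrite e1; move: tele vT0 v00; move: (_ * g' * vT) (_ * g1 * v0) => x y; lra.
Qed.

Lemma quarter_coef_le (R : realType) (g a b : R) : 0 <= g -> 0 <= a -> 0 <= b ->
  g / 4 * (1 - a - b) <= g / 2.
Proof. by move=> g0 a0 b0; have := mulr_ge0 g0 (addr_ge0 a0 b0); lra. Qed.

(** * Telescoped bounds for the algorithm *)

Section telescoping.
Context {R : realType} {n p d q : nat} (M : mm_data R n p d q).
Context {dO : measure_display} {Omega : measurableType dO}
  (P : probability Omega R)
  {dE : measure_display} {E : measurableType dE}
  (I : fedmm_input R n q Omega E).
Context (fgmin : R) (sig L : 'I_n -> R) (nu : 'cV[R]_q -> probability 'cV[R]_q R)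
  (omega Cstar Cstar2 vmin vmax : R).
Hypotheses (hprob : federated_problem M)
  (hmin : is_min_value (mm_obj M) fgmin)
  (hmm : mm_framework M)
  (hin : fedmm_admissible M I)
  (horacle : oracle_assumption M I P sig)
  (hcomp : compression_assumption I P nu omega)
  (hpart : participation_assumption I P)
  (hindep : sources_independent M I P)
  (hfield : field_assumption M L)
  (hmetric : metric_assumption M (fi_B I) Cstar Cstar2 vmin vmax)
  (hclosed : closed (mm_S M)).
Local Notation C := (Cbar M Cstar Cstar2).
Local Notation gam := (fi_gamma I).
Local Notation alpha := (fi_alpha I).
Local Notation omegap := (omega_part omega (fi_p I)).
Local Notation Ebar := (Ebar M I).
Local Notation Vdev t i := (Vdev M I t i).

Local Notation gap t := (Egap M P I fgmin t).
Local Notation step_coef t := (step_coef M I Cstar Cstar2 vmin t).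
Local Notation s2 := (\sum_i mm_mu M i ^+ 2 * sig i ^+ 2).
Local Notation l2 := (\sum_i mm_mu M i ^+ 2 * L i ^+ 2).
Local Notation Vn T := (\sum_i mm_mu M i ^+ 2 * fine (sqn P (Vdev T i))).

Lemma agg_sq_div c : agg_sq M c / n%:R = \sum_i mm_mu M i ^+ 2 * c i ^+ 2.
Proof.
(* Weights summing to one exclude an empty set of workers. *)
have n0 : n%:R != 0 :> R.
  have := fp_mu_sum hprob; case: (n) (mm_mu M) => [|m] mu.
    by rewrite big_ord0 => /eqP; rewrite eq_sym oner_eq0.
  by rewrite pnatr_eq0.
by rewrite /agg_sq mulrC mulKf.
Qed.

(** Summation takes place in the extended reals, since the initial gap may be infinite; only
    additions occur. *)
Lemma caseA_telescope T : omegap = 0 -> (forall t, 0 <= step_coef t) ->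
  (gap T + \sum_(t < T) (gam t.+1 / 2)%:E * 'E_P[Ebar t.+1] <=
   gap 0 + (\sum_(t < T) gam t.+1 / 2 * vmax * s2)%R%:E)%E.
Proof.
move=> o0 c0; elim: T => [|T IH]; first by rewrite !big_ord0 !adde0.
rewrite !big_ord_recr/= EFinD [leRHS]addeA.
have := caseA_step hprob hmin hmm hin horacle hcomp hpart hindep hfield hmetric hclosed o0 (c0 T).
move=> h; apply: le_trans (leeD IH (lexx _)).
by rewrite [leRHS]addeAC [leLHS]addeCA addeC leeD2r.
Qed.

Hypotheses (o0 : 0 < omegap) (a0 : 0 < alpha) (a1 : alpha * (1 + omegap) <= 1)
  (c0 : forall t, 0 < step_coef t) (gam_noninc : forall t, gam t.+2 <= gam t.+1)
  (l2_small : forall t, 3 * (omegap / alpha ^+ 2) * (vmax / vmin) * l2 * gam t.+1 ^+ 2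
     <= 2^-1 - gam t.+1 * C / vmin)
  (fgap : gap 0 \is a fin_num) (fV : forall i, sqn P (Vdev 0 i) \is a fin_num).

Lemma caseB_round t : gap t \is a fin_num ->
  (forall i, sqn P (Vdev t i) \is a fin_num) ->
  [/\ gap t.+1 \is a fin_num, forall i, sqn P (Vdev t.+1 i) \is a fin_num,
      'E_P[Ebar t.+1]%E \is a fin_num & exists s, [/\ 0 <= s,
      fine (gap t.+1) + gam t.+1 / 2 * fine 'E_P[Ebar t.+1]%E + step_coef t * vmin * s <=
        fine (gap t) + gam t.+1 / 2 * vmax * ((1 + omegap) * s2 + omegap * Vn t) &
      Vn t.+1 <= (1 - alpha / 2) * Vn t + 3 * alpha / 2 * s2 + 3 / alpha * l2 * s]].
Proof.
move=> fg fv.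
have [x' [e [s [v' [xE eE vE [e0 s0] [h1 h2]]]]]] :=
  caseB_step hprob hmin hmm hin horacle hcomp hpart hindep hfield hmetric hclosed
    o0 a0 a1 (c0 t) (esym (fineK fg)) (fun i => esym (fineK (fv i))).
have ex : x' = fine (gap t.+1) by rewrite xE.
have ee : e = fine 'E_P[Ebar t.+1]%E by rewrite eE.
have ev : v' = fun i => fine (sqn P (Vdev t.+1 i)) by apply/funext => i; rewrite vE.
subst x' e v'; split.
- by rewrite xE.
- by move=> i; rewrite vE.
- by rewrite eE.
- by exists s; split.
Qed.

Lemma caseB_fin t : gap t \is a fin_num /\ forall i, sqn P (Vdev t i) \is a fin_num.
Proof.
elim: t => [//|t [fg fv]].
by have [fg' fv' _ _] := caseB_round fg fv.
Qed.

(** The abstract step sequence is shifted, its entry t being the step size of index t.+1; hence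
    [gam T.+1] in front of [Vn T]. *)
Lemma caseB_telescope T :
  fine (gap T) + vmax * omegap / alpha * gam T.+1 * Vn T
    + \sum_(t < T) gam t.+1 / 2 * fine 'E_P[Ebar t.+1]%E <=
  fine (gap 0) + vmax * omegap / alpha * gam 1%N * Vn 0
    + vmax * s2 * ((1 + omegap) / 2 + 3 * omegap / 2) * \sum_(t < T) gam t.+1.
Proof.
have vx0 : 0 < vmax by have /andP[h1 h2] := ma_v hmetric; exact: lt_le_trans h2.
apply: (lyapunov_telescope (x := fun t => fine (gap t)) (v := fun t => Vn t)
  (e := fun t => fine 'E_P[Ebar t.+1]%E) (gam := fun t => gam t.+1)
  (c := C) (l2 := l2) a0 o0 (vmin_gt0 hmetric) vx0 (gam_gt0 hin) gam_noninc l2_small).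
- move=> t; apply: sumr_ge0 => i _; rewrite mulr_ge0 ?sqr_ge0//.
  by apply: fine_ge0; exact: sqn_ge0.
- move=> t; have [fg fv] := caseB_fin t.
  by have [_ _ _ [s hs]] := caseB_round fg fv; exists s.
Qed.

End telescoping.

(** * The two bounds on the weighted sum of expected squared displacements *)

Theorem theorem1 (R : realType) (n p d q : nat) (M : mm_data R n p d q)
    (dO : measure_display) (Omega : measurableType dO)
    (P : probability Omega R)
    (dE : measure_display) (E : measurableType dE)
    (I : fedmm_input R n q Omega E)
    (fgmin : R) (sig L : 'I_n -> R)
    (nu : 'cV[R]_q -> probability 'cV[R]_q R)
    (omega Cstar Cstar2 vmin vmax : R)
    (hprob : federated_problem M)
    (hmin : is_min_value (mm_obj M) fgmin)
    (hmm : mm_framework M)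
    (hin : fedmm_admissible M I)
    (hsmooth : smoothness_assumption M)
    (horacle : oracle_assumption M I P sig)
    (hcomp : compression_assumption I P nu omega)
    (hpart : participation_assumption I P)
    (hindep : sources_independent M I P)
    (hfield : field_assumption M L)
    (hmetric : metric_assumption M (fi_B I) Cstar Cstar2 vmin vmax)
    (hclosed : closed (mm_S M)) :
  let gamma := fi_gamma I in
  let alpha := fi_alpha I in
  let omegap := omega_part omega (fi_p I) in
  let C := Cbar M Cstar Cstar2 in
  let sigma2 := agg_sq M sig in
  let L2 := agg_sq M L in
  let gap0 := (\int[P]_w (mm_obj M (mm_T M (Shat M I 0 w)) - fgmin%:E))%E in
  let coefA t := 1 - 2 * C / vmin * gamma t in
  let coefB t := 1 - 2 * C / vmin * gamma t
    - 64 * (omegap / alpha ^+ 2) * (vmax / vmin) * (L2 / n%:R)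
      * gamma t ^+ 2 in
  (omegap = 0 -> 0 <= alpha <= 1 ->
   (forall t, 0 < gamma t.+1 < vmin / (2 * C)) ->
   forall T : nat, (0 < T)%N ->
     (\sum_(1 <= t < T.+1)
        (gamma t / 4 * coefA t)%:E * 'E_P[Ebar M I t]
      <= gap0
         + (vmax * (sigma2 / n%:R) * \sum_(1 <= t < T.+1) gamma t)%:E)%E)
  /\
  (0 < omegap -> 0 < alpha <= 1 / (1 + omegap) ->
   (forall t, (1 <= t)%N ->
      [/\ 0 < gamma t, gamma t.+1 <= gamma t, gamma t <= gamma 1%N
        & 0 < coefB t]) ->
   (* no constraint when L = 0 *)
   (0 < L2 ->
      gamma 1%N <= alpha / (4 * Num.sqrt omegap)
        * (Num.sqrt vmin / Num.sqrt vmax)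
        * (Num.sqrt n%:R / Num.sqrt L2)) ->
   forall T : nat, (0 < T)%N ->
     (\sum_(1 <= t < T.+1)
        (gamma t / 4 * coefB t)%:E * 'E_P[Ebar M I t]
      <= gap0
         + (4 * omegap * vmax / alpha * gamma 1%N)%:E
           * (\sum_i (mm_mu M i ^+ 2)%:E
                * 'E_P[(fun w => enorm (fi_V0 I i w
                                        - mm_hi M i (Shat M I 0 w)) ^+ 2)%R])
         + (2 * vmax * (1 + 5 * omegap) * (sigma2 / n%:R)
            * \sum_(1 <= t < T.+1) gamma t)%:E)%E).
Proof.
move=> gamma alpha omegap C sigma2 L2 gap0 coefA coefB.
have gap0E : gap0 = Egap M P I fgmin 0 := Egap0E P fgmin hprob hmm hin hmetric hclosed.
have v0 : 0 < vmin := vmin_gt0 hmetric.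
have vx0 : 0 < vmax by have /andP[h1 h2] := ma_v hmetric; exact: lt_le_trans h2.
have C0 : 0 < C := Cbar_gt0 hfield hmetric.
have g0 t : 0 < gamma t.+1 := gam_gt0 hin t.
have s2E : sigma2 / n%:R = \sum_i mm_mu M i ^+ 2 * sig i ^+ 2 := agg_sq_div hprob sig.
have l2E : L2 / n%:R = \sum_i mm_mu M i ^+ 2 * L i ^+ 2 := agg_sq_div hprob L.
have s20 : 0 <= sigma2 / n%:R.
  by rewrite s2E; apply: sumr_ge0 => i _; rewrite mulr_ge0 ?sqr_ge0.
have l20 : 0 <= L2 / n%:R.
  by rewrite l2E; apply: sumr_ge0 => i _; rewrite mulr_ge0 ?sqr_ge0.
split=> [op0 _ gle T T0|op0 /andP[a0 a1] hg _ T T0]; rewrite gap0E !big_nat1_ord.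
  (* A step below vmin / (2 C) keeps the surplus of the descent nonnegative. *)
  have c0 t : 0 <= step_coef M I Cstar Cstar2 vmin t.
    rewrite /step_coef -/gamma -/C mulr_ge0 ?invr_ge0 ?(ltW (g0 t))// subr_ge0.
    rewrite ler_pdivrMr//; have /andP[_] := gle t.
    by rewrite ltr_pdivlMr ?mulr_gt0// => h; lra.
  have tele := caseA_telescope hprob hmin hmm hin horacle hcomp hpart hindep hfield hmetric hclosed T op0 c0.
  (* The descent gives the weight gamma / 2, which dominates gamma / 4 times a coefficient at most
     1. *)
  apply: (@le_trans _ _ (\sum_(t < T) (gamma t.+1 / 2)%:E * 'E_P[Ebar M I t.+1])%E).
    apply: lee_sum => t _; apply: lee_wpmul2r; first exact: (EEbar_ge0 P hin hmetric hclosed).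
    rewrite lee_fin /coefA.
    have := mulr_ge0 (ltW (g0 t)) (mulr_ge0 (divr_ge0 (mulr_ge0 (ler0n R 2) (ltW C0)) (ltW v0)) (ltW (g0 t))).
    have := g0 t; lra.
  apply: le_trans (le_trans tele _).
    by rewrite leeDr// (Egap_ge0 P hprob hmin hmm hin hmetric hclosed).
  rewrite leeD2l// lee_fin mulr_sumr; apply: ler_sum => t _.
  rewrite -s2E -/gamma; have := mulr_ge0 (mulr_ge0 (ltW (g0 t)) (ltW vx0)) s20; lra.
have a1' : alpha * (1 + omegap) <= 1.
  by move: a1; rewrite ler_pdivlMr// addr_gt0.
have X0 t : 0 <= (omegap / alpha ^+ 2) * (vmax / vmin) * (L2 / n%:R) * gamma t.+1 ^+ 2.
  exact: mulr_ge0 (mulr_ge0 (mulr_ge0 (divr_ge0 (ltW op0) (sqr_ge0 alpha)) (divr_ge0 (ltW vx0) (ltW v0))) l20) (sqr_ge0 (gamma t.+1)).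
have XE k t : k * (omegap / alpha ^+ 2) * (vmax / vmin) * (L2 / n%:R) * gamma t.+1 ^+ 2 =
    k * ((omegap / alpha ^+ 2) * (vmax / vmin) * (L2 / n%:R) * gamma t.+1 ^+ 2) by rewrite !mulrA.
have c0 t : 0 < step_coef M I Cstar Cstar2 vmin t.
  rewrite /step_coef -/gamma -/C mulr_gt0 ?invr_gt0 ?g0//.
  have [_ _ _] := hg t.+1 isT; rewrite /coefB.
  have := X0 t; rewrite XE.
  have -> : 2 * C / vmin * gamma t.+1 = 2 * (gamma t.+1 * C / vmin) by ring.
  lra.
have gn t : gamma t.+2 <= gamma t.+1 by have [] := hg t.+1 isT.
(* With X the product that follows the numeric factor, positivity of [coefB] gives 32 X < 1/2 -
   gamma C / vmin, which covers 3 X. *)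
have lsmall t : 3 * (omegap / alpha ^+ 2) * (vmax / vmin) *
    (\sum_i mm_mu M i ^+ 2 * L i ^+ 2) * gamma t.+1 ^+ 2 <= 2^-1 - gamma t.+1 * C / vmin.
  rewrite -l2E; have [_ _ _] := hg t.+1 isT; rewrite /coefB.
  have := X0 t.
  have -> : 2 * C / vmin * gamma t.+1 = 2 * (gamma t.+1 * C / vmin) by ring.
  rewrite !XE; lra.
have EV i : 'E_P[(fun w => enorm (fi_V0 I i w - mm_hi M i (Shat M I 0 w)) ^+ 2)%R]%E =
    sqn P (Vdev M I 0 i) by rewrite expectation.unlock.
under [X in (_ + _ * X + _)%E]eq_bigr do rewrite EV.
set SV := (\sum_(i < n) _)%E.
have SV0 : (0 <= SV)%E.
  by apply: sume_ge0 => i _; rewrite mule_ge0 ?sqn_ge0// lee_fin sqr_ge0.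
set Gs := \sum_(t < T) gamma t.+1.
have Gs0 : 0 <= Gs by apply: sumr_ge0 => t _; exact: ltW.
set k := 4 * omegap * vmax / alpha * gamma 1%N.
have k0 : 0 < k by rewrite /k !mulr_gt0 ?invr_gt0// g0.
have gp0 : (0 <= Egap M P I fgmin 0)%E := Egap_ge0 P hprob hmin hmm hin hmetric hclosed 0.
have kSV0 : (0 <= k%:E * SV)%E by rewrite mule_ge0// lee_fin ltW.
set K2 := 2 * vmax * (1 + 5 * omegap) * (sigma2 / n%:R) * Gs.
have K20 : (0 <= K2%:E)%E.
  rewrite lee_fin; apply: mulr_ge0 => //; apply: mulr_ge0 => //.
  by apply: mulr_ge0; [exact: mulr_ge0 (ler0n R 2) (ltW vx0) | have := op0; lra].
(* An infinite right-hand side leaves nothing to prove; a finite one makes the initial gap and, the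
   weights being positive, every initial deviation finite, and the recursion then runs in the
   reals. *)
have [->|] := eqVneq (Egap M P I fgmin 0 + k%:E * SV + K2%:E)%E +oo%E; first exact: leey.
rewrite -ltey => fin.
have fgap : Egap M P I fgmin 0 \is a fin_num.
  rewrite ge0_fin_numE//; apply: le_lt_trans fin.
  by rewrite -addeA leeDl// adde_ge0.
have fSV : SV \is a fin_num.
  apply: (mule_fin_num k0 SV0); apply: le_lt_trans fin.
  by rewrite addeAC leeDr// adde_ge0.
have fV i : sqn P (Vdev M I 0 i) \is a fin_num.
  have mu0 : 0 < mm_mu M i ^+ 2 by rewrite exprn_gt0// (fp_mu_gt0 hprob).
  apply: (mule_fin_num mu0 (sqn_ge0 _ _)).
  apply: (@le_lt_trans _ _ SV); last by rewrite ltey_eq fSV.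
  rewrite /SV (bigD1 i)//= leeDl// sume_ge0// => j _.
  by rewrite mule_ge0 ?sqn_ge0// lee_fin sqr_ge0.
have tele := caseB_telescope hprob hmin hmm hin horacle hcomp hpart hindep hfield hmetric hclosed
  op0 a0 a1' c0 gn lsmall fgap fV T.
have fE t : 'E_P[Ebar M I t.+1]%E \is a fin_num.
  have [fg fv] := caseB_fin hprob hmin hmm hin horacle hcomp hpart hindep hfield hmetric hclosed
    op0 a0 a1' c0 fgap fV t.
  by have [] := caseB_round hprob hmin hmm hin horacle hcomp hpart hindep hfield hmetric hclosed
    op0 a0 a1' c0 fg fv.
have gT0 : 0 <= fine (Egap M P I fgmin T).
  by apply: fine_ge0; exact: (Egap_ge0 P hprob hmin hmm hin hmetric hclosed).
have -> : (\sum_(t < T) (gamma t.+1 / 4 * coefB t.+1)%:E * 'E_P[Ebar M I t.+1] =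
    (\sum_(t < T) gamma t.+1 / 4 * coefB t.+1 * fine 'E_P[Ebar M I t.+1]%E)%R%:E)%E.
  rewrite -sumEFin; apply: eq_bigr => t _.
  by rewrite [in RHS]EFinM fineK//; exact: fE.
have SVE : SV = (\sum_i mm_mu M i ^+ 2 * fine (sqn P (Vdev M I 0 i)))%:E.
  by rewrite -sumEFin; apply: eq_bigr => i _; rewrite [in RHS]EFinM fineK.
rewrite SVE -(fineK fgap) -EFinM -!EFinD lee_fin.
have kV0 t : 0 <= vmax * omegap / alpha * gamma t.+1 *
    (\sum_i mm_mu M i ^+ 2 * fine (sqn P (Vdev M I t i))).
  apply: mulr_ge0.
    exact: mulr_ge0 (divr_ge0 (mulr_ge0 (ltW vx0) (ltW op0)) (ltW a0)) (ltW (g0 t)).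
  by apply: sumr_ge0 => i _; apply: mulr_ge0 (sqr_ge0 _) (fine_ge0 (sqn_ge0 _ _)).
have SBE : \sum_(t < T) gamma t.+1 / 4 * coefB t.+1 * fine 'E_P[Ebar M I t.+1]%E <=
    \sum_(t < T) gamma t.+1 / 2 * fine 'E_P[Ebar M I t.+1]%E.
  apply: ler_sum => t _; apply: ler_wpM2r.
    by apply: fine_ge0; exact: (EEbar_ge0 P hin hmetric hclosed).
  rewrite /coefB.
  have h1 := X0 t; rewrite XE.
  have h2 : 0 <= 2 * C / vmin * gamma t.+1 :=
    mulr_ge0 (divr_ge0 (mulr_ge0 (ler0n R 2) (ltW C0)) (ltW v0)) (ltW (g0 t)).
  exact: quarter_coef_le (ltW (g0 t)) h2 (mulr_ge0 (ler0n R 64) h1).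
have h1 : 0 <= vmax * (sigma2 / n%:R) * Gs := mulr_ge0 (mulr_ge0 (ltW vx0) s20) Gs0.
rewrite -s2E in tele.
exact: (caseB_arith tele gT0 (kV0 T) (kV0 0) SBE h1 (ltW op0)).
Qed.
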